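(* Let $\rho$ be either smooth tempered of exponential type or Gaussian, $\rho(x)=\beta e^{-\alpha|x|^2}$, and let $g(h)=1-\lambda_1(h)$ be the spectral gap of $T_h$ on $L^2(\mathbb R^d,d\nu_h)$. There exist $C>0$ and $h_0>0$ such that for all $n\in\mathbb N$, $h\in(0,h_0]$ and $\tau>0$, $$\sup_{|x|<\tau}\|T_h^n(x,dy)-d\nu_h\|_{TV}\le Cq(\tau,h)e^{-ng(h)},$$ where $q(\tau,h)=e^{\alpha\tau(\tau+3h)}$ in the Gaussian case and $q(\tau,h)=h^{-d/2}\sup_{|x|<\tau}\frac1{\rho(x)}$ in the tempered case.
   Context: $\rho\in C^1(\mathbb R^d)$ strictly positive, bounded, $\int\rho\,dx=1$. Smooth tempered of exponential type means $\rho\in C^\infty$ and there are $C_\beta>0$, $R>0$, $\kappa_0>0$ with $|\partial^\beta\rho(x)|\le C_\beta\rho(x)$ for all $\beta$ and $\sum_i\partial_{x_i}^2\rho(x)\ge\kappa_0\rho(x)$ for $|x|\ge R$. $m_h(x)=\int_{|y-x|<h}\rho(y)dy$. $T_h$ is the Markov operator $T_hf(x)=\frac1{m_h(x)}\int_{|y-x|<h}f(y)\rho(y)dy$ with kernel $t_h(x,dy)=\frac{\rho(y)}{m_h(x)}\mathbf 1_{|x-y|<h}dy$; $T_h^n(x,dy)$ is the $n$-step kernel. $d\nu_h=Z_h^{-1}m_h(x)\rho(x)dx$ is the stationary probability measure; $T_h$ is self-adjoint on $L^2(\mathbb R^d,d\nu_h)$ with $1$ a simple eigenvalue (constants), and $\lambda_1(h)$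 denotes the supremum of the spectrum of $T_h$ other than the eigenvalue $1$ (the second largest eigenvalue). For probability measures, $\|\mu-\nu\|_{TV}=\sup_A|\mu(A)-\nu(A)|$ over measurable $A$. *)

(* Defs.v *)
From HB Require Import structures.
From mathcomp Require Import all_boot all_order all_algebra.
From mathcomp Require Import all_classical all_reals all_analysis.
Set Implicit Arguments. Unset Strict Implicit. Unset Printing Implicit Defensive.
Import Order.TTheory GRing.Theory Num.Theory.
Import numFieldNormedType.Exports.
Local Open Scope classical_set_scope.
Local Open Scope ring_scope.

Section Defs.
Variable R : realType.

Definition enorm (d : nat) (x : 'rV[R]_d) : R := Num.sqrt (\sum_i x ord0 i ^+ 2).

(* Lebesgue integral over R^d of a nonnegative (extended-real valued) function,
   realized as the iterated one-dimensional Lebesgue integral (Tonelli). *)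
Fixpoint intd (d : nat) : ('rV[R]_d -> \bar R) -> \bar R :=
  match d return ('rV[R]_d -> \bar R) -> \bar R with
  | 0 => fun f => f 0
  | d'.+1 => fun f =>
      (\int[@lebesgue_measure R]_(x in [set: R])
         intd (fun v : 'rV[R]_d' => f (row_mx (\row_(_ < 1) x) v)))%E
  end.

Definition borelRd (d : nat) (A : set 'rV[R]_d) : Prop := <<s open >> A.

Definition borel_fun (d : nat) (f : 'rV[R]_d -> R) : Prop :=
  forall B : set R, measurable B -> borelRd (f @^-1` B).

Definition ecoord (d : nat) (i : 'I_d) : 'rV[R]_d := delta_mx ord0 i.

(* Iterated partial derivative along the coordinates listed in s
   (a multi-index written as a list of coordinates). *)
Definition dpart (d : nat) (s : seq 'I_d) (f : 'rV[R]_d -> R) : 'rV[R]_d -> R :=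
  foldr (fun i g => fun x => 'D_(ecoord i) g x) f s.

Definition C1 (d : nat) (f : 'rV[R]_d -> R) : Prop :=
  continuous f /\ (forall x i, derivable f x (ecoord i)) /\
  (forall i, continuous (dpart [:: i] f)).

Definition smooth (d : nat) (f : 'rV[R]_d -> R) : Prop :=
  forall s : seq 'I_d,
    continuous (dpart s f) /\ (forall x i, derivable (dpart s f) x (ecoord i)).

Definition density (d : nat) (rho : 'rV[R]_d -> R) : Prop :=
  C1 rho /\ (forall x, 0 < rho x) /\ (exists M, forall x, rho x <= M) /\
  intd (fun x => (rho x)%:E) = 1%E.

Definition tempered_exp (d : nat) (rho : 'rV[R]_d -> R) : Prop :=
  smooth rho /\
  (forall s : seq 'I_d, exists C, 0 < C /\ forall x, `|dpart s rho x| <= C * rho x) /\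
  (exists R0 kappa0, 0 < R0 /\ 0 < kappa0 /\
     forall x, R0 <= enorm x -> kappa0 * rho x <= \sum_i dpart [:: i; i] rho x).

Section Operator.
Variables (d : nat) (rho : 'rV[R]_d -> R) (h : R).

Definition ballI (x y : 'rV[R]_d) : R := ((enorm (y - x) < h)%R : bool)%:R.

Definition mh (x : 'rV[R]_d) : R := fine (intd (fun y => (ballI x y * rho y)%:E)).

Fixpoint Tn (n : nat) (x : 'rV[R]_d) (A : set 'rV[R]_d) : \bar R :=
  match n with
  | 0 => (\1_A x)%:E
  | n'.+1 => ((mh x)^-1)%:E * intd (fun y => (ballI x y * rho y)%:E * Tn n' y A)
  end%E.

Definition Zh : R := fine (intd (fun y => (mh y * rho y)%:E)).

Definition nuh (A : set 'rV[R]_d) : \bar R :=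
  ((Zh)^-1)%:E * intd (fun y => (\1_A y * mh y * rho y)%:E).

Definition TVdist (n : nat) (x : 'rV[R]_d) : \bar R :=
  ereal_sup [set abse (Tn n x A - nuh A)%E | A in @borelRd d].

Definition L2 (f : 'rV[R]_d -> R) : Prop :=
  borel_fun f /\ (intd (fun y => (f y ^+ 2 * mh y * rho y)%:E) < +oo)%E.

Definition sint (f : 'rV[R]_d -> R) : \bar R :=
  (intd (fun y => (Num.max (f y) 0)%:E) - intd (fun y => (Num.max (- f y) 0)%:E))%E.

Definition Th (f : 'rV[R]_d -> R) (x : 'rV[R]_d) : R :=
  (mh x)^-1 * fine (sint (fun y => ballI x y * f y * rho y)).

Definition ae0 (f : 'rV[R]_d -> R) : Prop := nuh [set y | f y != 0] = 0%E.

(* lambda in the spectrum of T_h on L^2(nu_h): T_h - lambda is not a bijection of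
   L^2(nu_h) (elements being classes modulo nu_h-a.e. equality). *)
Definition in_spectrum (lambda : R) : Prop :=
  ~ ((forall f, L2 f -> ae0 (fun x => Th f x - lambda * f x) -> ae0 f) /\
     (forall g, L2 g -> exists f, L2 f /\ ae0 (fun x => Th f x - lambda * f x - g x))).

(* second largest eigenvalue: supremum of the spectrum other than 1 *)
Definition lambda1 : R := sup [set l | in_spectrum l /\ l != 1].

Definition spectral_gap : R := 1 - lambda1.

Definition supTV (n : nat) (tau : R) : \bar R :=
  ereal_sup [set TVdist n x | x in [set x | enorm x < tau]].

End Operator.
End Defs.

(* Main.v *)
Require Import Defs.
From HB Require Import structures.
From mathcomp Require Import all_boot all_order all_algebra.
From mathcomp Require Import all_classical all_reals all_analysis.
From mathcomp Require Import measurable_realfun ring lra zify.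
Set Implicit Arguments. Unset Strict Implicit. Unset Printing Implicit Defensive.
Import Order.TTheory GRing.Theory Num.Theory.
Import numFieldNormedType.Exports.
Local Open Scope classical_set_scope.
Local Open Scope ring_scope.

(** The operator T of the walk is symmetric on L^2(nu), fixes only the constants, and its
    quadratic form is at least -(1 - delta) |f|^2 with delta independent of h, because the
    indicator of |x - y| < h dominates the composition of the half-radius ball kernel with
    itself, which is positive semidefinite. A truncated coordinate is a test function showing
    that the gap g is at most C h^2, hence smaller than delta; so T^n contracts the orthogonal
    complement of the constants by e^(-n g). No spectral theorem is needed: absence of spectrum
    in (lambda1, 1) makes (1 - T)(T - a) nonpositive for lambda1 < a < 1, and this controls T
    on the closure of the range of 1 - T.

    It remains to bound |T^n0 f (x)| by K(x) |f| for one n0. In the tempered case n0 = 1, by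
    Cauchy-Schwarz and the Harnack inequality rho(y) >= e^(-L |x - y|) rho(x). In the Gaussian
    case convexity gives m_h >= e^(-alpha h^2) |B_h| rho, hence
    |T^n f| <= e^(n alpha h^2) rho^-1 P^n(rho |f|) for the ball walk P of Lebesgue measure, and
    Nash's argument bounds P^n0 from L^2 to L^oo, uniformly in h, for some n0 <= K / h^2. *)

(** * Spectral gap of a symmetric contraction *)

(** Two obstacles shape the proof. The spectrum is defined by failure of algebraic bijectivity, so a
    value outside it must first be shown to give an operator bounded below; this is a bounded
    inverse theorem, obtained from symmetry and completeness. And in the Gaussian case [q] carries
    no negative power of h: a single step would cost h^(-d/2), so about h^(-2) steps have to be
    spent on regularisation. Over that many steps only a factor e^(O(h^2)) may be lost per step,
    which the convexity bound provides; the log-gradient of a Gaussian is unbounded, so a Harnack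
    constant uniform in x does not exist. The bound g <= C h^2 serves three times: it puts lambda1
    above the bottom of the quadratic form, it keeps the factor e^(n0 g) of the sacrificed steps
    bounded, and it makes the trivial bound 1 sufficient for n < n0. The integrals of the statement
    are iterated one-dimensional ones; they are first identified with integrals for a sigma-finite
    measure, so that Tonelli's theorem applies. Dimension 0 is separate, since no coordinate is
    available for the test function. *)

Lemma exists_expr_lt (R : realType) (r e : R) : 0 <= r -> r < 1 -> 0 < e ->
  exists n, r ^+ n < e.
Proof.
move=> r0 r1 e0.
have /cvgrPdist_lt/(_ _ e0) : (GRing.exp r) @ \oo --> (0 : R).
  by apply: cvg_expr; rewrite ger0_norm.
case=> N _ /(_ N (leqnn N)) /=; rewrite sub0r normrN ger0_norm ?exprn_ge0// => h.
by exists N.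
Qed.

(** Replaces passages to the limit in [E], which carries no topology: a quantity that must vanish is
    bounded by every term of a geometric sequence. *)
Lemma le_geometric_le0 (R : realType) (x K r : R) : 0 <= r -> r < 1 ->
  (forall n, x <= K * r ^+ n) -> x <= 0.
Proof.
move=> r0 r1 h; rewrite leNgt; apply/negP => x0.
have K0 : 0 < K by have := h 0; rewrite expr0 mulr1; exact: lt_le_trans.
have [n] := exists_expr_lt r0 r1 (divr_gt0 x0 K0).
by rewrite ltr_pdivlMr// mulrC; rewrite ltNge h.
Qed.

Section SymmetricContraction.
Variables (R : realType) (E : lmodType R) (ip : E -> E -> R).

Definition bilinear_form (q : E -> E -> R) :=
  (forall u v, q u v = q v u) /\
  (forall a u v w, q (a *: u + v) w = a * q u w + q v w).

Lemma form_expand (q : E -> E -> R) (bq : bilinear_form q) a u v :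
  q (a *: u + v) (a *: u + v) = a ^+ 2 * q u u + 2 * a * q u v + q v v.
Proof.
case: bq => qC qL; rewrite qL (qC u) (qC v) !qL (qC v u); ring.
Qed.

(** The quadratic in [a] is nonnegative at its minimiser. When [q u u = 0] it is affine, and a
    nonzero slope would let it take the value -1. *)
Lemma form_CauchySchwarz (q : E -> E -> R) (bq : bilinear_form q) :
  (forall u, 0 <= q u u) -> forall u v, q u v ^+ 2 <= q u u * q v v.
Proof.
move=> q0 u v.
have H a : 0 <= a ^+ 2 * q u u + 2 * a * q u v + q v v.
  by rewrite -form_expand.
have [uu|uu] := eqVneq (q u u) 0.
  have [->|uv] := eqVneq (q u v) 0; first by rewrite uu expr0n mul0r.
  have := H (- (q v v + 1) / (2 * q u v)); rewrite uu.
  have -> : (- (q v v + 1) / (2 * q u v)) ^+ 2 * 0 +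
    2 * (- (q v v + 1) / (2 * q u v)) * q u v + q v v = -1 by field.
  lra.
have uu0 : 0 < q u u by rewrite lt_def uu q0.
have := H (- q u v / q u u).
have -> : (- q u v / q u u) ^+ 2 * q u u + 2 * (- q u v / q u u) * q u v + q v v
  = (q u u * q v v - q u v ^+ 2) / q u u by field.
by rewrite pmulr_lge0 ?invr_gt0// subr_ge0.
Qed.

Hypothesis ip_bil : bilinear_form ip.
Hypothesis ip_ge0 : forall u, 0 <= ip u u.

(** Only a seminorm: [ip u u = 0] does not force [u = 0]. Functions can then serve as vectors
    without a quotient by almost everywhere equality, and equations between vectors are written
    [nrm _ = 0]. *)
Definition nrm u := Num.sqrt (ip u u).

Lemma ipC u v : ip u v = ip v u. Proof. by case: ip_bil. Qed.
Lemma ipPl a u v w : ip (a *: u + v) w = a * ip u w + ip v w.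
Proof. by case: ip_bil. Qed.
Lemma ip0l w : ip 0 w = 0.
Proof. by have := ipPl 1 0 0 w; rewrite scaler0 add0r; lra. Qed.
Lemma ipDl u v w : ip (u + v) w = ip u w + ip v w.
Proof. by have := ipPl 1 u v w; rewrite scale1r mul1r. Qed.
Lemma ipZl a u w : ip (a *: u) w = a * ip u w.
Proof. by have := ipPl a u 0 w; rewrite ip0l !addr0. Qed.
Lemma ipNl u w : ip (- u) w = - ip u w.
Proof. by rewrite -scaleN1r ipZl mulN1r. Qed.
Lemma ipBl u v w : ip (u - v) w = ip u w - ip v w.
Proof. by rewrite ipDl ipNl. Qed.
Lemma ipDr u v w : ip w (u + v) = ip w u + ip w v.
Proof. by rewrite ipC ipDl !(ipC w). Qed.
Lemma ipZr a u w : ip w (a *: u) = a * ip w u.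
Proof. by rewrite ipC ipZl !(ipC w). Qed.
Lemma ipNr u w : ip w (- u) = - ip w u.
Proof. by rewrite ipC ipNl !(ipC w). Qed.
Lemma ipBr u v w : ip w (u - v) = ip w u - ip w v.
Proof. by rewrite ipDr ipNr. Qed.

Definition ipE := (ipDl, ipDr, ipBl, ipBr, ipNl, ipNr, ipZl, ipZr).

Lemma nrm_ge0 u : 0 <= nrm u. Proof. exact: sqrtr_ge0. Qed.
Lemma sqr_nrm u : nrm u ^+ 2 = ip u u. Proof. by rewrite sqr_sqrtr. Qed.
Lemma ler_sqr_nrm u v (c : R) : 0 <= c ->
  (ip u u <= c ^+ 2 * ip v v) = (nrm u <= c * nrm v).
Proof.
move=> c0; rewrite -!sqr_nrm -exprMn ler_sqr// nnegrE ?mulr_ge0// nrm_ge0//.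
Qed.
Lemma nrm_eq0 u : nrm u = 0 <-> ip u u = 0.
Proof.
split=> [h|h]; first by rewrite -sqr_nrm h expr0n.
by rewrite /nrm h sqrtr0.
Qed.
Lemma nrm0 : nrm 0 = 0. Proof. by apply/nrm_eq0; rewrite ip0l. Qed.
Lemma nrmZ a u : nrm (a *: u) = `|a| * nrm u.
Proof. by rewrite /nrm !ipE mulrA -expr2 sqrtrM ?sqr_ge0// sqrtr_sqr. Qed.
Lemma nrmN u : nrm (- u) = nrm u.
Proof. by rewrite -scaleN1r nrmZ normrN1 mul1r. Qed.
Lemma nrmB u v : nrm (u - v) = nrm (v - u).
Proof. by rewrite -nrmN opprB. Qed.

Lemma ip_CauchySchwarz u v : `|ip u v| <= nrm u * nrm v.
Proof.
rewrite -ler_sqr ?nnegrE ?mulr_ge0 ?nrm_ge0// exprMn !sqr_nrm real_normK ?num_real//.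
exact: form_CauchySchwarz.
Qed.

Lemma ip_le_nrm u v : ip u v <= nrm u * nrm v.
Proof. exact: le_trans (ler_norm _) (ip_CauchySchwarz _ _). Qed.

Lemma ler_nrmD u v : nrm (u + v) <= nrm u + nrm v.
Proof.
rewrite -ler_sqr ?nnegrE ?addr_ge0 ?nrm_ge0// sqr_nrm sqrrD !sqr_nrm !ipE (ipC v u).
have := ip_le_nrm u v; lra.
Qed.

Lemma ler_nrmB u v : nrm (u - v) <= nrm u + nrm v.
Proof. by rewrite -(nrmN v) ler_nrmD. Qed.

Lemma ler_nrm_dist u v w : nrm (u - w) <= nrm (u - v) + nrm (v - w).
Proof. by have := ler_nrmD (u - v) (v - w); rewrite addrA subrK. Qed.

Lemma nrm_le0 u : nrm u <= 0 -> nrm u = 0.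
Proof. by move=> h; apply/eqP; rewrite eq_le h nrm_ge0. Qed.

Lemma ip_nrm0 u v : nrm u = 0 -> ip u v = 0.
Proof.
move=> u0; have := ip_CauchySchwarz u v.
by rewrite u0 mul0r normr_le0 => /eqP.
Qed.

(* Only geometrically convergent sequences ever need a limit. *)
Hypothesis complete : forall (u : nat -> E) (C r : R), 0 <= C -> 0 < r -> r < 1 ->
  (forall n, nrm (u n.+1 - u n) <= C * r ^+ n) ->
  exists l, forall n, nrm (u n - l) <= C / (1 - r) * r ^+ n.

Section BoundedOperators.
Variable B : E -> E.
Hypothesis B_lin : forall a u v, B (a *: u + v) = a *: B u + B v.
Hypothesis B_sym : forall u v, ip (B u) v = ip u (B v).

Lemma op0 : B 0 = 0.
Proof. by have := B_lin (-1) 0 0; rewrite scaler0 addr0 scaleN1r addNr. Qed.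
Lemma opZ a u : B (a *: u) = a *: B u.
Proof. by have := B_lin a u 0; rewrite op0 !addr0. Qed.
Lemma opD u v : B (u + v) = B u + B v.
Proof. by have := B_lin 1 u v; rewrite !scale1r. Qed.
Lemma opN u : B (- u) = - B u.
Proof. by rewrite -scaleN1r opZ scaleN1r. Qed.
Lemma opB u v : B (u - v) = B u - B v.
Proof. by rewrite opD opN. Qed.

Lemma op_form_bil : bilinear_form (fun u v => ip (B u) v).
Proof.
by split=> [u v|a u v w]; [rewrite B_sym ipC|rewrite B_lin ipPl].
Qed.

(** Cauchy-Schwarz for the semidefinite form <B u, v> at v = B u bounds |B u|^4 by <B u, u> <B B u,
    B u>, and the last factor is at most K |B u|^2. *)
Lemma positive_op_sqr_le (K : R) : (forall u, 0 <= ip (B u) u) ->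
  (forall u, ip (B u) u <= K * ip u u) ->
  forall u, ip (B u) (B u) <= K * ip (B u) u.
Proof.
move=> B0 BK u.
have /= := form_CauchySchwarz op_form_bil B0 u (B u).
have := BK (B u); have := B0 u; have := ip_ge0 (B u).
set x := ip (B u) (B u); set y := ip (B u) u; set z := ip _ _.
move=> x0 y0 zx; rewrite le_eqVlt in x0; case/orP: x0 => [/eqP x0 _|x0 h].
  rewrite -x0.
  have [->|yn] := eqVneq y 0; first by rewrite mulr0.
  have uu : 0 < ip u u.
    rewrite lt_def ip_ge0 andbT; apply: contra_neq yn => u0.
    by rewrite /y ipC; apply: ip_nrm0; apply/nrm_eq0.
  apply: mulr_ge0 => //; have := BK u; have := B0 u; rewrite -/y => _ yK.
  by rewrite -(pmulr_lge0 _ uu) (le_trans y0).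
have : x ^+ 2 <= y * (K * x) by rewrite (le_trans h)// ler_wpM2l.
by rewrite expr2 mulrCA mulrA ler_pM2r// .
Qed.

(** For a symmetric operator the numerical radius controls the norm: polarise between [u] and
    [r^-1 B u], then use the parallelogram law. The invariant subspace [P] is there because the form
    of T will be bounded only on the range of 1 - T. *)
Lemma form_bound_norm (P : E -> Prop) (r : R) : 0 < r ->
  (forall a u v, P u -> P v -> P (a *: u + v)) -> (forall u, P u -> P (B u)) ->
  (forall u, P u -> `|ip (B u) u| <= r * ip u u) ->
  forall u, P u -> nrm (B u) <= r * nrm u.
Proof.
move=> r0 Plin PB Pr u Pu; rewrite -ler_sqr_nrm; last exact: ltW.
have PB' := PB _ Pu.
have h1 := Pr _ (Plin r^-1 _ _ PB' Pu).
have h2 := Pr _ (Plin (- r^-1) _ _ PB' Pu).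
move: h1 h2; rewrite !ler_norml => /andP[_ h1] /andP[h2 _].
move: h1 h2; rewrite !(form_expand ip_bil) !(form_expand op_form_bil) (B_sym (B u) u).
set x := ip (B u) (B u); set y := ip (B (B u)) (B u); set z := ip (B u) u.
set w := ip u u => h1 h2.
have : 4 * r^-1 * x <= 2 * r * w + 2 * r^-1 * x.
  have -> : 2 * r * w + 2 * r^-1 * x =
     r * (r^-1 ^+ 2 * x + 2 * r^-1 * z + w) +
     r * ((- r^-1) ^+ 2 * x + 2 * - r^-1 * z + w) by field; rewrite gt_eqF.
  have -> : 4 * r^-1 * x = (r^-1 ^+ 2 * y + 2 * r^-1 * x + z) -
    ((- r^-1) ^+ 2 * y + 2 * - r^-1 * x + z) by ring.
  by rewrite -[X in _ <= _ + X]opprK lerB.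
have -> : 2 * r * w + 2 * r^-1 * x = 2 * r^-1 * (r ^+ 2 * w + x).
  by field; rewrite gt_eqF.
have -> : 4 * r^-1 * x = 2 * r^-1 * (2 * x) by ring.
by rewrite ler_pM2l ?mulr_gt0 ?invr_gt0//; lra.
Qed.

(* Sokal's gliding hump: vectors [f n] with [B (f n)] bounded and [nrm (f n) = 4 ^ n]
   give functionals that are bounded on the range of [B] but not at the sum of
   the series of [+- f n / 12 ^ n]. *)
Lemma bijective_bounded_below :
  (forall g, exists f, nrm (B f - g) = 0) ->
  (forall f, nrm (B f) = 0 -> nrm f = 0) ->
  exists2 c, 0 < c & forall f, c * nrm f <= nrm (B f).
Proof.
move=> Bsurj Binj; apply: contrapT => noc.
have ex n : exists f, nrm f = 4 ^+ n /\ nrm (B f) <= 1.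
  apply: contrapT => nof; apply: noc; exists (4 ^+ n)^-1; first by rewrite invr_gt0 exprn_gt0.
  move=> f; have [f0|f0] := eqVneq (nrm f) 0; first by rewrite f0 mulr0 nrm_ge0.
  have f1 : 0 < nrm f by rewrite lt_def f0 nrm_ge0.
  rewrite leNgt; apply/negP => lt; apply: nof; exists (4 ^+ n / nrm f *: f).
  have p4 : 0 < 4 ^+ n :> R by rewrite exprn_gt0.
  rewrite opZ !nrmZ ger0_norm ?divr_ge0 ?(ltW p4) ?(ltW f1)// divfK//; split=> //.
  rewrite mulrAC ler_pdivrMr// mul1r mulrC -ler_pdivlMr//.
  by rewrite mulrC ltW.
have {ex} [f Hf] := choice ex.
have nf n : nrm (f n) = 4 ^+ n by case: (Hf n).
have nBf n : nrm (B (f n)) <= 1 by case: (Hf n).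
pose sg (b : bool) : R := if b then 1 else -1.
pose v := fix v n := if n is k.+1 then
   v k + (sg (0 <= ip (f k) (v k)) * (12 ^+ k)^-1) *: f k else 0.
have dv n : nrm (v n.+1 - v n) <= 1 * 3^-1 ^+ n.
  rewrite /= addrAC subrr add0r nrmZ nf mul1r normrM.
  have -> : `|sg (0 <= ip (f n) (v n))| = 1 by rewrite /sg; case: ifP; rewrite ?normrN normr1.
  rewrite mul1r ger0_norm ?invr_ge0 ?exprn_ge0//.
  have -> : (12 : R) = 3 * 4 by rewrite -natrM.
  by rewrite exprMn invfM exprVn mulfVK// expf_neq0// pnatr_eq0.
have t0 : 0 < 3^-1 :> R by rewrite invr_gt0.
have t1 : 3^-1 < 1 :> R by rewrite invf_lt1// ltr1n.
have [l Hl] := complete ler01 t0 t1 dv.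
have [w Hw] := Bsurj l.
(* Since [l] is the image of [w] up to norm zero, symmetry moves [B] onto [f n], whose image is
   bounded. *)
have up n : ip (f n) l <= nrm w /\ - ip (f n) l <= nrm w.
  have -> : ip (f n) l = ip (B (f n)) w.
    rewrite B_sym; apply/eqP; rewrite -subr_eq0 -ipBr ipC ip_nrm0// nrmB//.
  have := ip_CauchySchwarz (B (f n)) w.
  rewrite ler_norml => /andP[h1 h2].
  have : nrm (B (f n)) * nrm w <= nrm w by rewrite ler_piMl ?nrm_ge0.
  by split; move: h1 h2; lra.
(* The n-th hump contributes |f n|^2 / 12^n = (4/3)^n, with a sign that avoids cancellation; the
   later terms can undo at most half of it. *)
have lo n : (4 / 3) ^+ n / 2 <= nrm w.
  have p3 : 0 < 3^-1 ^+ n :> R by rewrite exprn_gt0.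
  have tail : `|ip (f n) (v n.+1 - l)| <= (4 / 3) ^+ n / 2.
    apply: le_trans (ip_CauchySchwarz _ _) _.
    apply: le_trans (ler_wpM2l (nrm_ge0 _) (Hl n.+1)) _.
    rewrite nf exprMn exprS le_eqVlt; apply/orP; left; apply/eqP.
    have -> : (1 - 3^-1)^-1 = 3 / 2 :> R by field.
    by field.
  have hump : (4 / 3) ^+ n <= `|ip (f n) (v n.+1)|.
    have -> : ip (f n) (v n.+1) = ip (f n) (v n) + sg (0 <= ip (f n) (v n)) * (4 / 3) ^+ n.
      rewrite /= !ipE; congr (_ + _); rewrite -mulrA; congr (_ * _).
      rewrite -sqr_nrm nf.
      have -> : (12 : R) = 3 * 4 by rewrite -natrM.
      by rewrite !exprMn exprVn; field; rewrite !expf_neq0// pnatr_eq0.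
    have p43 : 0 <= (4 / 3) ^+ n :> R by rewrite exprn_ge0// divr_ge0.
    rewrite /sg; case: (leP 0 (ip (f n) (v n))) => h.
      by rewrite mul1r ger0_norm ?addr_ge0// lerDr.
    by rewrite mulN1r ler0_norm; lra.
  have : `|ip (f n) l| <= nrm w.
    by have [h1 h2] := up n; rewrite ler_norml; lra.
  have : `|ip (f n) (v n.+1)| <= `|ip (f n) (v n.+1 - l)| + `|ip (f n) l|.
    by rewrite ipBr -{1}(subrK (ip (f n) l) (ip (f n) (v n.+1))) ler_normD.
  move: tail hump; lra.
have wp : 0 < 2 * nrm w + 1 by have := nrm_ge0 w; lra.
have [|||n] := @exists_expr_lt R (3 / 4) (2 * nrm w + 1)^-1.
- by rewrite divr_ge0.
- lra.
- by rewrite invr_gt0.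
have := lo n.
have -> : (3 / 4) ^+ n = ((4 / 3) ^+ n)^-1 :> R by rewrite -exprVn invf_div.
have p43 : 0 < (4 / 3) ^+ n :> R by rewrite exprn_gt0// divr_gt0.
rewrite ltf_pV2 ?posrE//; lra.
Qed.

End BoundedOperators.

(** * Spectrum of a symmetric contraction and decay on the complement of the constants *)

Variable T : E -> E.
Hypothesis T_lin : forall a u v, T (a *: u + v) = a *: T u + T v.
Hypothesis T_sym : forall u v, ip (T u) v = ip u (T v).
Hypothesis T_contr : forall u, nrm (T u) <= nrm u.

Definition spectrum (l : R) :=
  ~ ((forall f, nrm (T f - l *: f) = 0 -> nrm f = 0) /\
     (forall g, exists f, nrm (T f - l *: f - g) = 0)).

(** For l > 1 the equation T f - l f = g is the fixed point problem f = l^-1 (T f - g) of a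
    contraction of ratio l^-1, and the iterates converge geometrically. *)
Lemma spectrum_le1 l : spectrum l -> l <= 1.
Proof.
move=> sp; rewrite leNgt; apply/negP => l1; apply: sp.
have l0 : 0 < l by lra.
split=> [f h|g].
  apply: nrm_le0.
  have : nrm (l *: f) <= nrm f.
    have := ler_nrmD (T f) (- (T f - l *: f)).
    rewrite nrmN h addr0 opprB addrC subrK => /le_trans; apply; exact: T_contr.
  rewrite nrmZ gtr0_norm// => h1; have : (l - 1) * nrm f <= 0 by lra.
  by rewrite pmulr_rle0//; lra.
pose u := fix u n := if n is k.+1 then l^-1 *: (T (u k) - g) else 0.
have lu n : l *: u n.+1 = T (u n) - g by rewrite /= scalerA divff ?gt_eqF// scale1r.
have li : l^-1 < 1 by rewrite invf_lt1.
have li0' : 0 < l^-1 by rewrite invr_gt0.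
have li0 := ltW li0'.
have du n : nrm (u n.+1 - u n) <= nrm (u 1) * l^-1 ^+ n.
  elim: n => [|n ih]; first by rewrite expr0 mulr1 subr0.
  have -> : u n.+2 - u n.+1 = l^-1 *: T (u n.+1 - u n).
    by rewrite (opB T_lin) /= -scalerBr opprB addrA subrK.
  rewrite nrmZ ger0_norm// exprS mulrCA ler_wpM2l//.
  exact: le_trans (T_contr _) ih.
have [f Hf] := complete (nrm_ge0 _) li0' li du.
exists f; apply: nrm_le0.
set K := nrm (u 1) / (1 - l^-1) in Hf.
apply: (le_geometric_le0 li0 li) (_ : forall n, _ <= (K + l * K) * _) => n.
have -> : T f - l *: f - g = T (f - u n) + l *: (u n.+1 - f).
  rewrite (opB T_lin) scalerBr lu -(addrA (T (u n))) (addrA _ (T (u n))) subrK -addrA.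
  by congr (_ + _); rewrite addrC.
apply: le_trans (ler_nrmD _ _) _; rewrite mulrDl lerD//.
  by apply: le_trans (T_contr _) _; rewrite nrmB.
rewrite nrmZ gtr0_norm// -mulrA ler_wpM2l ?(ltW l0)//.
apply: le_trans (Hf n.+1) _; rewrite ler_wpM2l//.
  by rewrite /K divr_ge0 ?nrm_ge0// subr_ge0 ltW.
by rewrite exprS ler_piMl ?exprn_ge0// ltW.
Qed.

Definition shift_op (l : R) u := T u - l *: u.

Lemma shift_op_lin l a u v : shift_op l (a *: u + v) = a *: shift_op l u + shift_op l v.
Proof.
rewrite /shift_op T_lin scalerBr scalerDr !scalerA (mulrC l a) opprD addrACA //.
Qed.

Lemma shift_op_sym l u v : ip (shift_op l u) v = ip u (shift_op l v).
Proof. by rewrite !ipE T_sym. Qed.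

Lemma shift_op_bound l u : nrm (shift_op l u) <= (1 + `|l|) * nrm u.
Proof.
apply: le_trans (ler_nrmB _ _) _; rewrite nrmZ mulrDl mul1r lerD2r; exact: T_contr.
Qed.

Lemma resolvent_bounded l : ~ spectrum l ->
  exists2 c, 0 < c & forall f, c * nrm f <= nrm (shift_op l f).
Proof.
move=> /contrapT[inj surj].
exact: (bijective_bounded_below (shift_op_lin l) (shift_op_sym l) surj inj).
Qed.

(** With t the midpoint, s the half-length and A = T - t, the form is |A f|^2 - s^2 |f|^2. If it
    were negative, the infimum c^2 of |A u|^2 / |u|^2 would satisfy c < s. Then A^2 - c^2 is
    positive and factors as (T - (t + c)) (T - (t - c)), two operators bounded below because t + c
    and t - c lie in the gap. *)
Lemma gap_form_ge0 a b : a < b -> (forall l, a < l -> l < b -> ~ spectrum l) ->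
  forall f, 0 <= ip (shift_op a f) (shift_op b f).
Proof.
move=> ab gap f; rewrite leNgt; apply/negP => flt.
pose t := (a + b) / 2; pose s := (b - a) / 2.
have s0 : 0 < s by rewrite /s; lra.
pose A := shift_op t.
have Af : ip (A f) (A f) < s ^+ 2 * ip f f.
  rewrite -subr_lt0; move: flt; rewrite /A /shift_op !ipE (ipC f (T f)) /s /t.
  lra.
have ff : 0 < ip f f.
  rewrite lt_def ip_ge0 andbT; apply: contraTN isT => /eqP ff.
  by move: Af; rewrite ff mulr0 ltNge ip_ge0.
pose Q := [set ip (A u) (A u) / ip u u | u in [set u | 0 < ip u u]].
have Q0 x : Q x -> 0 <= x by move=> [u /= _ <-]; rewrite divr_ge0.
have hQ : has_inf Q.
  by split; [exists (ip (A f) (A f) / ip f f); exists f|exists 0 => x /Q0].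
pose c2 := inf Q.
have c20 : 0 <= c2 by apply: lb_le_inf; [case: hQ|move=> x /Q0].
have c2s : c2 < s ^+ 2.
  apply: (@le_lt_trans _ _ (ip (A f) (A f) / ip f f)).
    by apply: ge_inf; [case: hQ|exists f].
  by rewrite ltr_pdivrMr.
have c2A u : c2 * ip u u <= ip (A u) (A u).
  have := ip_ge0 u; rewrite le_eqVlt => /orP[/eqP <-|uu]; first by rewrite mulr0.
  by rewrite -ler_pdivlMr//; apply: ge_inf; [case: hQ|exists u].
pose c := Num.sqrt c2.
have cc : c ^+ 2 = c2 by rewrite sqr_sqrtr.
have c0 : 0 <= c by rewrite sqrtr_ge0.
have cs : c < s by rewrite -ltr_sqr ?nnegrE ?(ltW s0)// cc.
have [k1 k10 Hk1] : exists2 k, 0 < k & forall u, k * nrm u <= nrm (shift_op (t + c) u).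
  apply: resolvent_bounded; apply: gap; move: cs c0; rewrite /t /s; lra.
have [k2 k20 Hk2] : exists2 k, 0 < k & forall u, k * nrm u <= nrm (shift_op (t - c) u).
  apply: resolvent_bounded; apply: gap; move: cs c0; rewrite /t /s; lra.
pose B u := A (A u) - c2 *: u.
have BE u : B u = shift_op (t + c) (shift_op (t - c) u).
  rewrite /B /A /shift_op -cc expr2 !(opB T_lin) !(opZ T_lin) !scalerBr !scalerA.
  set x := T (T u); set y := T u.
  have -> : x - t *: y - (t *: y - (t * t) *: u) - (c * c) *: u
      = x + (- t - t) *: y + (t * t - c * c) *: u.
    by rewrite !scalerBl scaleNr opprB !addrA (addrAC (x - t *: y)).
  have -> : x - (t - c) *: y - ((t + c) *: y - ((t + c) * (t - c)) *: u)
      = x + (- (t - c) - (t + c)) *: y + ((t + c) * (t - c)) *: u.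
    by rewrite (scalerBl (- (t - c))) scaleNr opprB !addrA (addrAC (x - _)).
  by congr (x + _ *: y + _ *: u); ring.
have B_lin a' u v : B (a' *: u + v) = a' *: B u + B v.
  rewrite /B /A !shift_op_lin scalerBr (scalerDr c2) !scalerA (mulrC c2) opprD addrACA//.
have B_sym u v : ip (B u) v = ip u (B v) by rewrite /B ipBl ipBr ipZl ipZr /A !shift_op_sym.
have B_form u : ip (B u) u = ip (A u) (A u) - c2 * ip u u.
  by rewrite /B ipBl ipZl /A shift_op_sym.
have B_pos u : 0 <= ip (B u) u by rewrite B_form subr_ge0.
pose K := (1 + `|t|) ^+ 2.
have K0 : 0 < K by rewrite exprn_gt0// ltr_pwDl.
have B_K u : ip (B u) u <= K * ip u u.
  rewrite B_form; apply: (@le_trans _ _ (ip (A u) (A u))).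
    by rewrite gerDl oppr_le0 mulr_ge0.
  by rewrite ler_sqr_nrm ?addr_ge0//; exact: shift_op_bound.
(* [positive_op_sqr_le] turns the lower bound on |B u| into one on <B u, u>, which strictly raises
   the infimum [c2]: a contradiction. *)
have low u : (c2 + (k1 * k2) ^+ 2 / K) * ip u u <= ip (A u) (A u).
  have h1 := positive_op_sqr_le B_lin B_sym B_pos B_K u.
  have h2 : k1 * k2 * nrm u <= nrm (B u).
    rewrite BE -mulrA (le_trans _ (Hk1 _))// ler_wpM2l ?(ltW k10)//.
  have : (k1 * k2) ^+ 2 * ip u u <= K * ip (B u) u.
    apply: le_trans h1; rewrite -!sqr_nrm -exprMn ler_sqr ?nnegrE ?mulr_ge0 ?nrm_ge0 ?(ltW k10) ?(ltW k20)//.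
  rewrite B_form mulrDl => h3.
  rewrite -lerBrDl.
  by rewrite mulrAC ler_pdivrMr// [leRHS]mulrC.
have : c2 + (k1 * k2) ^+ 2 / K <= c2.
  apply: lb_le_inf; first by case: hQ.
  by move=> _ [u /= uu <-]; rewrite ler_pdivlMr.
rewrite gerDl leNgt => /negP; apply.
by rewrite divr_gt0// exprn_gt0// mulr_gt0.
Qed.

Variables (e0 : E) (delta : R).
Hypothesis Te0 : T e0 = e0.
Hypothesis ker_triv : forall f, ip f e0 = 0 -> nrm (T f - f) = 0 -> nrm f = 0.
Hypothesis delta01 : 0 < delta <= 1.
Hypothesis form_lower : forall f, - (1 - delta) * ip f f <= ip (T f) f.

Lemma T_iter_lin n a u v : iter n T (a *: u + v) = a *: iter n T u + iter n T v.
Proof. by elim: n => //= n ->; rewrite T_lin. Qed.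

Lemma ip_T_perp f : ip f e0 = 0 -> ip (T f) e0 = 0.
Proof. by rewrite T_sym Te0. Qed.

Lemma ip_iter_perp n f : ip f e0 = 0 -> ip (iter n T f) e0 = 0.
Proof. by elim: n => //= n ih /ih; exact: ip_T_perp. Qed.

(* On the range of [1 - T] the form of [T] is at most [a]: with S = 1 - T >= 0 the gap
   gives S^2 >= (1-a) S, and the moments <S^k v, v> are log-convex. *)
Lemma form_upper_range a : a < 1 -> (forall l, a < l -> l < 1 -> ~ spectrum l) ->
  forall v, ip (T (v - T v)) (v - T v) <= a * ip (v - T v) (v - T v).
Proof.
move=> a1 gap v.
pose S u := u - T u.
have S_lin a' u w : S (a' *: u + w) = a' *: S u + S w.
  by rewrite /S T_lin scalerBr opprD addrACA.
have S_sym u w : ip (S u) w = ip u (S w) by rewrite /S !ipE T_sym.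
have S_pos u : 0 <= ip (S u) u.
  rewrite /S !ipE subr_ge0 (le_trans (ip_le_nrm _ _))//.
  by rewrite -sqr_nrm expr2 ler_wpM2r ?nrm_ge0.
have h1 : (1 - a) * ip (S v) v <= ip (S v) (S v).
  have := gap_form_ge0 a1 gap v; rewrite /shift_op /S !ipE (ipC v (T v)); lra.
have h2 := form_CauchySchwarz (op_form_bil S_lin S_sym) S_pos v (S v).
rewrite /= in h2.
suff : (1 - a) * ip (S v) (S v) <= ip (S (S v)) (S v).
  have -> : ip (S (S v)) (S v) = ip (S v) (S v) - ip (T (S v)) (S v) by rewrite -ipBl.
  rewrite -/(S v); lra.
have := ip_ge0 (S v); rewrite le_eqVlt => /orP[/eqP <-|]; first by rewrite mulr0 S_pos.
move: h1 h2 (S_pos v) (S_pos (S v)).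
set x := ip (S v) (S v); set y := ip (S v) v; set z := ip _ _.
move=> h1 h2 y0 z0 x0.
have : (1 - a) * x ^+ 2 <= x * z.
  apply: (@le_trans _ _ ((1 - a) * (y * z))); first by rewrite ler_wpM2l// subr_ge0 ltW.
  by rewrite mulrA ler_wpM2r.
by rewrite expr2 mulrA mulrC ler_pM2l.
Qed.

(** On the range of 1 - T the form bounds on both sides give |T w| <= a |w|. The increments of
    [iter n T f] lie in that range, so the iterates converge geometrically; the limit is fixed by T
    and orthogonal to [e0], hence null. Thus f is the limit of f - T^n f, which belongs to the
    range, and the bound passes to f. *)
Lemma nrm_T_perp a : 1 - delta <= a -> 0 < a -> a < 1 ->
  (forall l, a < l -> l < 1 -> ~ spectrum l) ->
  forall f, ip f e0 = 0 -> nrm (T f) <= a * nrm f.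
Proof.
move=> da a0 a1 gap f fe.
pose P w := exists v, w = v - T v.
have PT w : P w -> P (T w) by move=> [v ->]; exists (T v); rewrite (opB T_lin).
have Plin b u w : P u -> P w -> P (b *: u + w).
  move=> [u' ->] [w' ->]; exists (b *: u' + w').
  by rewrite T_lin scalerBr opprD addrACA.
have PR w : P w -> nrm (T w) <= a * nrm w.
  apply: (form_bound_norm T_lin T_sym a0 Plin PT) => _ [v ->].
  rewrite ler_norml; apply/andP; split; last exact: form_upper_range.
  apply: le_trans (form_lower _); rewrite -mulNr ler_wpM2r//; lra.
have PRn n w : P w -> P (iter n T w) /\ nrm (iter n T w) <= a ^+ n * nrm w.
  move=> Pw; elim: n => [|n [ih1 ih2]] /=; first by rewrite expr0 mul1r.
  split; first exact: PT.
  by rewrite exprS -mulrA (le_trans (PR _ ih1))// ler_wpM2l// ltW.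
have PS : P (T f - f) by exists (- f); rewrite (opN T_lin) opprK addrC.
have df n : nrm (iter n.+1 T f - iter n T f) <= nrm (T f - f) * a ^+ n.
  have -> : iter n.+1 T f - iter n T f = iter n T (T f - f).
    by rewrite iterSr -scaleN1r [RHS](_ : _ = iter n T (-1 *: f + T f));
      [rewrite T_iter_lin addrC|rewrite scaleN1r addrC].
  by rewrite mulrC; case: (PRn n _ PS).
have [u Hu] := complete (nrm_ge0 _) a0 a1 df.
set K := _ / _ in Hu.
have K0 : 0 <= K by rewrite /K divr_ge0 ?nrm_ge0// subr_ge0 ltW.
have Tu : nrm (T u - u) = 0.
  apply: nrm_le0; apply: (le_geometric_le0 (ltW a0) a1) (_ : forall n, _ <= (K + K) * _) => n.
  apply: le_trans (ler_nrm_dist _ (iter n.+1 T f) _) _; rewrite mulrDl lerD//.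
    by rewrite iterS -(opB T_lin) (le_trans (T_contr _))// nrmB.
  apply: le_trans (Hu n.+1) _; rewrite ler_wpM2l// exprS ler_piMl ?exprn_ge0// ltW//.
have ue : ip u e0 = 0.
  apply/eqP; rewrite -normr_le0.
  apply: (le_geometric_le0 (ltW a0) a1) (_ : forall n, _ <= (K * nrm e0) * _) => n.
  have -> : ip u e0 = ip (u - iter n T f) e0 by rewrite ipBl (ip_iter_perp n fe) subr0.
  apply: le_trans (ip_CauchySchwarz _ _) _.
  by rewrite mulrAC ler_wpM2r ?nrm_ge0// nrmB.
have u0 := ker_triv ue Tu.
have fn n : nrm (iter n T f) <= K * a ^+ n.
  apply: le_trans (Hu n); rewrite -{1}(subrK u (iter n T f)).
  by apply: le_trans (ler_nrmD _ _) _; rewrite u0 addr0.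
have Pw n : P (f - iter n T f).
  elim: n => [|n [v Hv]]; first by exists 0; rewrite /= subrr (op0 T_lin) subr0.
  exists (v + iter n T f); rewrite (opD T_lin) opprD addrACA -Hv.
  by rewrite addrA subrK.
rewrite -subr_le0.
apply: (le_geometric_le0 (ltW a0) a1) (_ : forall n, _ <= (2 * K) * _) => n.
have h1 : nrm (T f) <= nrm (T (f - iter n T f)) + nrm (T (iter n T f)).
  by rewrite (opB T_lin) -{1}(subrK (T (iter n T f)) (T f)) ler_nrmD.
have h2 := PR _ (Pw n).
have h3 := T_contr (iter n T f).
have h4 : a * nrm (f - iter n T f) <= a * nrm f + nrm (iter n T f).
  apply: (@le_trans _ _ (a * (nrm f + nrm (iter n T f)))).
    by rewrite ler_wpM2l ?(ltW a0)// ler_nrmB.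
  by rewrite mulrDr lerD2l ler_piMl ?nrm_ge0// ltW.
have h5 := fn n.
rewrite -mulrA; lra.
Qed.

Definition second_spectral_value := sup [set l | spectrum l /\ l != 1].

(** The test vector forces the second spectral value above 1 - eps > 1 - delta, so the bottom of the
    form never limits the rate. *)
Theorem spectral_gap_contraction (f0 : E) (eps : R) :
  ip f0 e0 = 0 -> nrm f0 <> 0 -> ip (f0 - T f0) f0 <= eps * ip f0 f0 -> eps < delta ->
  1 - second_spectral_value <= eps /\
  forall n f, ip f e0 = 0 ->
    nrm (iter n T f) <= expR (- n%:R * (1 - second_spectral_value)) * nrm f.
Proof.
move=> f0e f0n f0eps epsd; set L := second_spectral_value.
have Lub a l : L < a -> a < l -> l < 1 -> ~ spectrum l.
  move=> La al l1 sp.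
  have : l <= L.
    apply: ub_le_sup; last by split => //; rewrite lt_eqF.
    by exists 1 => x [/spectrum_le1].
  lra.
have /andP[d0 d1] := delta01.
have ff : 0 < ip f0 f0.
  by rewrite lt_def ip_ge0 andbT; apply: contra_not_neq f0n => ?; apply/nrm_eq0.
have eps0 : 0 <= eps.
  have : 0 <= ip (f0 - T f0) f0.
    rewrite !ipE subr_ge0 (le_trans (ip_le_nrm _ _))//.
    by rewrite -sqr_nrm expr2 ler_wpM2r ?nrm_ge0.
  by move=> /le_trans/(_ f0eps); rewrite pmulr_lge0.
have gL : 1 - L <= eps.
  rewrite leNgt; apply/negP => epsL.
  (* Admissible as a contraction factor, being above both [L] and [1 - delta], yet below [1 - eps],
     which the Rayleigh quotient of [f0] forbids. *)
  pose a := (Num.max L (1 - delta) + (1 - eps)) / 2.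
  have mlt : Num.max L (1 - delta) < 1 - eps by rewrite gt_max; apply/andP; split; lra.
  have mL : L <= Num.max L (1 - delta) by rewrite le_max lexx.
  have md : 1 - delta <= Num.max L (1 - delta) by rewrite le_max lexx orbT.
  have := @nrm_T_perp a _ _ _ _ _ f0e.
  have a1 : a < 1 by rewrite /a; lra.
  have a2 : 1 - delta <= a by rewrite /a; lra.
  have a3 : 0 < a by rewrite /a; lra.
  have a4 : L < a by rewrite /a; lra.
  move=> /(_ a2 a3 a1 (fun l => @Lub a l a4)) h.
  have : (1 - eps) * ip f0 f0 <= a * ip f0 f0.
    apply: (@le_trans _ _ (ip (T f0) f0)); first by move: f0eps; rewrite !ipE; lra.
    apply: le_trans (ip_le_nrm _ _) _.
    by rewrite -sqr_nrm expr2 mulrA ler_wpM2r ?nrm_ge0.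
  rewrite ler_pM2r// /a; lra.
split=> // n f fe.
have L0 : 0 < L by lra.
have step u : ip u e0 = 0 -> nrm (T u) <= L * nrm u.
  move=> ue; have [L1|L1] := leP 1 L.
    by apply: le_trans (T_contr _) _; rewrite ler_peMl ?nrm_ge0.
  apply/ler_addgt0Pr => e e_gt0.
  (* Contraction is known only for factors strictly between [L] and 1; this one exceeds [L] by so
     little that [a * nrm u] exceeds [L * nrm u] by at most [e]. *)
  pose a := Num.min ((1 + L) / 2) (L + e / (nrm u + 1)).
  have nu1 : 0 < nrm u + 1 by rewrite ltr_wpDl ?nrm_ge0.
  have La : L < a by rewrite lt_min ltrDl divr_gt0// andbT; lra.
  have a1 : a < 1 by rewrite gt_min; apply/orP; left; lra.
  apply: (@le_trans _ _ (a * nrm u)).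
    by apply: nrm_T_perp ue => // [||l]; [lra|lra|exact: Lub].
  apply: (@le_trans _ _ ((L + e / (nrm u + 1)) * nrm u)).
    by rewrite ler_wpM2r ?nrm_ge0// ge_min lexx orbT.
  rewrite mulrDl lerD2l mulrAC ler_pdivrMr// ler_wpM2l ?(ltW e_gt0)// lerDl//.
apply: (@le_trans _ _ (L ^+ n * nrm f)).
  elim: n => [|n ih]; first by rewrite expr0 mul1r.
  rewrite iterS; apply: le_trans (step _ _) _; first exact: ip_iter_perp.
  by rewrite exprS -mulrA ler_wpM2l// ltW.
rewrite ler_wpM2r ?nrm_ge0// mulNr -mulrN expRM_natl lerXn2r ?nnegrE ?expR_ge0 ?(ltW L0)//.
by have := expR_ge1Dx (- (1 - L)); lra.
Qed.

End SymmetricContraction.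

(** * Lebesgue measure on R^d *)

Notation Rd R d := (g_sigma_algebraType (@open 'rV[R]_d)).

Section SigmaFiniteCopy.
Context dsp (T : measurableType dsp) (R : realType).
Variables (nu : {measure set T -> \bar R}) (nu_sf : sigma_finite setT nu).

(** An alias indexed by the proof, on which the sigma-finite structure can be declared although
    sigma-finiteness of [nu] is only a hypothesis. *)
Definition sigma_finite_copy of sigma_finite setT nu : set T -> \bar R := nu.
HB.instance Definition _ := Measure.on (sigma_finite_copy nu_sf).
HB.instance Definition _ :=
  Measure_isSigmaFinite.Build _ _ _ (sigma_finite_copy nu_sf) nu_sf.

End SigmaFiniteCopy.

Section BorelRd.
Variable R : realType.

Definition box d (q : 'rV[rat]_d) (r : rat) : set 'rV[R]_d :=
  [set v | forall i, `|v ord0 i - ratr (q ord0 i)| < ratr r].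

(** Second countability: rational boxes are countably many, so measurability into the sigma-algebra
    generated by all open sets can be checked coordinate by coordinate. *)
Lemma open_box_cover d (U : set 'rV[R]_d) : open U ->
  U = \bigcup_(p in [set p : 'rV[rat]_d * rat | box p.1 p.2 `<=` U]) box p.1 p.2.
Proof.
move=> oU; apply/seteqP; split=> [v Uv|v [p /= pU]]; last exact: pU.
have := open_nbhs_nbhs (conj oU Uv); rewrite -nbhs_ballE => -[e /= e0 eU].
have e2 : 0 < e / 2 by rewrite divr_gt0.
have [q] := rat_in_itvoo e2; rewrite in_itv /= => /andP[].
set r := ratr q => r0 re.
have [c Hc] : exists c : 'I_d -> rat, forall i, `|v ord0 i - ratr (c i)| < r.
  have h i : exists c : rat, `|v ord0 i - ratr c| < r.
    have lt : v ord0 i - r < v ord0 i + r by lra.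
    have [c] := rat_in_itvoo lt; rewrite in_itv /= => /andP[c1 c2].
    by exists c; rewrite ltr_norml; lra.
  by have [c Hc] := choice h; exists c.
exists (\row_i c i, q) => /=; last by move=> i; rewrite mxE.
move=> w /= Hw; apply: eU; split=> // i j; rewrite ord1 /ball /=.
have := Hw j; rewrite mxE -/r; have := Hc j; rewrite !ltr_norml => h1 h2.
lra.
Qed.

Lemma measurable_coord d (i : 'I_d) :
  measurable_fun [set: Rd R d] (fun v : 'rV[R]_d => v ord0 i).
Proof.
apply: (measurability (@RGenOpens.G R)) => [|_ [_ [a [b ->]] <-]].
  exact: RGenOpens.measurableE.
rewrite setTI; apply: sub_sigma_algebra.
apply: open_comp; last exact: interval_open.
by move=> x _; exact: coord_continuous.
Qed.

Lemma measurable_rV d' (X : measurableType d') d (f : X -> Rd R d) :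
  (forall i, measurable_fun setT (fun x => (f x : 'rV[R]_d) ord0 i)) ->
  measurable_fun setT f.
Proof.
move=> mf; apply: (measurability (@open 'rV[R]_d : set (set (Rd R d)))) => // _ [U oU <-]; rewrite setTI.
rewrite (open_box_cover oU) preimage_bigcup bigcup_mkcond.
apply: countable_bigcupT_measurable => // p; case: ifPn => // _.
rewrite (_ : _ @^-1` _ = \bigcap_(i in [set: 'I_d])
   (fun x => (f x : 'rV[R]_d) ord0 i) @^-1` (ball (ratr (p.1 ord0 i) : R) (ratr p.2))).
  apply: fin_bigcap_measurable => // i _; rewrite -[X in measurable X]setTI.
  by apply: mf => //; exact: measurable_ball.
apply/seteqP; split=> x /= h i; have := h i.
  by rewrite /ball /= distrC.
by rewrite /ball /= distrC; apply.
Qed.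

Lemma measurable_row_mx d :
  measurable_fun [set: measurableTypeR R * Rd R d]
    (fun p => row_mx (\row_(_ < 1) (p.1 : R)) (p.2 : 'rV[R]_d) : Rd R d.+1).
Proof.
apply: measurable_rV => i.
rewrite (_ : (fun _ => _) = fun p : measurableTypeR R * Rd R d =>
   match fintype.split (i : 'I_(1 + d)) with inl _ => (p.1 : R) | inr j => (p.2 : 'rV[R]_d) ord0 j end).
  case: (fintype.split _) => j; first exact: measurable_fst.
  by apply: measurableT_comp (measurable_coord j) _; exact: measurable_snd.
by apply/funext => p; rewrite mxE; case: fintype.split => j; rewrite ?mxE.
Qed.

Definition unrow_mx d (v : Rd R d.+1) : measurableTypeR R * Rd R d :=
  ((v : 'rV[R]_d.+1) ord0 ord0, rsubmx (v : 'rV[R]_(1 + d))).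

Lemma measurable_unrow_mx d : measurable_fun setT (@unrow_mx d).
Proof.
apply: measurable_fun_pair; first exact: (measurable_coord (ord0 : 'I_d.+1)).
apply: measurable_rV => i.
rewrite (_ : (fun _ => _) = fun v : 'rV[R]_d.+1 => v ord0 (rshift 1 i : 'I_d.+1)).
  exact: measurable_coord.
by apply/funext => v; rewrite mxE.
Qed.

(** The measure is the pushforward of a product along the concatenation of a coordinate with the
    others; Tonelli then reproduces the recursion of [intd]. *)
Lemma lebesgue_Rd_exists d : exists mu : {sigma_finite_measure set (Rd R d) -> \bar R},
  forall f : 'rV[R]_d -> \bar R, (forall x, (0 <= f x)%E) ->
    measurable_fun [set: Rd R d] f -> (\int[mu]_x f x = intd f)%E.
Proof.
elim: d => [|d [mu IH]].
  exists (@dirac _ (Rd R 0) (0 : 'rV[R]_0) R).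
  by move=> f f0 mf; rewrite integral_dirac// diracT mul1e.
pose phi (p : measurableTypeR R * Rd R d) :=
  row_mx (\row_(_ < 1) (p.1 : R)) (p.2 : 'rV[R]_d) : Rd R d.+1.
have mphi : measurable_fun setT phi by exact: measurable_row_mx.
pose nu := measure_function_pushforward__canonical__measure_function_Measure
  ((@lebesgue_measure R) \x mu)%E mphi.
have nu_sf : sigma_finite setT nu.
  have /sigma_finiteP[F [FT ndF Foo]] := sigma_finiteT (@lebesgue_measure R).
  have /sigma_finiteP[G [GT ndG Goo]] := sigma_finiteT mu.
  exists (fun n => @unrow_mx d @^-1` (F n `*` G n)).
    apply/esym; rewrite -subTset => v _.
    have : setT (unrow_mx v).1 by []. rewrite FT => -[m _ Fm].
    have : setT (unrow_mx v).2 by []. rewrite GT => -[n _ Gn].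
    exists (maxn m n) => //; split.
      by apply: (subsetPset _ _ (ndF _ _ _)) Fm; exact: leq_maxl.
    by apply: (subsetPset _ _ (ndG _ _ _)) Gn; exact: leq_maxr.
  move=> n; have [mF Fn] := Foo n; have [mG Gn] := Goo n.
  have mFG : measurable (F n `*` G n) by exact: measurableX.
  split; first by rewrite -[X in measurable X]setTI; exact: measurable_unrow_mx.
  rewrite /nu /= /pushforward -comp_preimage (_ : _ \o _ = id).
    by rewrite preimage_id product_measure1E// lte_mul_pinfty// ge0_fin_numE.
  apply/funext => -[x v]; rewrite /unrow_mx /phi /= row_mxKr; congr (_, _).
  by rewrite mxE; case: splitP => // j _; rewrite mxE.
pose nus : {sigma_finite_measure set (Rd R d.+1) -> \bar R} := sigma_finite_copy nu_sf.
exists nus => f f0 mf.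
rewrite (ge0_integral_pushforward mphi)//=.
rewrite preimage_setT fubini_tonelli1//.
  apply: eq_integral => x _; rewrite /fubini_F /= IH//.
  exact: (measurableT_comp mf (measurableT_comp mphi (pair1_measurable x))).
exact: (measurableT_comp mf mphi).
Qed.

Definition leb d := projT1 (cid (lebesgue_Rd_exists d)).

Lemma integral_leb d (f : 'rV[R]_d -> \bar R) : (forall x, (0 <= f x)%E) ->
    measurable_fun [set: Rd R d] f -> (\int[leb d]_x f x = intd f)%E.
Proof. exact: (projT2 (cid (lebesgue_Rd_exists d))). Qed.

End BorelRd.

(** * Affine changes of variables and the volume of cubes *)

Section LebesgueRd.
Variable R : realType.
Local Notation lambda := (@lebesgue_measure R).

(** Uniqueness of Lebesgue measure reduces the claim to half-open intervals. For c < 0 the preimage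
    is closed on the other side, which leaves its length unchanged. *)
Lemma lebesgue_measure_affine (c a : R) (A : set (measurableTypeR R)) : c != 0 ->
  measurable A ->
  (`|c|%:E * lambda ((fun x : R => (c * x + a)%R) @^-1` A) = lambda A)%E.
Proof.
move=> c0 mA.
pose phi (x : measurableTypeR R) : measurableTypeR R := c * (x : R) + a.
have mphi : measurable_fun setT phi.
  by apply: measurable_funD => //; exact: mulrl_measurable.
pose cn := NngNum (normr_ge0 c).
pose nu := measure_function_pushforward__canonical__measure_function_Measure lambda mphi.
have E : forall A, measurable A -> lambda A = mscale cn nu A.
  apply: lebesgue_measure_unique => _ [[p q] _ <-].
  change (lambda `]p, q]%classic = (`|c|%:E * lambda (phi @^-1` `]p, q]%classic))%E).
  have [c_gt0|c_lt0|/eqP] := ltrgt0P c; last by rewrite (negPf c0).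
    rewrite (_ : _ @^-1` _ = `](p - a) / c, (q - a) / c]%classic); last first.
      apply/seteqP; split => x /=; rewrite !in_itv /= ltr_pdivrMr// ler_pdivlMr// /phi;
        rewrite (mulrC x) ltrBlDr lerBrDr//.
    rewrite !lebesgue_measure_itv /= !lte_fin ltr_pM2r ?invr_gt0// ltrD2r.
    case: ifP => _; last by rewrite mule0.
    rewrite -!EFinD -EFinM; congr (_%:E); field; exact: lt0r_neq0.
  rewrite (_ : _ @^-1` _ = `[(q - a) / c, (p - a) / c[%classic); last first.
    apply/seteqP; split => x /=; rewrite !in_itv /= ltr_ndivlMr// ler_ndivrMr// /phi;
      rewrite (mulrC x) ltrBlDr lerBrDr andbC//.
  rewrite !lebesgue_measure_itv /= !lte_fin ltr_nM2r ?invr_lt0// ltrD2r.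
  case: ifP => _; last by rewrite mule0.
  rewrite -!EFinD -EFinM; congr (_%:E); field; exact: ltr0_neq0.
by rewrite (E A mA).
Qed.

Lemma integral_affine1 (c a : R) (f : R -> \bar R) : c != 0 ->
  measurable_fun [set: measurableTypeR R] f -> (forall x, (0 <= f x)%E) ->
  (`|c|%:E * \int[lambda]_x f (c * x + a)%R = \int[lambda]_x f x)%E.
Proof.
move=> c0 mf f0.
pose phi (x : measurableTypeR R) : measurableTypeR R := c * (x : R) + a.
have mphi : measurable_fun setT phi.
  by apply: measurable_funD => //; exact: mulrl_measurable.
pose cn := NngNum (normr_ge0 c).
pose nu := measure_function_pushforward__canonical__measure_function_Measure lambda mphi.
transitivity (\int[mscale cn nu]_x f x)%E.
  rewrite ge0_integral_mscale//=; congr (_ * _)%E.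
  by rewrite (ge0_integral_pushforward mphi).
apply: eq_measure_integral => A mA _; exact: lebesgue_measure_affine.
Qed.

Local Notation mu := (@leb R).

Lemma integral_lebS d (f : 'rV[R]_d.+1 -> \bar R) : (forall x, (0 <= f x)%E) ->
  measurable_fun [set: Rd R d.+1] f ->
  (\int[mu d.+1]_x f x =
   \int[lambda]_x \int[mu d]_v f (row_mx (\row_(_ < 1) x) v))%E.
Proof.
move=> f0 mf; rewrite integral_leb//=; apply: eq_integral => x _.
rewrite integral_leb//.
exact: (measurableT_comp mf (measurableT_comp (@measurable_row_mx R d) (pair1_measurable x))).
Qed.

Lemma measurable_affine d (c : R) (a : 'rV[R]_d) :
  measurable_fun setT (fun v : Rd R d => c *: (v : 'rV[R]_d) + a : Rd R d).
Proof.
apply: measurable_rV => i.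
rewrite (_ : (fun _ => _) = fun v : Rd R d => c * (v : 'rV[R]_d) ord0 i + a ord0 i).
  apply: measurable_funD => //.
  by apply: measurable_funM => //; exact: measurable_coord.
by apply/funext => v; rewrite !mxE.
Qed.

Lemma integral_affine d (c : R) (a : 'rV[R]_d) (f : 'rV[R]_d -> \bar R) : c != 0 ->
  measurable_fun [set: Rd R d] f -> (forall x, (0 <= f x)%E) ->
  ((`|c| ^+ d)%:E * \int[mu d]_x f (c *: x + a)%R = \int[mu d]_x f x)%E.
Proof.
elim: d a f => [|d IH] a f c0 mf f0.
  rewrite expr0 mul1e; apply: eq_integral => x _.
  by congr f; apply/rowP => -[].
rewrite !integral_lebS//; last exact: (measurableT_comp mf (measurable_affine c a)).
pose a0 := a ord0 ord0; pose a' : 'rV_d := rsubmx (a : 'rV_(1 + d)).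
have E x (v : 'rV_d) : c *: row_mx (\row_(_ < 1) x) v + a =
    row_mx (\row_(_ < 1) (c * x + a0)) (c *: v + a').
  rewrite -[in LHS](hsubmxK (a : 'rV_(1 + d))) scale_row_mx add_row_mx; congr row_mx.
  by apply/rowP => j; rewrite !mxE ord1; congr (_ + a _ _); apply/val_inj.
under eq_integral do under eq_integral do rewrite E.
pose F x := (\int[mu d]_v f (row_mx (\row_(_ < 1) x) v))%E.
have mF : measurable_fun [set: measurableTypeR R] F.
  have := @measurable_fun_fubini_tonelli_F _ _ (measurableTypeR R) (Rd R d) R (mu d)
    (fun p => f (row_mx (\row_(_ < 1) p.1) p.2)).
  by apply => //; exact: (measurableT_comp mf (@measurable_row_mx R d)).
have F0 x : (0 <= F x)%E by apply: integral_ge0.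
have <- := integral_affine1 a0 c0 mF F0.
rewrite exprS EFinM -muleA; congr (_ * _)%E.
have mfx x : measurable_fun [set: Rd R d] (fun v : 'rV[R]_d => f (row_mx (\row_(_ < 1) x) v)).
  exact: (measurableT_comp mf (measurableT_comp (@measurable_row_mx R d) (pair1_measurable x))).
pose G x := (\int[mu d]_v f (row_mx (\row_(_ < 1) (c * x + a0)%R) (c *: v + a')%R))%E.
have GE : G = (fun x : R => ((`|c| ^+ d)^-1)%:E * F (c * x + a0)%R)%E.
  apply/funext => x; rewrite /F -(IH a' _ c0 (mfx _))//.
  by rewrite muleA -EFinM mulVf ?mul1e// expf_neq0// normr_eq0.
have mG : measurable_fun [set: measurableTypeR R] G.
  rewrite GE; apply: measurable_funeM; apply: (measurableT_comp mF).
  by apply: measurable_funD => //; exact: mulrl_measurable.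
rewrite -ge0_integralZl//=; last by move=> x _; exact: integral_ge0.
by apply: eq_integral => x _; rewrite /F -(IH a' _ c0 (mfx _)).
Qed.

Lemma integral_translate d (a : 'rV[R]_d) (f : 'rV[R]_d -> \bar R) :
  measurable_fun [set: Rd R d] f -> (forall x, (0 <= f x)%E) ->
  (\int[mu d]_x f (x + a)%R = \int[mu d]_x f x)%E.
Proof.
move=> mf f0; rewrite -(@integral_affine d 1 a f)// ?oner_eq0//.
by rewrite normr1 expr1n mul1e; apply: eq_integral => x _; rewrite scale1r.
Qed.

Lemma integral_reflect d (a : 'rV[R]_d) (f : 'rV[R]_d -> \bar R) :
  measurable_fun [set: Rd R d] f -> (forall x, (0 <= f x)%E) ->
  (\int[mu d]_x f (a - x)%R = \int[mu d]_x f x)%E.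
Proof.
move=> mf f0; rewrite -(@integral_affine d (-1) a f)// ?oppr_eq0 ?oner_eq0//.
rewrite normrN1 expr1n mul1e; apply: eq_integral => x _.
by rewrite scaleN1r addrC.
Qed.

Definition cube d (a : 'rV[R]_d) (r : R) : set 'rV[R]_d :=
  [set v | forall i, `|v ord0 i - a ord0 i| < r].

Lemma measurable_cube d a r : measurable (@cube d a r : set (Rd R d)).
Proof.
rewrite (_ : cube a r = \bigcap_(i in [set: 'I_d])
   (fun v : Rd R d => (v : 'rV[R]_d) ord0 i) @^-1` (ball (a ord0 i) r)).
  apply: fin_bigcap_measurable => // i _; rewrite -[X in measurable X]setTI.
  by apply: measurable_coord => //; exact: measurable_ball.
apply/seteqP; split=> x /= h i; have := h i.
  by rewrite /ball /= distrC.
by rewrite /ball /= distrC; apply.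
Qed.

Lemma measure_integral_indic dsp (T : measurableType dsp)
    (m : {measure set T -> \bar R}) (A : set T) : measurable A ->
  (m A = \int[m]_x (\1_A x)%:E)%E.
Proof. by move=> mA; rewrite integral_indic// setIT. Qed.

Lemma lebesgue_cube d (r : R) : 0 < r -> mu d (cube 0 r) = ((2 * r) ^+ d)%:E.
Proof.
move=> r0.
have mI n : measurable_fun [set: Rd R n] (fun v => (\1_(cube (0 : 'rV[R]_n) r) v : R)%:E).
  by apply/measurable_EFinP; apply: measurable_indic; exact: measurable_cube.
elim: d => [|d IH].
  rewrite measure_integral_indic; last exact: measurable_cube.
  by rewrite integral_leb// /intd indicE mem_set// => -[].
rewrite measure_integral_indic; last exact: measurable_cube.
rewrite integral_lebS//=; last exact: mI.
have E x (v : 'rV_d) : (\1_(cube 0 r) (row_mx (\row_(_ < 1) x) v) : R) =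
    \1_(ball 0 r) x * \1_(cube 0 r) v.
  rewrite !indicE -natrM mulnb; congr ((_ : bool)%:R).
  apply/idP/andP; rewrite !inE.
    move=> h; split.
      by have := h (lshift d ord0); rewrite row_mxEl !mxE /ball /= sub0r subr0 normrN.
    by move=> i; have := h (rshift 1 i); rewrite row_mxEr !mxE.
  move=> [h1 h2] i; rewrite [row_mx _ _ _ _]mxE; case: fintype.split => j.
    by rewrite !mxE subr0; move: h1; rewrite /ball /= sub0r normrN.
  by have := h2 j; rewrite !mxE.
transitivity (\int[lambda]_x ((\1_(ball 0 r) x)%:E * ((2 * r) ^+ d)%:E))%E.
  apply: eq_integral => x _; rewrite -IH measure_integral_indic; last exact: measurable_cube.
  by rewrite -ge0_integralZl//; apply: eq_integral => v _; rewrite E EFinM.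
have mb : measurable_fun setT (fun x : measurableTypeR R => (\1_(ball 0 r) (x : R) : R)%:E).
  by apply/measurable_EFinP; apply: measurable_indic; exact: measurable_ball.
rewrite ge0_integralZr//=; last first.
  by rewrite lee_fin exprn_ge0// mulr_ge0// ltW.
rewrite integral_indic ?setIT//; last exact: measurable_ball.
transitivity ((r *+ 2)%:E * ((2 * r) ^+ d)%:E)%E.
  by congr (_ * _)%E; exact: lebesgue_measure_ball (ltW r0).
by rewrite -EFinM exprS mulr_natl.
Qed.

End LebesgueRd.

Lemma measurable_rsum dsp (T : measurableType dsp) (R : realType) (I : Type)
    (s : seq I) (f : I -> T -> R) : (forall i, measurable_fun setT (f i)) ->
  measurable_fun setT (fun x => \sum_(i <- s) f i x).
Proof.
move=> mf; elim: s => [|i s IH].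
  by under eq_fun do rewrite big_nil; exact: measurable_cst.
by under eq_fun do rewrite big_cons; exact: measurable_funD.
Qed.

(** * The Euclidean norm, balls and their volume *)

Section EuclideanNorm.
Variables (R : realType) (d : nat).
Implicit Types u v : 'rV[R]_d.

Definition edot u v := \sum_i u ord0 i * v ord0 i.

Lemma edot_bil : bilinear_form edot.
Proof.
split=> [u v|a u v w]; first by apply: eq_bigr => i _; rewrite mulrC.
rewrite /edot mulr_sumr -big_split /=; apply: eq_bigr => i _.
by rewrite !mxE mulrDl mulrA.
Qed.

Lemma edot_ge0 u : 0 <= edot u u.
Proof. by apply: sumr_ge0 => i _; rewrite -expr2 sqr_ge0. Qed.

Lemma enormE u : enorm u = nrm edot u.
Proof. by rewrite /enorm /nrm /edot; congr Num.sqrt; apply: eq_bigr => i _; rewrite expr2. Qed.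

Lemma enorm_ge0 u : 0 <= enorm u. Proof. exact: sqrtr_ge0. Qed.
Lemma sqr_enorm u : enorm u ^+ 2 = edot u u.
Proof. rewrite enormE; exact: (sqr_nrm edot_ge0). Qed.
Lemma ler_enormD u v : enorm (u + v) <= enorm u + enorm v.
Proof. rewrite !enormE; exact: (ler_nrmD edot_bil edot_ge0). Qed.
Lemma enormZ a u : enorm (a *: u) = `|a| * enorm u.
Proof. rewrite !enormE; exact: (nrmZ edot_bil). Qed.
Lemma enormN u : enorm (- u) = enorm u.
Proof. by rewrite -scaleN1r enormZ normrN1 mul1r. Qed.
Lemma enormB u v : enorm (u - v) = enorm (v - u).
Proof. by rewrite -enormN opprB. Qed.
Lemma enorm0 : enorm (0 : 'rV[R]_d) = 0.
Proof. rewrite enormE; exact: (nrm0 edot_bil edot_ge0). Qed.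
Lemma ler_enorm_dist u v w : enorm (u - w) <= enorm (u - v) + enorm (v - w).
Proof. by have := ler_enormD (u - v) (v - w); rewrite addrA subrK. Qed.

Lemma ler_coord_enorm u i : `|u ord0 i| <= enorm u.
Proof.
rewrite -ler_sqr ?nnegrE ?normr_ge0 ?enorm_ge0// sqr_enorm real_normK ?num_real//.
rewrite /edot (bigD1 i)//= expr2 lerDl; apply: sumr_ge0 => j _.
by rewrite -expr2 sqr_ge0.
Qed.

(** The half-side [r / d.+1] is cruder than r divided by the root of d, but makes the inequality
    strict and also makes sense for d = 0. *)
Lemma enorm_lt_cube u (r : R) : 0 < r -> cube 0 (r / d.+1%:R) u -> enorm u < r.
Proof.
move=> r0 hu; rewrite -ltr_sqr ?nnegrE ?enorm_ge0 ?(ltW r0)// sqr_enorm.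
have d0 : 0 < d.+1%:R :> R by rewrite ltr0n.
apply: (@le_lt_trans _ _ (\sum_(i < d) (r / d.+1%:R) ^+ 2)).
  apply: ler_sum => i _; rewrite -expr2 -real_normK ?num_real//.
  rewrite ler_sqr ?nnegrE ?normr_ge0 ?divr_ge0 ?(ltW r0) ?(ltW d0)//.
  by have := hu i; rewrite mxE subr0 => /ltW.
rewrite sumr_const card_ord -[ltLHS]mulr_natl expr_div_n mulrCA gtr_pMr ?exprn_gt0//.
rewrite ltr_pdivrMr ?exprn_gt0// mul1r -natrX ltr_nat.
by rewrite (leq_trans (ltnSn d))// expnS expn1 leq_pmulr.
Qed.

Lemma cube_enorm u (r : R) : enorm u < r -> cube 0 r u.
Proof. by move=> h i; rewrite mxE subr0 (le_lt_trans _ h)// ler_coord_enorm. Qed.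

Lemma measurable_enorm : measurable_fun [set: Rd R d] (@enorm R d).
Proof.
rewrite /enorm; apply: measurableT_comp.
  by apply: continuous_measurable_fun; exact: sqrt_continuous.
apply: measurable_rsum => i; apply: measurable_funX; exact: measurable_coord.
Qed.

Local Notation X := (Rd R d).
Local Notation mu := (@leb R d).

Lemma measurable_coord_le (i : 'I_d) (a : R) :
  measurable ([set x | (x : 'rV[R]_d) ord0 i <= a] : set X).
Proof.
have := @measurable_coord R d i measurableT `]-oo, a]%classic; rewrite setTI.
rewrite (_ : _ @^-1` _ = [set x : X | (x : 'rV[R]_d) ord0 i <= a]).
  by apply; exact: measurable_itv.
by apply/seteqP; split=> x /=; rewrite in_itv.
Qed.

Lemma measurable_coord_ge (i : 'I_d) (a : R) :
  measurable ([set x | a <= (x : 'rV[R]_d) ord0 i] : set X).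
Proof.
have := @measurable_coord R d i measurableT `[a, +oo[%classic; rewrite setTI.
rewrite (_ : _ @^-1` _ = [set x : X | a <= (x : 'rV[R]_d) ord0 i]).
  by apply; exact: measurable_itv.
by apply/seteqP; split=> x /=; rewrite in_itv /= andbT.
Qed.

Lemma measurable_subRd : measurable_fun [set: X * X]
  (fun p => (p.2 : 'rV[R]_d) - (p.1 : 'rV[R]_d) : X).
Proof.
apply: measurable_rV => i.
rewrite (_ : (fun _ => _) = fun p : X * X =>
  (p.2 : 'rV[R]_d) ord0 i - (p.1 : 'rV[R]_d) ord0 i).
  apply: measurable_funB; apply: (measurableT_comp (@measurable_coord R d i)).
  - exact: measurable_snd.
  - exact: measurable_fst.
by apply/funext => v; rewrite !mxE.
Qed.

Lemma measurable_ballI (h : R) :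
  measurable_fun [set: X * X] (fun p => ballI h (p.1 : 'rV[R]_d) p.2).
Proof.
rewrite /ballI.
rewrite (_ : (fun _ => _) = fun p : X * X =>
   if (enorm ((p.2 : 'rV[R]_d) - (p.1 : 'rV[R]_d)) < h)%R then 1 else 0).
  apply: measurable_fun_ifT => //; apply: measurable_fun_ltr => //.
  exact: (measurableT_comp measurable_enorm measurable_subRd).
by apply/funext => p; case: ifP.
Qed.

Lemma measurable_ballI1 (h : R) (x : 'rV[R]_d) : measurable_fun [set: X] (ballI h x).
Proof. exact: (measurableT_comp (measurable_ballI h) (pair1_measurable (x : X))). Qed.

Lemma ballI_ge0 (h : R) x y : 0 <= @ballI R d h x y. Proof. by rewrite /ballI ler0n. Qed.
Lemma ballI_le1 (h : R) x y : @ballI R d h x y <= 1.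
Proof. by rewrite /ballI; case: (_ < _); rewrite ?ler01 ?lexx. Qed.
Lemma ballI_sym (h : R) x y : @ballI R d h x y = ballI h y x.
Proof. by rewrite /ballI enormB. Qed.

Definition vol (r : R) : R := fine (\int[mu]_y (ballI r 0 y)%:E).

Lemma integral_ballI_lty (r : R) : (\int[mu]_y (ballI r 0%R y)%:E < +oo)%E.
Proof.
have [r0|r0] := ltP 0 r; last first.
  rewrite integral0_eq// => y _; rewrite /ballI subr0.
  by rewrite ltNge (le_trans r0)// enorm_ge0.
apply: (@le_lt_trans _ _ (mu (cube 0 r))); last by rewrite lebesgue_cube// ltry.
rewrite measure_integral_indic; last exact: measurable_cube.
apply: ge0_le_integral => //.
- by move=> y _; rewrite lee_fin ballI_ge0.
- by apply/measurable_EFinP; exact: measurable_ballI1.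
- by apply/measurable_EFinP; apply: measurable_indic; exact: measurable_cube.
- move=> y _; rewrite lee_fin /ballI subr0; case: ltP => // h.
  by rewrite indicE mem_set//; exact: cube_enorm.
Qed.

Lemma vol_ge0 r : 0 <= vol r.
Proof. by apply: fine_ge0; apply: integral_ge0 => y _; rewrite lee_fin ballI_ge0. Qed.

Lemma integral_ballI (r : R) (x : 'rV[R]_d) : (\int[mu]_y (ballI r x y)%:E = (vol r)%:E)%E.
Proof.
rewrite /vol fineK; last first.
  rewrite ge0_fin_numE ?integral_ballI_lty//.
  by apply: integral_ge0 => y _; rewrite lee_fin ballI_ge0.
rewrite -(@integral_translate R d x); last first.
- by move=> y; rewrite lee_fin ballI_ge0.
- by apply/measurable_EFinP; exact: measurable_ballI1.
by apply: eq_integral => y _; rewrite /ballI addrK subr0.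
Qed.

Lemma volM (c r : R) : 0 < c -> vol (c * r) = c ^+ d * vol r.
Proof.
move=> c0; apply: EFin_inj; rewrite EFinM -!(integral_ballI _ 0).
rewrite -(@integral_affine R d c 0 (fun y => (ballI (c * r) 0 y)%:E)) ?gt_eqF//.
- rewrite gtr0_norm//; congr (_ * _)%E; apply: eq_integral => y _.
  by rewrite /ballI addr0 !subr0 enormZ gtr0_norm// ltr_pM2l.
- by apply/measurable_EFinP; exact: measurable_ballI1.
- by move=> y; rewrite lee_fin ballI_ge0.
Qed.

Lemma vol_gt0 (r : R) : 0 < r -> 0 < vol r.
Proof.
move=> r0; rewrite -lte_fin -(integral_ballI r 0).
have d0 : 0 < r / d.+1%:R by rewrite divr_gt0.
apply: (@lt_le_trans _ _ (mu (cube 0 (r / d.+1%:R)))).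
  by rewrite lebesgue_cube// lte_fin exprn_gt0// mulr_gt0.
rewrite measure_integral_indic; last exact: measurable_cube.
apply: ge0_le_integral => //.
- by apply/measurable_EFinP; apply: measurable_indic; exact: measurable_cube.
- by apply/measurable_EFinP; exact: measurable_ballI1.
- move=> y _; rewrite lee_fin indicE; case: (boolP (y \in _)) => [|_]; last exact: ballI_ge0.
  by rewrite inE /ballI subr0 => h; rewrite (enorm_lt_cube r0 h).
Qed.

End EuclideanNorm.

(** * Weighted L^2 spaces and symmetric kernel operators *)

Lemma sum_geometric_le (R : realType) (r : R) n : 0 <= r -> r < 1 ->
  \sum_(0 <= k < n) r ^+ k <= (1 - r)^-1.
Proof.
move=> r0 r1; have r1' : 0 < 1 - r by rewrite subr_gt0.
rewrite -[leRHS]div1r ler_pdivlMr//.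
suff -> : (\sum_(0 <= k < n) r ^+ k) * (1 - r) = 1 - r ^+ n.
  by rewrite gerBl exprn_ge0.
elim: n => [|n IH]; first by rewrite big_nil mul0r expr0 subrr.
by rewrite big_nat_recr//= mulrDl IH exprS; ring.
Qed.

Lemma cvg_geometric_steps (R : realType) (a : nat -> R) (c s : R) : 0 <= s -> s < 1 ->
  (forall n, `|a n.+1 - a n| <= c * s ^+ n) -> cvgn a.
Proof.
move=> s0 s1 h.
have cs : cvgn (series (telescope a)).
  apply: normed_cvg.
  apply: (@series_le_cvg _ _ (geometric c s)).
  - by move=> n; rewrite /= normr_ge0.
  - by move=> n; rewrite /geometric /= (le_trans _ (h n))// normr_ge0.
  - by move=> n; rewrite /geometric /= /telescope; exact: h.
  - by apply: is_cvg_geometric_series; rewrite ger0_norm.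
rewrite (_ : a = (fun n => a 0%N + series (telescope a) n)).
  by apply: is_cvgD => //; exact: is_cvg_cst.
by apply/funext => n; exact: eq_sum_telescope.
Qed.

Lemma limn_einf_le (R : realType) (u : nat -> \bar R) (n : nat) (M : \bar R) :
  (forall N, (n <= N)%N -> (u N <= M)%E) -> (limn_einf u <= M)%E.
Proof.
move=> h; rewrite limn_einf_lim; apply: lime_le; first exact: is_cvg_einfs.
apply: nearW => j; apply: (@le_trans _ _ (u (maxn j n))).
  by apply: ereal_inf_lbound; exists (maxn j n) => //=; exact: leq_maxl.
by apply: h; exact: leq_maxr.
Qed.

(** * Completeness of a weighted L^2 space along geometrically Cauchy sequences *)

Section WeightedCompleteness.
Context dsp (T : measurableType dsp) (R : realType) (m : {measure set T -> \bar R}).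
Variables (w : T -> R) (u : nat -> T -> R) (C r D : R).
Hypotheses (mw : measurable_fun setT w) (w0 : forall x, 0 < w x).
Hypothesis mu : forall n, measurable_fun setT (u n).
Hypotheses (r0 : 0 < r) (r1 : r < 1).
Hypothesis step : forall n,
  (\int[m]_x ((u n.+1 x - u n x) ^+ 2 * w x)%:E <= ((C * r ^+ n) ^+ 2)%:E)%E.

(** Dividing the squared step by r^n leaves integrals at most C^2 r^n, still summable, while a
    finite sum at a point bounds the n-th step there by a multiple of the n-th power of the root of
    r. Pointwise convergence follows without Minkowski's inequality. *)
Let g n x := (u n.+1 x - u n x) ^+ 2 * w x * (r ^+ n)^-1.
Let G x := (\sum_(n <oo) (g n x)%:E)%E.

Let mg n : measurable_fun setT (g n).
Proof.
apply: measurable_funM => //; apply: measurable_funM => //.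
by apply: measurable_funX; exact: measurable_funB.
Qed.
Let g0 n x : 0 <= g n x.
Proof. by rewrite mulr_ge0 ?invr_ge0 ?exprn_ge0 ?(ltW r0)// mulr_ge0 ?sqr_ge0// ltW. Qed.

Let mG : measurable_fun setT G.
Proof.
apply: ge0_emeasurable_sum => [k x _ _|k _]; first by rewrite lee_fin.
exact/measurable_EFinP.
Qed.

Let G0 x : (0 <= G x)%E.
Proof. by apply: nneseries_ge0 => n _ _; rewrite lee_fin. Qed.

Let Gint : (\int[m]_x G x < +oo)%E.
Proof.
rewrite integral_nneseries//; last 2 first.
- by move=> n; exact/measurable_EFinP.
- by move=> n x _; rewrite lee_fin.
apply: (@le_lt_trans _ _ (C ^+ 2 / (1 - r))%:E); last by rewrite ltry.
apply: lime_le.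
  by apply: is_cvg_nneseries => n _ _; apply: integral_ge0 => x _; rewrite lee_fin.
apply: nearW => N.
apply: (@le_trans _ _ (\sum_(0 <= n < N) (C ^+ 2 * r ^+ n)%:E)%E).
  apply: lee_sum => n _.
  have -> : (\int[m]_x (g n x)%:E =
     ((r ^+ n)^-1)%:E * \int[m]_x ((u n.+1 x - u n x) ^+ 2 * w x)%:E)%E.
    rewrite -ge0_integralZl//.
    - by apply: eq_integral => x _; rewrite -EFinM mulrC.
    - apply/measurable_EFinP; apply: measurable_funM => //.
      by apply: measurable_funX; exact: measurable_funB.
    - by move=> x _; rewrite lee_fin mulr_ge0 ?sqr_ge0// ltW.
    - by rewrite lee_fin invr_ge0 exprn_ge0// ltW.
  apply: (@le_trans _ _ (((r ^+ n)^-1)%:E * ((C * r ^+ n) ^+ 2)%:E)%E).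
    by apply: lee_wpmul2l => //; rewrite lee_fin invr_ge0 exprn_ge0// ltW.
  rewrite -EFinM lee_fin le_eqVlt; apply/orP; left; apply/eqP.
  by field; rewrite expf_neq0// gt_eqF.
rewrite sumEFin lee_fin -mulr_sumr ler_wpM2l ?sqr_ge0// sum_geometric_le//.
exact: ltW.
Qed.

Let A := [set x | (G x < +oo)%E].

Let mA : measurable A.
Proof.
rewrite -[A]setTI; exact: emeasurable_fun_infty_o.
Qed.

Let A_ae : m (~` A) = 0%E.
Proof.
have iG : m.-integrable setT G.
  apply/integrableP; split => //.
  by under eq_integral do rewrite gee0_abs//.
have [N [mN N0 sub]] := integrable_ae measurableT iG.
apply: (subset_measure0 _ mN _ N0); first exact: measurableC.
move=> x nA; apply: sub => /= h; apply: nA.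
by rewrite /A /= -ge0_fin_numE//; exact: h.
Qed.

(** Cutting off the null set where [G] is infinite gives convergence at every point, hence a
    measurable limit. *)
Let v n x := u n x * \1_A x.

Let mv n : measurable_fun setT (v n).
Proof. by apply: measurable_funM => //; exact: measurable_indic. Qed.

Let v_cvg x : cvgn (v ^~ x).
Proof.
have [xA|xA] := pselect (A x); last first.
  rewrite (_ : v ^~ x = cst 0); first exact: is_cvg_cst.
  by apply/funext => n; rewrite /v indicE memNset// mulr0.
rewrite (_ : v ^~ x = u ^~ x); last by apply/funext => n; rewrite /v indicE mem_set// mulr1.
have wx := w0 x.
have Gx : exists2 c, 0 <= c & forall n, (u n.+1 x - u n x) ^+ 2 <= c * r ^+ n.
  exists (fine (G x) / w x); first by rewrite divr_ge0 ?fine_ge0// ltW.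
  move=> n; rewrite mulrAC ler_pdivlMr// -ler_pdivrMr ?exprn_gt0//.
  rewrite -lee_fin fineK; last by rewrite ge0_fin_numE.
  apply: (@le_trans _ _ (\sum_(0 <= k < n.+1) (g k x)%:E)%E); last first.
    by apply: nneseries_lim_ge => k _ _; rewrite lee_fin.
  rewrite big_nat_recr//= leeDr//; apply: sume_ge0 => k _; rewrite lee_fin//.
have [c c0 hc] := Gx.
apply: (@cvg_geometric_steps _ _ (Num.sqrt c) (Num.sqrt r)).
- exact: sqrtr_ge0.
- by rewrite -[ltRHS]sqrtr1 ltr_sqrt.
- move=> n; rewrite -ler_sqr ?nnegrE ?mulr_ge0 ?exprn_ge0 ?sqrtr_ge0//.
  by rewrite real_normK ?num_real// exprMn exprAC !sqr_sqrtr// ltW.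
Qed.

(** Fatou's lemma transfers the Cauchy estimate to the pointwise limit. *)
Lemma weighted_complete : (forall n N, (n <= N)%N ->
    (\int[m]_x ((u n x - u N x) ^+ 2 * w x)%:E <= ((D * r ^+ n) ^+ 2)%:E)%E) ->
  exists2 l : T -> R, measurable_fun setT l &
    forall n, (\int[m]_x ((u n x - l x) ^+ 2 * w x)%:E <= ((D * r ^+ n) ^+ 2)%:E)%E.
Proof.
move=> cauchy; pose l x := limn (v ^~ x).
have vl x : v ^~ x @ \oo --> l x by exact: v_cvg.
have ml : measurable_fun setT l.
  by apply: (measurable_fun_cvg mv) => x _; exact: vl.
exists l => // n.
have md (f h : T -> R) : measurable_fun setT f -> measurable_fun setT h ->
    measurable_fun setT (fun x => ((f x - h x) ^+ 2 * w x)%:E).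
  move=> mf mh; apply/measurable_EFinP; apply: measurable_funM => //.
  by apply: measurable_funX; exact: measurable_funB.
have d0 (f h : T -> R) x : (0 <= ((f x - h x) ^+ 2 * w x)%:E)%E.
  by rewrite lee_fin mulr_ge0 ?sqr_ge0// ltW.
rewrite (@ge0_ae_eq_integral _ _ _ m setT _ (fun x => ((v n x - l x) ^+ 2 * w x)%:E))//;
  [|exact: md|exact: md|]; last first.
  exists (~` A); split=> //; first exact: measurableC.
  move=> x /= h xA; apply: h => _; congr (((_ - _) ^+ 2 * _)%:E).
  by rewrite /v indicE mem_set// mulr1.
have -> : (\int[m]_x ((v n x - l x) ^+ 2 * w x)%:E =
    \int[m]_x limn_einf (fun N => ((v n x - v N x) ^+ 2 * w x)%:E))%E.
  apply: eq_integral => x _.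
  have cv : (fun N => ((v n x - v N x) ^+ 2 * w x)%:E) @ \oo --> ((v n x - l x) ^+ 2 * w x)%:E.
    have c1 : (fun N => v n x - v N x) @ \oo --> v n x - l x.
      by apply: cvgB => //; exact: cvg_cst.
    have c3 := cvgM (cvgM c1 c1) (cvg_cst (w x)).
    apply: cvg_EFin; first exact: nearW.
    by rewrite expr2; under eq_fun do rewrite expr2; exact: c3.
  rewrite is_cvg_limn_einfE; last by apply/cvg_ex; eexists; exact: cv.
  by apply/esym/cvg_lim.
apply: le_trans (fatou m measurableT (f := fun N x => ((v n x - v N x) ^+ 2 * w x)%:E) _ _) _ => //.
  by move=> N; exact: md.
apply: (@limn_einf_le _ _ n) => N nN.
apply: le_trans (cauchy _ _ nN); apply: ge0_le_integral => //.
- exact: md.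
- exact: md.
- move=> x _; rewrite lee_fin ler_wpM2r ?(ltW (w0 _))// /v -mulrBl exprMn.
  by rewrite ler_piMr ?sqr_ge0// exprn_ile1// indicE ?ler0n// lern1 leq_b1.
Qed.

End WeightedCompleteness.

Section IntegrationHelpers.
Context dsp (T : measurableType dsp) (R : realType) (m : {measure set T -> \bar R}).
Implicit Types f g : T -> R.

Local Notation intble f := (m.-integrable [set: T] (fun x => (f x)%:E)).

Lemma ge0_integrable f : measurable_fun setT f -> (forall x, 0 <= f x) ->
  (\int[m]_x (f x)%:E < +oo)%E -> intble f.
Proof.
move=> mf f0 foo; apply/integrableP; split; first exact/measurable_EFinP.
by under eq_integral do rewrite abse_EFin ger0_norm//.
Qed.

Lemma le_integrableR f g : measurable_fun setT f -> (forall x, `|f x| <= g x) ->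
  intble g -> intble f.
Proof.
move=> mf fg ig; apply: le_integrable ig => //; first exact/measurable_EFinP.
by move=> x _; rewrite !abse_EFin lee_fin (le_trans (fg x))// ler_norm.
Qed.

Lemma integrableDR f g : intble f -> intble g -> intble (fun x => f x + g x).
Proof.
move=> ia ib; rewrite (_ : (fun _ => _) = (fun x => (f x)%:E) \+ (fun x => (g x)%:E))%E//.
exact: integrableD.
Qed.

Lemma integrableZR (a : R) f : intble f -> intble (fun x => a * f x).
Proof.
move=> ia; rewrite (_ : (fun _ => _) = fun x => a%:E * (f x)%:E)%E//.
exact: integrableZl.
Qed.

Lemma integrableNR f : intble f -> intble (fun x => - f x).
Proof. by move=> /(integrableZR (-1)); under eq_fun do rewrite mulN1r. Qed.

Lemma integrableBR f g : intble f -> intble g -> intble (fun x => f x - g x).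
Proof. by move=> ia ib; apply: integrableDR => //; exact: integrableNR. Qed.

Lemma EFin_Rint f : intble f -> ((\int[m]_x f x)%R%:E = \int[m]_x (f x)%:E)%E.
Proof. by move=> fi; rewrite /Rintegral fineK//; exact: integrable_fin_num. Qed.

Lemma integrable_lty_ge0 f : intble f -> (forall x, 0 <= f x) ->
  (\int[m]_x (f x)%:E < +oo)%E.
Proof.
by move=> /integrableP[_ fi] f0; under eq_integral do rewrite -[f _]ger0_norm//.
Qed.

Lemma ge0_le_integralR f g : measurable_fun setT f -> measurable_fun setT g ->
  (forall x, 0 <= f x) -> (forall x, f x <= g x) ->
  (\int[m]_x (f x)%:E <= \int[m]_x (g x)%:E)%E.
Proof.
move=> mf mg f0 fg; apply: ge0_le_integral => //.
- by move=> x _; rewrite lee_fin.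
- exact/measurable_EFinP.
- exact/measurable_EFinP.
- by move=> x _; rewrite lee_fin.
Qed.

Lemma ge0_integralZlR (a : R) f : 0 <= a -> measurable_fun setT f -> (forall x, 0 <= f x) ->
  (\int[m]_x (a * f x)%:E = a%:E * \int[m]_x (f x)%:E)%E.
Proof.
move=> a0 mf f0; under eq_integral do rewrite EFinM.
rewrite ge0_integralZl//; first exact/measurable_EFinP.
by move=> x _; rewrite lee_fin.
Qed.

(** Stands for the nonnegativity of the integral of (F - G)^2 when [F] and [G] may be infinite, so
    that the difference cannot be formed. *)
Lemma integral_AMGM (F G : T -> \bar R) : measurable_fun setT F -> measurable_fun setT G ->
  (forall x, (0 <= F x)%E) -> (forall x, (0 <= G x)%E) ->
  (\int[m]_x (F x * G x) + \int[m]_x (F x * G x)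
    <= \int[m]_x (F x * F x) + \int[m]_x (G x * G x))%E.
Proof.
move=> mF mG F0 G0.
have nn A C (A0 : forall x, (0 <= A x)%E) (C0 : forall x, (0 <= C x)%E) (x : T) (_ : setT x) :
   (0 <= (A x : \bar R) * C x)%E by apply: mule_ge0.
rewrite -!ge0_integralD//; try exact: emeasurable_funM; try exact: nn.
apply: ge0_le_integral => //.
- by move=> x _; apply: adde_ge0; apply: nn.
- by apply: emeasurable_funD; exact: emeasurable_funM.
- by apply: emeasurable_funD; exact: emeasurable_funM.
move=> x _; move: (F0 x) (G0 x).
case: (F x) (G x) => [s||] [t||] h1 h2 //; rewrite ?mulyy ?addey ?addye ?leey//.
by rewrite -!EFinM -!EFinD lee_fin; have := sqr_ge0 (s - t); rewrite sqrrB; lra.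
Qed.

End IntegrationHelpers.

Lemma measurable_inv_gt0 dsp (T : measurableType dsp) (R : realType) (f : T -> R) :
  measurable_fun setT f -> (forall x, 0 < f x) -> measurable_fun setT (fun x => (f x)^-1).
Proof.
move=> mf f0; rewrite (_ : (fun _ => _) = (@powR R ^~ (-1)) \o f).
  exact: measurableT_comp (measurable_powR (-1)) mf.
by apply/funext => x; rewrite /= powR_inv1// ltW.
Qed.

(** Optimising over [s] recovers Cauchy-Schwarz. The optimal ratio degenerates when [b] or [c]
    vanishes, so both roots are shifted by a small [e1]. *)
Lemma AMGM_sqrt (R : realType) (a b c : R) : 0 <= b -> 0 <= c ->
  (forall s, 0 < s -> a <= (s * b + s^-1 * c) / 2) -> a <= Num.sqrt b * Num.sqrt c.
Proof.
move=> b0 c0 h; rewrite leNgt; apply/negP => lt.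
set p := Num.sqrt b in lt *; set q := Num.sqrt c in lt *.
have pb : b = p ^+ 2 by rewrite sqr_sqrtr.
have qc : c = q ^+ 2 by rewrite sqr_sqrtr.
have p0 : 0 <= p by rewrite sqrtr_ge0.
have q0 : 0 <= q by rewrite sqrtr_ge0.
have a0 : 0 < a by apply: le_lt_trans lt; rewrite mulr_ge0.
pose e := (a - p * q) / (p + q + 1) .
have pq1 : 0 < p + q + 1 by lra.
have e0 : 0 < e by rewrite divr_gt0// subr_gt0.
pose e1 := Num.min e 1.
have e10 : 0 < e1 by rewrite lt_min e0 ltr01.
have e11 : e1 <= 1 by rewrite ge_min lexx orbT.
have e1e : e1 * (p + q + 1) <= a - p * q.
  by rewrite -ler_pdivlMr// ge_min lexx.
have pe : 0 < p + e1 by lra.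
have qe : 0 < q + e1 by lra.
have := h ((q + e1) / (p + e1)) (divr_gt0 qe pe).
have -> : ((q + e1) / (p + e1) * b + ((q + e1) / (p + e1))^-1 * c) / 2 =
   ((q + e1) * (p ^+ 2 / (p + e1)) + (p + e1) * (q ^+ 2 / (q + e1))) / 2.
  by rewrite pb qc; field; rewrite !gt_eqF.
have h1 : p ^+ 2 / (p + e1) <= p by rewrite ler_pdivrMr// expr2 mulrDr lerDl mulr_ge0// ltW.
have h2 : q ^+ 2 / (q + e1) <= q by rewrite ler_pdivrMr// expr2 mulrDr lerDl mulr_ge0// ltW.
have h3 : (q + e1) * (p ^+ 2 / (p + e1)) <= (q + e1) * p by rewrite ler_wpM2l// ltW.
have h4 : (p + e1) * (q ^+ 2 / (q + e1)) <= (p + e1) * q by rewrite ler_wpM2l// ltW.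
have : e1 * (p + q + 1) = e1 * p + e1 * q + e1 by ring.
move: h3 h4; rewrite !mulrDl; have : p * q = q * p by rewrite mulrC.
have : 0 <= e1 * p by rewrite mulr_ge0// ltW.
have : 0 <= e1 * q by rewrite mulr_ge0// ltW.
lra.
Qed.

(** * The averaging operator of a symmetric kernel, with its weighted L^2 space *)

Section KernelOperator.
Context dsp (X : measurableType dsp) (R : realType).
Variable mu : {sigma_finite_measure set X -> \bar R}.
Variables (k : X -> X -> R) (rho m : X -> R) (B : R).
Hypothesis mk : measurable_fun setT (fun p : X * X => k p.1 p.2).
Hypothesis k_ge0 : forall x y, 0 <= k x y.
Hypothesis k_sym : forall x y, k x y = k y x.
Hypothesis mrho : measurable_fun setT rho.
Hypothesis rho_gt0 : forall x, 0 < rho x.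
Hypothesis mm : measurable_fun setT m.
Hypothesis m_gt0 : forall x, 0 < m x.
Hypothesis kE : forall x, (\int[mu]_y (k x y * rho y)%:E = (m x)%:E)%E.
Hypothesis B_ge0 : 0 <= B.
Hypothesis kB : forall x, (\int[mu]_y (k x y * (rho y / m y))%:E <= B%:E)%E.

Local Notation M2 := (mu \x mu)%E.
Local Notation intble f := (mu.-integrable [set: X] (fun x => (f x)%:E)).
Local Notation intble2 f := (M2.-integrable [set: X * X] (fun x => (f x)%:E)).
Local Notation w x := (m x * rho x).

Implicit Types f g u v : X -> R.

Definition sqint (f : X -> R) :=
  measurable_fun setT f /\ (\int[mu]_x (f x ^+ 2 * m x * rho x)%:E < +oo)%E.

Definition wip (f g : X -> R) := \int[mu]_x (f x * g x * w x).

Let rho_ge0 x : 0 <= rho x. Proof. exact: ltW. Qed.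
Let m_ge0 x : 0 <= m x. Proof. exact: ltW. Qed.
Let w_ge0 x : 0 <= w x. Proof. exact: mulr_ge0. Qed.
Let mw : measurable_fun setT (fun x => w x). Proof. exact: measurable_funM. Qed.
Let mk1 x : measurable_fun setT (k x).
Proof. exact: (measurableT_comp mk (pair1_measurable x)). Qed.

Lemma sqint_mul f g : sqint f -> sqint g -> intble (fun x => f x * g x * w x).
Proof.
move=> [mf fi] [mg gi].
have h (u : X -> R) : measurable_fun setT u ->
    (\int[mu]_x (u x ^+ 2 * m x * rho x)%:E < +oo)%E -> intble (fun x => u x ^+ 2 * w x).
  move=> mu' ui; apply: ge0_integrable.
  - by apply: measurable_funM => //; exact: measurable_funX.
  - by move=> x; rewrite mulr_ge0// sqr_ge0.
  - by under eq_integral do rewrite mulrA.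
apply: (@le_integrableR _ _ _ _ _ (fun x => f x ^+ 2 * w x + g x ^+ 2 * w x)).
- by do 2 apply: measurable_funM => //.
- move=> x; rewrite normrM (ger0_norm (w_ge0 x)) -mulrDl ler_wpM2r//.
  rewrite ler_norml; have := sqr_ge0 (f x + g x); have := sqr_ge0 (f x - g x).
  have := sqr_ge0 (f x); have := sqr_ge0 (g x).
  rewrite sqrrB sqrrD; lra.
- by apply: integrableDR; exact: h.
Qed.

Lemma sqint_sqr f : sqint f -> intble (fun x => f x ^+ 2 * w x).
Proof. by move=> /[dup] h /(sqint_mul h); under eq_fun do rewrite -expr2. Qed.

Lemma sqintP f : measurable_fun setT f -> intble (fun x => f x ^+ 2 * w x) -> sqint f.
Proof.
move=> mf fi; split=> //; under eq_integral do rewrite -mulrA.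
by apply: (integrable_lty_ge0 fi) => x; rewrite mulr_ge0// sqr_ge0.
Qed.

Lemma sqint_lin a f g : sqint f -> sqint g -> sqint (fun x => a * f x + g x).
Proof.
move=> /[dup] hf [mf _] /[dup] hg [mg _]; apply: sqintP.
  by apply: measurable_funD => //; exact: measurable_funM.
have -> : (fun x => ((a * f x + g x) ^+ 2 * w x)%:E) =
  (fun x => (a ^+ 2 * (f x ^+ 2 * w x) + (2 * a * (f x * g x * w x) + g x ^+ 2 * w x))%:E).
  by apply/funext => x; congr (_%:E); ring.
apply: integrableDR; first by apply: integrableZR; exact: sqint_sqr.
apply: integrableDR; last exact: sqint_sqr.
by apply: integrableZR; exact: sqint_mul.
Qed.

Lemma wipC f g : wip f g = wip g f.
Proof. by apply: eq_Rintegral => x _; rewrite (mulrC (f x)). Qed.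

Lemma wip_lin a f g u : sqint f -> sqint g -> sqint u ->
  wip (fun x => a * f x + g x) u = a * wip f u + wip g u.
Proof.
move=> hf hg hu; rewrite /wip -RintegralZl//; last exact: sqint_mul.
rewrite -RintegralD//; last 2 first.
- by apply: integrableZR; exact: sqint_mul.
- exact: sqint_mul.
by apply: eq_Rintegral => x _; ring.
Qed.

Lemma wip_ge0 f : 0 <= wip f f.
Proof. by apply: Rintegral_ge0 => x _; rewrite mulr_ge0// -expr2 sqr_ge0. Qed.

Lemma wipE f : sqint f -> (\int[mu]_x (f x ^+ 2 * w x)%:E = (wip f f)%:E)%E.
Proof.
move=> hf; rewrite /wip EFin_Rint; last exact: sqint_mul.
by apply: eq_integral => x _; rewrite expr2.
Qed.

(* [|f| rho <= (s f^2 m rho + s^-1 rho / m) / 2] makes [f] locally integrable at every point. *)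
Let local_AMGM (f : X -> R) x y s : 0 < s ->
  k x y * `|f y| * rho y <= 2^-1 * (s * (k x y * (f y ^+ 2 * w y))) +
      2^-1 * (s^-1 * (k x y * (rho y / m y))).
Proof.
move=> s0.
have -> : 2^-1 * (s * (k x y * (f y ^+ 2 * w y))) + 2^-1 * (s^-1 * (k x y * (rho y / m y)))
  = k x y * ((s * m y * f y ^+ 2 + (s * m y)^-1) / 2) * rho y.
  by field; rewrite !gt_eqF.
rewrite ler_wpM2r// ler_wpM2l//.
have z0 : 0 < s * m y by rewrite mulr_gt0.
rewrite -(ler_pM2l z0).
have -> : s * m y * ((s * m y * f y ^+ 2 + (s * m y)^-1) / 2) =
  ((s * m y) ^+ 2 * f y ^+ 2 + 1) / 2 by field; rewrite !gt_eqF.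
rewrite ler_pdivlMr//.
have := sqr_ge0 (s * m y * `|f y| - 1).
rewrite sqrrB expr1n mulr1 exprMn real_normK ?num_real//.
lra.
Qed.

Hypothesis k_le1 : forall x y, k x y <= 1.

Lemma sqint_local f x : sqint f -> intble (fun y => k x y * `|f y| * rho y).
Proof.
move=> /[dup] hf [mf _].
apply: (@le_integrableR _ _ _ _ _ (fun y => 2^-1 * (1 * (k x y * (f y ^+ 2 * w y))) +
      2^-1 * (1^-1 * (k x y * (rho y / m y))))).
- by do 2 apply: measurable_funM => //; exact: measurableT_comp.
- move=> y; rewrite ger0_norm; first exact: local_AMGM.
  by rewrite mulr_ge0// mulr_ge0.
- apply: integrableDR; do 2 apply: integrableZR.
    apply: (le_integrableR _ _ (sqint_sqr hf)).
      by do 2 apply: measurable_funM => //; exact: measurable_funX.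
    move=> y; rewrite ger0_norm.
      by rewrite ler_piMl// mulr_ge0// sqr_ge0.
    by rewrite mulr_ge0// mulr_ge0// sqr_ge0.
  apply: ge0_integrable.
  + apply: measurable_funM => //; apply: measurable_funM => //.
    exact: measurable_inv_gt0.
  + by move=> y; rewrite mulr_ge0// divr_ge0.
  + by apply: le_lt_trans (kB x) _; rewrite ltry.
Qed.

Lemma sqint_section f x : sqint f -> intble (fun y => k x y * f y * rho y).
Proof.
move=> hf; apply: (le_integrableR _ _ (sqint_local x hf)).
  by case: hf => mf _; do 2 apply: measurable_funM => //.
by move=> y; rewrite !normrM (ger0_norm (k_ge0 _ _)) (ger0_norm (rho_ge0 _)).
Qed.

Definition op f x := (m x)^-1 * \int[mu]_y (k x y * f y * rho y).

Lemma op_lin a f g x : sqint f -> sqint g ->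
  op (fun y => a * f y + g y) x = a * op f x + op g x.
Proof.
move=> hf hg; rewrite /op mulrCA -mulrDr; congr (_ * _).
rewrite -RintegralZl//; last exact: sqint_section.
rewrite -RintegralD//; last 2 first.
- by apply: integrableZR; exact: sqint_section.
- exact: sqint_section.
by apply: eq_Rintegral => y _; ring.
Qed.

Lemma integrable_k x : intble (fun y => k x y * rho y).
Proof.
apply: ge0_integrable; last by rewrite kE ltry.
- exact: measurable_funM.
- by move=> y; rewrite mulr_ge0.
Qed.

Lemma op_cst c x : op (fun=> c) x = c.
Proof.
rewrite /op (_ : \int[mu]_y _ = c * m x); first by field; rewrite gt_eqF.
rewrite -[m x]/(fine (m x)%:E) -kE -[fine _]/(\int[mu]_y (k x y * rho y)).
rewrite -RintegralZl//; last exact: integrable_k.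
by apply: eq_Rintegral => y _; ring.
Qed.

(** Cauchy-Schwarz after splitting the integrand into f (m rho)^(1/2) and (rho / m)^(1/2) on the
    support of the kernel; [B] bounds the integral of the second square. *)
Lemma op_bound f x : sqint f ->
  `|op f x| <= (m x)^-1 * (Num.sqrt (wip f f) * Num.sqrt B).
Proof.
move=> /[dup] hf [mf _]; rewrite /op normrM ger0_norm ?invr_ge0//.
rewrite ler_wpM2l ?invr_ge0//.
apply: (@le_trans _ _ (\int[mu]_y (k x y * `|f y| * rho y))).
  apply: le_trans (le_normr_Rintegral _ _) _ => //; first exact: sqint_section.
  rewrite le_eqVlt; apply/orP; left; apply/eqP; apply: eq_Rintegral => y _.
  by rewrite !normrM (ger0_norm (k_ge0 _ _)) (ger0_norm (rho_ge0 _)).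
apply: AMGM_sqrt => //; first exact: wip_ge0.
move=> s s0; rewrite -lee_fin EFin_Rint; last exact: sqint_local.
have m1 : measurable_fun setT (fun y => k x y * (f y ^+ 2 * w y)).
  by do 2 apply: measurable_funM => //; exact: measurable_funX.
have m2 : measurable_fun setT (fun y => k x y * (rho y / m y)).
  by do 2 apply: measurable_funM => //; exact: measurable_inv_gt0.
have p1 y : 0 <= k x y * (f y ^+ 2 * w y) by rewrite mulr_ge0// mulr_ge0// sqr_ge0.
have p2 y : 0 <= k x y * (rho y / m y) by rewrite mulr_ge0// divr_ge0.
have s2 : 0 <= 2^-1 * s by rewrite mulr_ge0// ltW.
have s3 : 0 <= 2^-1 * s^-1 by rewrite mulr_ge0// invr_ge0 ltW.
apply: (@le_trans _ _ (\int[mu]_y (2^-1 * s * (k x y * (f y ^+ 2 * w y)) +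
      2^-1 * s^-1 * (k x y * (rho y / m y)))%:E)%E).
  apply: ge0_le_integralR.
  - by do 2 apply: measurable_funM => //; exact: measurableT_comp.
  - by apply: measurable_funD; exact: measurable_funM.
  - by move=> y; rewrite mulr_ge0// mulr_ge0.
  - by move=> y; rewrite -!(mulrA 2^-1); exact: local_AMGM.
under eq_integral do rewrite EFinD.
rewrite ge0_integralD//; last 4 first.
- by move=> y _; rewrite lee_fin mulr_ge0.
- by apply/measurable_EFinP; exact: measurable_funM.
- by move=> y _; rewrite lee_fin mulr_ge0.
- by apply/measurable_EFinP; exact: measurable_funM.
rewrite !ge0_integralZlR// mulrDl EFinD leeD//.
- rewrite [leRHS](_ : _ = (2^-1 * s)%:E * (wip f f)%:E)%E; last first.
    by rewrite -EFinM; congr (_%:E); ring.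
  apply: lee_wpmul2l; rewrite ?lee_fin// -wipE//; apply: ge0_le_integralR => //.
  + by apply: measurable_funM => //; exact: measurable_funX.
  + by move=> y; rewrite ler_piMl// mulr_ge0// sqr_ge0.
- rewrite [leRHS](_ : _ = (2^-1 * s^-1)%:E * B%:E)%E; last first.
    by rewrite -EFinM; congr (_%:E); ring.
  by apply: lee_wpmul2l; rewrite ?lee_fin//.
Qed.

Lemma measurable_integral_section (F : X * X -> \bar R) : measurable_fun setT F ->
  measurable_fun setT (fun x => \int[mu]_y F (x, y))%E.
Proof.
move=> mF; under eq_fun do rewrite integralE.
apply: emeasurable_funB.
- apply: eq_measurable_fun (measurable_fun_fubini_tonelli_F (F^\+%E) (m2 := mu)
      (measurable_funepos mF) (fun p => funepos_ge0 F p)) => x _.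
  by apply: eq_integral => y _; rewrite !funeposE.
- apply: eq_measurable_fun (measurable_fun_fubini_tonelli_F (F^\-%E) (m2 := mu)
      (measurable_funeneg mF) (fun p => funeneg_ge0 F p)) => x _.
  by apply: eq_integral => y _; rewrite !funenegE.
Qed.

Lemma measurable_Rintegral_section (F : X -> X -> R) :
  measurable_fun setT (fun p : X * X => F p.1 p.2) ->
  measurable_fun setT (fun x => \int[mu]_y F x y).
Proof.
move=> mF; apply: (measurableT_comp (fine_measurable measurableT)).
apply: (measurable_integral_section (F := fun p => (F p.1 p.2)%:E)).
exact/measurable_EFinP.
Qed.

Let mfst f : measurable_fun setT f -> measurable_fun setT (fun p : X * X => f p.1).
Proof. by move=> mf; apply: (measurableT_comp mf). Qed.
Let msnd f : measurable_fun setT f -> measurable_fun setT (fun p : X * X => f p.2).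
Proof. by move=> mf; apply: (measurableT_comp mf). Qed.

Lemma measurable_op f : measurable_fun setT f -> measurable_fun setT (op f).
Proof.
move=> mf; apply: measurable_funM; first exact: measurable_inv_gt0.
apply: (measurable_Rintegral_section (F := fun x y => k x y * f y * rho y)) => /=.
apply: measurable_funM; last exact: msnd.
by apply: measurable_funM => //; exact: msnd.
Qed.

(** * Forms of a symmetric kernel [J <= k], applied both to [k] itself and to the half-ball
    kernel *)

Section SubKernel.
Variable J : X -> X -> R.
Hypothesis mJ : measurable_fun setT (fun p : X * X => J p.1 p.2).
Hypothesis J_ge0 : forall x y, 0 <= J x y.
Hypothesis J_sym : forall x y, J x y = J y x.
Hypothesis J_le : forall x y, J x y <= k x y.

Definition jbar x := \int[mu]_y (J x y * rho y).
Local Notation K p := (J p.1 p.2 * rho p.1 * rho p.2).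

Let mJ1 x : measurable_fun setT (J x).
Proof. exact: (measurableT_comp mJ (pair1_measurable x)). Qed.

Lemma jbarE x : (\int[mu]_y (J x y * rho y)%:E = (jbar x)%:E)%E.
Proof.
rewrite /jbar EFin_Rint//; apply: (le_integrableR _ _ (integrable_k x)).
  exact: measurable_funM.
by move=> y; rewrite ger0_norm ?mulr_ge0// ler_wpM2r.
Qed.

Lemma jbar_le x : jbar x <= m x.
Proof.
rewrite -lee_fin -jbarE -kE; apply: ge0_le_integralR.
- exact: measurable_funM.
- exact: measurable_funM.
- by move=> y; rewrite mulr_ge0.
- by move=> y; rewrite ler_wpM2r.
Qed.

Lemma jbar_ge0 x : 0 <= jbar x.
Proof. by apply: Rintegral_ge0 => y _; rewrite mulr_ge0. Qed.

Lemma measurable_jbar : measurable_fun setT jbar.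
Proof.
apply: (measurable_Rintegral_section (F := fun x y => J x y * rho y)) => /=.
by apply: measurable_funM => //; exact: msnd.
Qed.

Let mK : measurable_fun setT (fun p : X * X => K p).
Proof.
apply: measurable_funM; last exact: msnd.
by apply: measurable_funM => //; exact: mfst.
Qed.
Let K_ge0 p : 0 <= K p. Proof. by rewrite mulr_ge0// mulr_ge0. Qed.

Lemma integral_K1 u : measurable_fun setT u -> (forall x, 0 <= u x) ->
  (\int[M2]_p (K p * u p.1)%:E = \int[mu]_x (u x * (jbar x * rho x))%:E)%E.
Proof.
move=> mu0 u0; rewrite (fubini_tonelli1 (fun p => (K p * u p.1)%:E))//.
- apply: eq_integral => x _; rewrite /fubini_F /=.
  transitivity (\int[mu]_y ((u x * rho x) * (J x y * rho y))%:E)%E.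
    by apply: eq_integral => y _; congr (_%:E); ring.
  rewrite ge0_integralZlR ?mulr_ge0//.
  + by rewrite jbarE -EFinM; congr (_%:E); ring.
  + exact: measurable_funM.
  + by move=> y; rewrite mulr_ge0.
- by apply/measurable_EFinP; apply: measurable_funM => //; exact: mfst.
- by move=> p; rewrite lee_fin mulr_ge0.
Qed.

Lemma integral_K2 u : measurable_fun setT u -> (forall x, 0 <= u x) ->
  (\int[M2]_p (K p * u p.2)%:E = \int[mu]_x (u x * (jbar x * rho x))%:E)%E.
Proof.
move=> mu0 u0; rewrite (fubini_tonelli2 (fun p => (K p * u p.2)%:E))//.
- apply: eq_integral => x _; rewrite /fubini_G /=.
  transitivity (\int[mu]_y ((u x * rho x) * (J x y * rho y))%:E)%E.
    by apply: eq_integral => y _; rewrite J_sym; congr (_%:E); ring.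
  rewrite ge0_integralZlR ?mulr_ge0//.
  + by rewrite jbarE -EFinM; congr (_%:E); ring.
  + exact: measurable_funM.
  + by move=> y; rewrite mulr_ge0.
- by apply/measurable_EFinP; apply: measurable_funM => //; exact: msnd.
- by move=> p; rewrite lee_fin mulr_ge0.
Qed.

Lemma sqint_jbar f : sqint f -> intble (fun x => f x ^+ 2 * (jbar x * rho x)).
Proof.
move=> hf; have [mf _] := hf; apply: (le_integrableR _ _ (sqint_sqr hf)).
  apply: measurable_funM; first exact: measurable_funX.
  by apply: measurable_funM => //; exact: measurable_jbar.
move=> x; rewrite ger0_norm.
  by rewrite ler_wpM2l ?sqr_ge0// ler_wpM2r// jbar_le.
by rewrite mulr_ge0 ?sqr_ge0// mulr_ge0// jbar_ge0.
Qed.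

Lemma integrable_K1 f : sqint f -> intble2 (fun p => K p * f p.1 ^+ 2).
Proof.
move=> hf; have [mf _] := hf; apply: ge0_integrable.
- by apply: measurable_funM => //; exact: (mfst (measurable_funX 2 mf)).
- by move=> p; rewrite mulr_ge0// sqr_ge0.
- rewrite (integral_K1 (u := fun x => f x ^+ 2)); last by move=> x; rewrite sqr_ge0.
    apply: (integrable_lty_ge0 (sqint_jbar hf)) => x.
    by rewrite mulr_ge0 ?sqr_ge0// mulr_ge0// jbar_ge0.
  exact: measurable_funX.
Qed.

Lemma integrable_K2 f : sqint f -> intble2 (fun p => K p * f p.2 ^+ 2).
Proof.
move=> hf; have [mf _] := hf; apply: ge0_integrable.
- by apply: measurable_funM => //; exact: (msnd (measurable_funX 2 mf)).
- by move=> p; rewrite mulr_ge0// sqr_ge0.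
- rewrite (integral_K2 (u := fun x => f x ^+ 2)); last by move=> x; rewrite sqr_ge0.
    apply: (integrable_lty_ge0 (sqint_jbar hf)) => x.
    by rewrite mulr_ge0 ?sqr_ge0// mulr_ge0// jbar_ge0.
  exact: measurable_funX.
Qed.

Lemma Rintegral_K1 f : sqint f ->
  \int[M2]_p (K p * f p.1 ^+ 2) = \int[mu]_x (f x ^+ 2 * (jbar x * rho x)).
Proof.
move=> [mf _]; congr fine; apply: (integral_K1 (u := fun x => f x ^+ 2)).
  exact: measurable_funX.
by move=> x; rewrite sqr_ge0.
Qed.

Lemma Rintegral_K2 f : sqint f ->
  \int[M2]_p (K p * f p.2 ^+ 2) = \int[mu]_x (f x ^+ 2 * (jbar x * rho x)).
Proof.
move=> [mf _]; congr fine; apply: (integral_K2 (u := fun x => f x ^+ 2)).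
  exact: measurable_funX.
by move=> x; rewrite sqr_ge0.
Qed.

Lemma integrable_K12 f g : sqint f -> sqint g ->
  intble2 (fun p => K p * (f p.1 * g p.2)).
Proof.
move=> hf hg; have [mf _] := hf; have [mg _] := hg.
apply: (le_integrableR _ _ (integrableDR (integrable_K1 hf) (integrable_K2 hg))).
  by apply: measurable_funM => //; apply: measurable_funM; [exact: mfst|exact: msnd].
move=> p; rewrite normrM (ger0_norm (K_ge0 p)) -mulrDr ler_wpM2l//.
have := sqr_ge0 (f p.1 + g p.2); have := sqr_ge0 (f p.1 - g p.2).
have := sqr_ge0 (f p.1); have := sqr_ge0 (g p.2).
rewrite ler_norml sqrrB sqrrD; lra.
Qed.

Definition kform f g := \int[M2]_p (K p * (f p.1 * g p.2)).

Lemma kformE f g : sqint f -> sqint g ->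
  kform f g = \int[mu]_x (f x * rho x * \int[mu]_y (J x y * g y * rho y)).
Proof.
move=> hf hg; have [mf _] := hf; have [mg _] := hg.
rewrite /kform /Rintegral -integral12_prod_meas1; last exact: integrable_K12.
congr fine; apply: eq_integral => x _; rewrite /fubini_F /=.
have i1 : intble (fun y => J x y * g y * rho y).
  apply: (le_integrableR _ _ (sqint_local x hg)).
    by do 2 apply: measurable_funM => //.
  move=> y; rewrite !normrM (ger0_norm (J_ge0 _ _)) (ger0_norm (rho_ge0 _)).
  by rewrite ler_wpM2r// ler_wpM2r.
rewrite EFinM -[(fine _)%:E]/((\int[mu]_y (J x y * g y * rho y))%R%:E) EFin_Rint//.
rewrite -integralZl//; apply: eq_integral => y _; rewrite -EFinM; congr (_%:E); ring.
Qed.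

Lemma kform_sym f g : sqint f -> sqint g -> kform f g = kform g f.
Proof.
move=> hf hg; rewrite /kform /Rintegral -integral12_prod_meas1; last exact: integrable_K12.
rewrite -integral21_prod_meas1; last exact: integrable_K12.
congr fine; apply: eq_integral => x _; rewrite /fubini_F /fubini_G /=.
by apply: eq_integral => y _; rewrite (J_sym y); congr (_%:E); ring.
Qed.

End SubKernel.

Lemma jbar_k x : jbar k x = m x.
Proof. by rewrite /jbar /Rintegral kE. Qed.

Lemma wipEj f : wip f f = \int[mu]_x (f x ^+ 2 * (jbar k x * rho x)).
Proof. by apply: eq_Rintegral => x _; rewrite jbar_k expr2. Qed.

(** Jensen's inequality for the square: integrate the tangent line bound 2 c f - c^2 <= f^2 with c
    the average of f. An infinite right-hand side is set aside first. *)
Lemma op_sqr_le f x : sqint f ->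
  ((op f x ^+ 2 * m x)%:E <= \int[mu]_y (k x y * f y ^+ 2 * rho y)%:E)%E.
Proof.
move=> /[dup] hf [mf _]; set c := op f x.
have [|] := boolP (\int[mu]_y (k x y * f y ^+ 2 * rho y)%:E < +oo)%E; last first.
  by rewrite -leNgt leye_eq => /eqP ->; rewrite leey.
move=> fin.
have i2 : intble (fun y => k x y * f y ^+ 2 * rho y).
  apply: ge0_integrable => //.
    by do 2 apply: measurable_funM => //; exact: measurable_funX.
  by move=> y; rewrite mulr_ge0// mulr_ge0// sqr_ge0.
have i1 := sqint_section x hf; have i0 := integrable_k x.
rewrite -EFin_Rint// lee_fin.
have -> : c ^+ 2 * m x = \int[mu]_y (2 * c * (k x y * f y * rho y) - c ^+ 2 * (k x y * rho y)).
  rewrite RintegralB//; last 2 first.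
  - exact: integrableZR.
  - exact: integrableZR.
  rewrite !RintegralZl//.
  rewrite [X in _ - _ * X](_ : _ = m x); last by rewrite /Rintegral kE.
  rewrite (_ : \int[mu]_y _ = c * m x); first by ring.
  by rewrite /c /op; field; rewrite gt_eqF.
apply: le_Rintegral => //.
  by apply: integrableBR; exact: integrableZR.
move=> y _.
have -> : 2 * c * (k x y * f y * rho y) - c ^+ 2 * (k x y * rho y) =
  k x y * (2 * c * f y - c ^+ 2) * rho y by ring.
rewrite ler_wpM2r// ler_wpM2l//.
have := sqr_ge0 (f y - c); rewrite sqrrB; lra.
Qed.

Let k_lexx x y : k x y <= k x y. Proof. exact: lexx. Qed.
Local Notation K p := (k p.1 p.2 * rho p.1 * rho p.2).

Lemma measurable_K : measurable_fun setT (fun p : X * X => K p).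
Proof.
apply: measurable_funM; last exact: msnd.
by apply: measurable_funM => //; exact: mfst.
Qed.

Lemma op_contr f : sqint f ->
  (\int[mu]_x (op f x ^+ 2 * w x)%:E <= \int[mu]_x (f x ^+ 2 * w x)%:E)%E.
Proof.
move=> /[dup] hf [mf _].
have mf2 := measurable_funX 2 mf.
have f20 x : 0 <= f x ^+ 2 by rewrite sqr_ge0.
have -> : (\int[mu]_x (f x ^+ 2 * w x)%:E = \int[M2]_p (K p * f p.2 ^+ 2)%:E)%E.
  rewrite (integral_K2 mk k_ge0 k_sym k_lexx mf2 f20).
  by apply: eq_integral => x _; rewrite jbar_k.
have mF : measurable_fun setT (fun p : X * X => (K p * f p.2 ^+ 2)%:E).
  apply/measurable_EFinP; apply: measurable_funM; first exact: measurable_K.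
  exact: (msnd mf2).
have F0 p : (0 <= (K p * f p.2 ^+ 2)%:E)%E.
  by rewrite lee_fin mulr_ge0// mulr_ge0// mulr_ge0.
rewrite fubini_tonelli1//; apply: ge0_le_integral => //.
- by move=> x _; rewrite lee_fin mulr_ge0// sqr_ge0.
- apply/measurable_EFinP; apply: measurable_funM => //.
  exact: measurable_funX (measurable_op mf).
- exact: measurable_fun_fubini_tonelli_F.
- move=> x _; rewrite /fubini_F /=.
  rewrite [leRHS](_ : _ = (rho x)%:E * \int[mu]_y (k x y * f y ^+ 2 * rho y)%:E)%E; last first.
    rewrite -ge0_integralZlR//; first by apply: eq_integral => y _; congr (_%:E); ring.
      by do 2 apply: measurable_funM => //.
    by move=> y; rewrite mulr_ge0// mulr_ge0.
  rewrite mulrA mulrC EFinM; apply: lee_wpmul2l; first by rewrite lee_fin.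
  exact: op_sqr_le.
Qed.

Lemma sqint_op f : sqint f -> sqint (op f).
Proof.
move=> /[dup] hf [mf fi]; have mo := measurable_op mf; split=> //.
under eq_integral do rewrite -mulrA.
apply: le_lt_trans (op_contr hf) _.
by under eq_integral do rewrite mulrA.
Qed.

Lemma wip_op_contr f : sqint f -> wip (op f) (op f) <= wip f f.
Proof.
move=> hf; have ho := sqint_op hf.
by rewrite -lee_fin -!wipE//; exact: op_contr.
Qed.

Lemma wip_op f g : sqint f -> sqint g -> wip (op f) g = kform k g f.
Proof.
move=> hf hg; rewrite (kformE mk k_ge0 k_sym k_lexx hg hf).
by apply: eq_Rintegral => x _; rewrite /op; field; rewrite gt_eqF.
Qed.

Lemma op_sym f g : sqint f -> sqint g -> wip (op f) g = wip f (op g).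
Proof.
move=> hf hg; rewrite (wipC f) !wip_op//.
exact: (kform_sym mk k_ge0 k_sym k_lexx).
Qed.

Lemma integrable_diff f : sqint f -> intble2 (fun p => K p * (f p.1 - f p.2) ^+ 2).
Proof.
move=> hf.
have i1 := integrable_K1 mk k_ge0 k_lexx hf.
have i2 := integrable_K2 mk k_ge0 k_sym k_lexx hf.
have i3 := integrable_K12 mk k_ge0 k_sym k_lexx hf hf.
rewrite (_ : (fun _ => _) = (fun p => (K p * f p.1 ^+ 2 +
   (K p * f p.2 ^+ 2 - 2 * (K p * (f p.1 * f p.2))))%:E)).
  apply: integrableDR => //; apply: integrableBR => //; exact: integrableZR.
by apply/funext => p; congr (_%:E); ring.
Qed.

Lemma dirichlet_formE f : sqint f ->
  \int[M2]_p (K p * (f p.1 - f p.2) ^+ 2) = 2 * (wip f f - wip (op f) f).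
Proof.
move=> hf.
have i1 := integrable_K1 mk k_ge0 k_lexx hf.
have i2 := integrable_K2 mk k_ge0 k_sym k_lexx hf.
have i3 := integrable_K12 mk k_ge0 k_sym k_lexx hf hf.
transitivity (\int[M2]_p (K p * f p.1 ^+ 2 +
   (K p * f p.2 ^+ 2 - 2 * (K p * (f p.1 * f p.2))))).
  by apply: eq_Rintegral => p _; ring.
have i4 := integrableZR 2 i3.
rewrite RintegralD//; last exact: integrableBR.
rewrite RintegralB// RintegralZl// wip_op// -/(kform k f f).
rewrite (Rintegral_K1 mk k_ge0 k_lexx hf) (Rintegral_K2 mk k_ge0 k_sym k_lexx hf).
rewrite -wipEj; ring.
Qed.

(** * Marginals of [k] against plain [mu], for Schur's test *)

Section UnweightedMarginals.
Variables (V : R) (u : X -> R).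
Hypothesis kV : forall x, (\int[mu]_y (k x y)%:E = V%:E)%E.
Hypotheses (mu0 : measurable_fun setT u) (u0 : forall x, 0 <= u x).

Lemma integral_k1 : (\int[M2]_p (k p.1 p.2 * u p.1)%:E = \int[mu]_x (V * u x)%:E)%E.
Proof.
rewrite (fubini_tonelli1 (fun p => (k p.1 p.2 * u p.1)%:E))//.
- apply: eq_integral => x _; rewrite /fubini_F /=.
  under eq_integral do rewrite mulrC.
  by rewrite ge0_integralZlR// kV -EFinM mulrC.
- by apply/measurable_EFinP; apply: measurable_funM => //; exact: mfst.
- by move=> p; rewrite lee_fin mulr_ge0.
Qed.

Lemma integral_k2 : (\int[M2]_p (k p.1 p.2 * u p.2)%:E = \int[mu]_x (V * u x)%:E)%E.
Proof.
rewrite (fubini_tonelli2 (fun p => (k p.1 p.2 * u p.2)%:E))//.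
- apply: eq_integral => x _; rewrite /fubini_G /=.
  under eq_integral do rewrite mulrC k_sym.
  by rewrite ge0_integralZlR// kV -EFinM mulrC.
- by apply/measurable_EFinP; apply: measurable_funM => //; exact: msnd.
- by move=> p; rewrite lee_fin mulr_ge0.
Qed.

Hypothesis ui : intble (fun x => V * u x).

Let Vu0 x : 0 <= V * u x.
Proof.
rewrite mulr_ge0// -lee_fin -(kV x).
by apply: integral_ge0 => y _; rewrite lee_fin.
Qed.

Lemma integrable_k1 : intble2 (fun p => k p.1 p.2 * u p.1).
Proof.
apply: ge0_integrable; last by rewrite integral_k1; exact: integrable_lty_ge0.
- by apply: measurable_funM => //; exact: mfst.
- by move=> p; rewrite mulr_ge0.
Qed.

Lemma integrable_k2 : intble2 (fun p => k p.1 p.2 * u p.2).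
Proof.
apply: ge0_integrable; last by rewrite integral_k2; exact: integrable_lty_ge0.
- by apply: measurable_funM => //; exact: msnd.
- by move=> p; rewrite mulr_ge0.
Qed.

End UnweightedMarginals.

(* Two lower bounds are averaged: [J] is positive semidefinite, so that [k - J] costs only
   its row sums; and Schur's test with weight [1 / rho]. *)
Lemma form_lower_bound (J : X -> X -> R) (V delta : R) :
  measurable_fun setT (fun p : X * X => J p.1 p.2) ->
  (forall x y, 0 <= J x y) -> (forall x y, J x y = J y x) ->
  (forall x y, J x y <= k x y) ->
  (forall f, sqint f -> 0 <= kform J f f) -> 0 < V ->
  (forall x, (\int[mu]_y (k x y)%:E = V%:E)%E) ->
  (forall x, V * rho x - jbar J x <= (1 - delta) * m x) ->
  forall f, sqint f -> - (1 - delta / 2) * wip f f <= wip (op f) f.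
Proof.
move=> mJ J0 Jsym Jle Jpsd V0 kV hV f hf; have [mf _] := hf.
have i1 := integrable_K1 mk k_ge0 k_lexx hf.
have i2 := integrable_K2 mk k_ge0 k_sym k_lexx hf.
have i3 := integrable_K12 mk k_ge0 k_sym k_lexx hf hf.
have j1 := integrable_K1 mJ J0 Jle hf.
have j2 := integrable_K2 mJ J0 Jsym Jle hf.
have j3 := integrable_K12 mJ J0 Jsym Jle hf hf.
have ij := sqint_jbar mJ J0 Jle hf.
(* The form of [J] is dropped by positivity; what remains is the integral of (k - J) (f x + f y)^2,
   a nonnegative function. *)
have low1 : \int[mu]_x (f x ^+ 2 * (jbar J x * rho x)) <= wip f f + wip (op f) f.
  apply: (@le_trans _ _ (\int[mu]_x (f x ^+ 2 * (jbar J x * rho x)) + kform J f f)).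
    by rewrite lerDl Jpsd.
  have -> : \int[mu]_x (f x ^+ 2 * (jbar J x * rho x)) + kform J f f =
    2^-1 * (\int[M2]_p (J p.1 p.2 * rho p.1 * rho p.2 * f p.1 ^+ 2) +
            \int[M2]_p (J p.1 p.2 * rho p.1 * rho p.2 * f p.2 ^+ 2)) + kform J f f.
    by rewrite (Rintegral_K1 mJ J0 Jle hf) (Rintegral_K2 mJ J0 Jsym Jle hf); field.
  have -> : wip f f + wip (op f) f =
    2^-1 * (\int[M2]_p (K p * f p.1 ^+ 2) + \int[M2]_p (K p * f p.2 ^+ 2)) + kform k f f.
    rewrite (Rintegral_K1 mk k_ge0 k_lexx hf) (Rintegral_K2 mk k_ge0 k_sym k_lexx hf).
    by rewrite -wipEj wip_op//; field.
  rewrite /kform -!RintegralD// -!RintegralZl//; last 2 first.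
  - exact: integrableDR.
  - exact: integrableDR.
  rewrite -!RintegralD//; last 2 first.
  - by apply: integrableZR; exact: integrableDR.
  - by apply: integrableZR; exact: integrableDR.
  apply: le_Rintegral => //.
  - by apply: integrableDR => //; apply: integrableZR; exact: integrableDR.
  - by apply: integrableDR => //; apply: integrableZR; exact: integrableDR.
  move=> p _; rewrite -subr_ge0.
  have -> : 2^-1 * (K p * f p.1 ^+ 2 + K p * f p.2 ^+ 2) + K p * (f p.1 * f p.2) -
    (2^-1 * (J p.1 p.2 * rho p.1 * rho p.2 * f p.1 ^+ 2 +
       J p.1 p.2 * rho p.1 * rho p.2 * f p.2 ^+ 2) +
       J p.1 p.2 * rho p.1 * rho p.2 * (f p.1 * f p.2)) =
    2^-1 * ((k p.1 p.2 - J p.1 p.2) * rho p.1 * rho p.2 * (f p.1 + f p.2) ^+ 2).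
    by field.
  by rewrite mulr_ge0// mulr_ge0 ?sqr_ge0// mulr_ge0// mulr_ge0// subr_ge0.
pose u x := f x ^+ 2 * rho x ^+ 2.
have mu0 : measurable_fun setT u by apply: measurable_funM; exact: measurable_funX.
have u0 x : 0 <= u x by rewrite mulr_ge0// sqr_ge0.
have uE x : V * u x <= (1 - delta) * (f x ^+ 2 * w x) + f x ^+ 2 * (jbar J x * rho x).
  have -> : V * u x = f x ^+ 2 * rho x * (V * rho x) by rewrite /u; ring.
  have -> : (1 - delta) * (f x ^+ 2 * w x) + f x ^+ 2 * (jbar J x * rho x) =
    f x ^+ 2 * rho x * ((1 - delta) * m x + jbar J x) by ring.
  by apply: ler_wpM2l; [rewrite mulr_ge0 ?sqr_ge0|have := hV x; lra].
have isq := sqint_sqr hf.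
have ui : intble (fun x => V * u x).
  apply: le_integrableR (integrableDR (integrableZR (1 - delta) isq) ij).
    exact: measurable_funM.
  by move=> x; rewrite ger0_norm// mulr_ge0// ltW.
(* Integrates k (f x rho x + f y rho y)^2 >= 0, where the row integrals of [k] are the constant
   [V]. *)
have low2 : - (\int[mu]_x (V * u x)) <= wip (op f) f.
  have -> : - (\int[mu]_x (V * u x)) = \int[M2]_p (- (2^-1 * (k p.1 p.2 * u p.1 + k p.1 p.2 * u p.2))).
    have i4 := integrable_k1 kV mu0 u0 ui; have i5 := integrable_k2 kV mu0 u0 ui.
    transitivity (\int[M2]_p (- 2^-1 * (k p.1 p.2 * u p.1 + k p.1 p.2 * u p.2))).
      rewrite [RHS]RintegralZl//; last exact: integrableDR.
      rewrite RintegralD// {2 3}/Rintegral (integral_k1 kV mu0 u0) (integral_k2 kV mu0 u0).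
      by rewrite -[fine _]/(\int[mu]_x (V * u x)); field.
    by apply: eq_Rintegral => p _; rewrite mulNr.
  rewrite wip_op//; apply: le_Rintegral => //.
    apply: integrableNR; apply: integrableZR; apply: integrableDR.
    - exact: integrable_k1 kV mu0 u0 ui.
    - exact: integrable_k2 kV mu0 u0 ui.
  move=> p _; rewrite -subr_ge0 opprK.
  have -> : K p * (f p.1 * f p.2) + 2^-1 * (k p.1 p.2 * u p.1 + k p.1 p.2 * u p.2) =
     2^-1 * (k p.1 p.2 * (f p.1 * rho p.1 + f p.2 * rho p.2) ^+ 2).
    by rewrite /u; field.
  by rewrite mulr_ge0// mulr_ge0// sqr_ge0.
have up : \int[mu]_x (V * u x) <= (1 - delta) * wip f f + \int[mu]_x (f x ^+ 2 * (jbar J x * rho x)).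
  have -> : wip f f = \int[mu]_x (f x ^+ 2 * w x).
    by apply: eq_Rintegral => x _; rewrite expr2.
  rewrite -RintegralZl// -RintegralD//; last exact: integrableZR.
  apply: le_Rintegral => //.
  by apply: integrableDR => //; exact: integrableZR.
(* Adding [low1] and [low2] cancels the integral of [jbar J] and leaves 2 <T f, f> >= -(2 - delta)
   |f|^2. *)
lra.
Qed.

(** * Positivity of a kernel that is a composition of another with its transpose *)

Section CompositionKernel.
Variables (b J : X -> X -> R) (c : R).
Hypothesis mb : measurable_fun setT (fun p : X * X => b p.1 p.2).
Hypothesis b_ge0 : forall x z, 0 <= b x z.
Hypothesis mJ : measurable_fun setT (fun p : X * X => J p.1 p.2).
Hypothesis J_ge0 : forall x y, 0 <= J x y.
Hypothesis J_sym : forall x y, J x y = J y x.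
Hypothesis J_le : forall x y, J x y <= k x y.
Hypothesis c_gt0 : 0 < c.
Hypothesis bJ : forall x y, (\int[mu]_z (b x z * b y z)%:E = (c * J x y)%:E)%E.

Let P (u : X -> R) z := (\int[mu]_x (b x z * (u x * rho x))%:E)%E.

Let mP u : measurable_fun setT u -> measurable_fun setT (P u).
Proof.
move=> mu0; apply: (measurable_integral_section
  (F := fun p : X * X => (b p.2 p.1 * (u p.2 * rho p.2))%:E)).
apply/measurable_EFinP; apply: measurable_funM; last by apply: measurable_funM; exact: msnd.
exact: (measurableT_comp mb (@measurable_swap _ _ X X)).
Qed.

Let P_ge0 u z : (forall x, 0 <= u x) -> (0 <= P u z)%E.
Proof. by move=> u0; apply: integral_ge0 => x _; rewrite lee_fin mulr_ge0// mulr_ge0. Qed.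

Lemma composition_kformE u v : sqint u -> sqint v ->
  (forall x, 0 <= u x) -> (forall x, 0 <= v x) ->
  ((c * kform J u v)%:E = \int[mu]_z (P u z * P v z))%E.
Proof.
move=> hu hv u0 v0; have [mu0 _] := hu; have [mv0 _] := hv.
have mP1 := mP mu0; have mP2 := mP mv0.
have mb1 x : measurable_fun setT (b x) by exact: (measurableT_comp mb (pair1_measurable x)).
have mb2 z : measurable_fun setT (b ^~ z) by exact: (measurableT_comp mb (pair2_measurable z)).
have i3 := integrable_K12 mJ J_ge0 J_sym J_le hu hv.
rewrite EFinM /kform EFin_Rint// fubini_tonelli1//; last first.
- by move=> p; rewrite lee_fin !mulr_ge0.
- by case/integrableP: i3.
rewrite -ge0_integralZl//; last 3 first.
- apply: measurable_fun_fubini_tonelli_F; first by case/integrableP: i3.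
  by move=> p; rewrite lee_fin !mulr_ge0.
- by move=> x _; apply: integral_ge0 => y _; rewrite lee_fin !mulr_ge0.
- by rewrite lee_fin ltW.
transitivity (\int[mu]_x \int[mu]_z ((b x z * (u x * rho x))%:E * P v z))%E.
  apply: eq_integral => x _; rewrite /fubini_F /=.
  transitivity (\int[mu]_y \int[mu]_z ((b x z * (u x * rho x)) * (b y z * (v y * rho y)))%:E)%E.
    rewrite -ge0_integralZl//; last 3 first.
    - by case/integrableP: i3 => h _; exact: (measurableT_comp h (pair1_measurable x)).
    - by move=> y _; rewrite lee_fin !mulr_ge0.
    - by rewrite lee_fin ltW.
    apply: eq_integral => y _.
    transitivity (\int[mu]_z ((u x * rho x * (v y * rho y)) * (b x z * b y z))%:E)%E.
      rewrite ge0_integralZlR// ?bJ ?mulr_ge0//; first by rewrite -!EFinM; congr (_%:E); ring.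
        exact: measurable_funM.
      by move=> z; rewrite mulr_ge0.
    by apply: eq_integral => z _; congr (_%:E); ring.
  rewrite (fubini_tonelli (fun p : X * X =>
    ((b x p.2 * (u x * rho x)) * (b p.1 p.2 * (v p.1 * rho p.1)))%:E))//=.
  - apply: eq_integral => z _; rewrite /P.
    rewrite -ge0_integralZl//; last first.
    + by rewrite lee_fin !mulr_ge0.
    + by move=> y _; rewrite lee_fin !mulr_ge0.
    + by apply/measurable_EFinP; apply: measurable_funM => //; exact: measurable_funM.
  - apply/measurable_EFinP; apply: measurable_funM; apply: measurable_funM => //.
    + exact: msnd.
    + by apply: measurable_funM; exact: mfst.
  - by move=> p; rewrite lee_fin !mulr_ge0.
rewrite (fubini_tonelli (fun p : X * X => ((b p.1 p.2 * (u p.1 * rho p.1))%:E * P v p.2)%E))//=.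
- apply: eq_integral => z _; rewrite ge0_integralZr//.
  + by apply/measurable_EFinP; apply: measurable_funM => //; exact: measurable_funM.
  + by move=> x _; rewrite lee_fin !mulr_ge0.
  + exact: P_ge0.
- apply: emeasurable_funM.
  + apply/measurable_EFinP; apply: measurable_funM => //.
    by apply: measurable_funM; exact: mfst.
  + exact: (measurableT_comp mP2).
- by move=> p; rewrite mule_ge0// ?lee_fin ?mulr_ge0// P_ge0.
Qed.

(** Formally [c * kform J f f] is the integral of (P f)^2, but Tonelli needs a sign and [P] may be
    infinite. Splitting f = p - q reduces the claim to 2 <P p, P q> <= |P p|^2 + |P q|^2 in the
    extended reals. *)
Lemma kform_composition_ge0 f : sqint f -> 0 <= kform J f f.
Proof.
move=> hf; have [mf _] := hf.
pose p := fun x => Num.max (f x) 0; pose q := fun x => Num.max (- f x) 0.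
have mp : measurable_fun setT p by exact: measurable_maxr.
have mq : measurable_fun setT q by apply: measurable_maxr => //; exact: measurable_funN.
have p0 x : 0 <= p x by rewrite le_max lexx orbT.
have q0 x : 0 <= q x by rewrite le_max lexx orbT.
have fE x : f x = p x - q x.
  rewrite /p /q; case: (leP 0 (f x)) => h.
    by rewrite max_r ?subr0// oppr_le0.
  by rewrite max_l ?opprK ?add0r// oppr_ge0 ltW.
have hs u : measurable_fun setT u -> (forall x, 0 <= u x <= `|f x|) -> sqint u.
  move=> mu0 h; apply: sqintP => //; apply: le_integrableR (sqint_sqr hf).
    by apply: measurable_funM => //; exact: measurable_funX.
  move=> x; have /andP[h1 h2] := h x.
  rewrite ger0_norm ?mulr_ge0 ?sqr_ge0// ler_wpM2r// -[leRHS]real_normK ?num_real//.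
  by rewrite ler_sqr ?nnegrE.
have hp : sqint p.
  by apply: hs => // x; rewrite p0 ge_max normr_ge0 ler_norm.
have hq : sqint q.
  by apply: hs => // x; rewrite q0 ge_max normr_ge0 -normrN ler_norm.
have i1 := integrable_K12 mJ J_ge0 J_sym J_le hp hp.
have i2 := integrable_K12 mJ J_ge0 J_sym J_le hp hq.
have i3 := integrable_K12 mJ J_ge0 J_sym J_le hq hq.
have i4 := integrable_K12 mJ J_ge0 J_sym J_le hq hp.
have -> : kform J f f = kform J p p + kform J q q - (kform J p q + kform J q p).
  rewrite /kform -!RintegralD// -RintegralB//; last 2 first.
  - exact: integrableDR.
  - exact: integrableDR.
  by apply: eq_Rintegral => z _; rewrite !fE; ring.
rewrite (kform_sym mJ J_ge0 J_sym J_le hq hp) subr_ge0.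
rewrite -(ler_pM2l c_gt0) !mulrDr -lee_fin !EFinD.
rewrite (composition_kformE hp hp p0 p0) (composition_kformE hq hq q0 q0) (composition_kformE hp hq p0 q0).
by apply: integral_AMGM; [exact: mP|exact: mP|move=> z; exact: P_ge0|move=> z; exact: P_ge0].
Qed.

End CompositionKernel.

(** * The seminormed space of square-integrable functions *)

Definition sqint_pred : {pred (X -> R)} := fun f => `[< sqint f >].

Lemma sqint_submod_closed : submod_closed sqint_pred.
Proof.
split=> [|a f g /asboolW hf /asboolW hg]; apply: asboolT; last exact: sqint_lin.
split; first exact: measurable_cst.
by rewrite integral0_eq// => x _; rewrite /= expr0n !mul0r.
Qed.

HB.instance Definition _ := GRing.isSubmodClosed.Build R (X -> R) sqint_pred
  sqint_submod_closed.

Record L2space := L2Space { L2fun :> X -> R; _ : L2fun \in sqint_pred }.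
HB.instance Definition _ := [isSub for L2fun].
HB.instance Definition _ := [Choice of L2space by <:].
HB.instance Definition _ := [SubChoice_isSubLmodule of L2space by <:].

Lemma L2fun_sqint (f : L2space) : sqint f.
Proof. by case: f => f /= /asboolP. Qed.

Definition mkL2 f (hf : sqint f) : L2space := @L2Space f (asboolT hf).

Definition ipL2 (f g : L2space) := wip f g.

Lemma ipL2_bil : bilinear_form ipL2.
Proof.
split=> [f g|a f g u]; first exact: wipC.
exact: (wip_lin a (L2fun_sqint f) (L2fun_sqint g) (L2fun_sqint u)).
Qed.

Lemma ipL2_ge0 (f : L2space) : 0 <= ipL2 f f. Proof. exact: wip_ge0. Qed.

Lemma ipL2E (f : L2space) : (\int[mu]_x (f x ^+ 2 * w x)%:E = (nrm ipL2 f ^+ 2)%:E)%E.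
Proof. by rewrite (sqr_nrm ipL2_ge0) wipE//; exact: L2fun_sqint. Qed.

Lemma L2space_complete (u : nat -> L2space) (C r : R) : 0 <= C -> 0 < r -> r < 1 ->
  (forall n, nrm ipL2 (u n.+1 - u n) <= C * r ^+ n) ->
  exists l, forall n, nrm ipL2 (u n - l) <= C / (1 - r) * r ^+ n.
Proof.
move=> C0 r0 r1 step.
have D0 : 0 <= C / (1 - r) by rewrite divr_ge0// subr_ge0 ltW.
have p0 n : 0 <= C / (1 - r) * r ^+ n by rewrite mulr_ge0// exprn_ge0// ltW.
have mu_ n : measurable_fun setT (u n) by case: (L2fun_sqint (u n)).
have st n : (\int[mu]_x ((u n.+1 x - u n x) ^+ 2 * w x)%:E <= ((C * r ^+ n) ^+ 2)%:E)%E.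
  have := ipL2E (u n.+1 - u n); rewrite /= => ->; rewrite lee_fin.
  by rewrite ler_sqr ?nnegrE ?nrm_ge0// mulr_ge0// exprn_ge0// ltW.
have tele n j : nrm ipL2 (u n - u (n + j)%N) <= C * r ^+ n * \sum_(0 <= i < j) r ^+ i.
  elim: j => [|j IH].
    by rewrite addn0 subrr (nrm0 ipL2_bil ipL2_ge0) big_nil mulr0.
  apply: le_trans (ler_nrm_dist ipL2_bil ipL2_ge0 _ (u (n + j)%N) _) _.
  rewrite big_nat_recr//= mulrDr lerD// (nrmB ipL2_bil).
  by rewrite addnS (le_trans (step _))// exprD mulrA.
have cauchy n N : (n <= N)%N ->
    (\int[mu]_x ((u n x - u N x) ^+ 2 * w x)%:E <= ((C / (1 - r) * r ^+ n) ^+ 2)%:E)%E.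
  move=> nN; have := ipL2E (u n - u N); rewrite /= => ->; rewrite lee_fin.
  rewrite ler_sqr ?nnegrE ?nrm_ge0// -(subnKC nN).
  apply: le_trans (tele _ _) _; rewrite mulrAC -mulrA mulrAC -mulrA ler_wpM2l// mulrC.
  by rewrite ler_wpM2l ?exprn_ge0 ?(ltW r0)// sum_geometric_le// ltW.
have w_gt0 x : 0 < w x by rewrite mulr_gt0.
have [l ml Hl] := weighted_complete mw w_gt0 mu_ r0 r1 st cauchy.
have hl : sqint l.
  have hd : sqint (fun x => u 0%N x - l x).
    apply: sqintP; first exact: measurable_funB.
    apply: ge0_integrable.
    - by apply: measurable_funM => //; apply: measurable_funX; exact: measurable_funB.
    - by move=> x; rewrite mulr_ge0 ?sqr_ge0.
    - by apply: le_lt_trans (Hl 0%N) _; rewrite ltry.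
  have := sqint_lin (-1) hd (L2fun_sqint (u 0%N)).
  by rewrite (_ : (fun x => _) = l)//; apply/funext => x; ring.
exists (mkL2 hl) => n.
rewrite -ler_sqr ?nnegrE ?nrm_ge0// -lee_fin -ipL2E.
exact: Hl.
Qed.

Definition opL2 (f : L2space) : L2space := mkL2 (sqint_op (L2fun_sqint f)).

Lemma iter_opL2 n (f : L2space) : iter n opL2 f = iter n op f :> (X -> R).
Proof. by elim: n => //= n ->. Qed.

Lemma L2space_ext (f g : L2space) : f =1 g -> f = g.
Proof. by move=> fg; apply: val_inj; apply/funext. Qed.

(** An intermediate form between [in_spectrum] and the abstract [spectrum]: plain functions, with
    [wip g g = 0] in place of almost everywhere vanishing. *)
Definition kspectrum (l : R) :=
  ~ ((forall f, sqint f ->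
        let g x := op f x - l * f x in wip g g = 0 -> wip f f = 0) /\
     (forall g, sqint g -> exists2 f, sqint f &
        let e x := op f x - l * f x - g x in wip e e = 0)).

Theorem kernel_gap_contraction (delta eps : R) (f0 : X -> R) :
  0 < delta <= 1 -> (forall f, sqint f -> - (1 - delta) * wip f f <= wip (op f) f) ->
  sqint (fun=> 1) ->
  (forall f, sqint f -> wip f (fun=> 1) = 0 ->
     let g x := op f x - f x in wip g g = 0 -> wip f f = 0) ->
  sqint f0 -> wip f0 (fun=> 1) = 0 -> wip f0 f0 <> 0 ->
  wip f0 f0 - wip (op f0) f0 <= eps * wip f0 f0 -> eps < delta ->
  let L := sup [set l | kspectrum l /\ l != 1] in
  1 - L <= eps /\
  forall n f, sqint f -> wip f (fun=> 1) = 0 ->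
    Num.sqrt (wip (iter n op f) (iter n op f)) <=
      expR (- n%:R * (1 - L)) * Num.sqrt (wip f f).
Proof.
move=> d01 lower h1 ker hf0 f01 f0n f0e ed L.
have lin a (f g : L2space) : opL2 (a *: f + g) = a *: opL2 f + opL2 g.
  by apply: L2space_ext => x; exact: (op_lin a x (L2fun_sqint f) (L2fun_sqint g)).
have sym (f g : L2space) : ipL2 (opL2 f) g = ipL2 f (opL2 g).
  exact: (op_sym (L2fun_sqint f) (L2fun_sqint g)).
have contr (f : L2space) : nrm ipL2 (opL2 f) <= nrm ipL2 f.
  by apply: ler_wsqrtr; exact: (wip_op_contr (L2fun_sqint f)).
have fix1 : opL2 (mkL2 h1) = mkL2 h1.
  by apply: L2space_ext => x; exact: op_cst.
have nrm_0 (f : L2space) : nrm ipL2 f = 0 <-> wip f f = 0 := nrm_eq0 ipL2_ge0 f.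
have specE : kspectrum = spectrum ipL2 opL2.
  apply/funext => l; apply/propext; split; apply: contra_not => -[H1 H2]; split.
  - move=> f hf /= g0; apply/(nrm_0 (mkL2 hf))/H1/nrm_0; exact: g0.
  - move=> g hg; have [f hf] := H2 (mkL2 hg).
    by exists f; [exact: L2fun_sqint|exact: (proj1 (nrm_0 _) hf)].
  - by move=> f /nrm_0 h; apply/nrm_0; apply: H1 => //; exact: L2fun_sqint.
  - move=> g; have [f hf h] := H2 g (L2fun_sqint g).
    by exists (mkL2 hf); apply/nrm_0.
have kerT (f : L2space) : ipL2 f (mkL2 h1) = 0 -> nrm ipL2 (opL2 f - f) = 0 -> nrm ipL2 f = 0.
  by move=> f1 /nrm_0 h; apply/nrm_0; exact: (ker f (L2fun_sqint f)).
have low (f : L2space) : - (1 - delta) * ipL2 f f <= ipL2 (opL2 f) f.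
  exact: (lower f (L2fun_sqint f)).
have := @spectral_gap_contraction R L2space ipL2 ipL2_bil ipL2_ge0 L2space_complete opL2
  lin sym contr (mkL2 h1) delta fix1 kerT d01 low (mkL2 hf0) eps.
rewrite /second_spectral_value -specE -/L => /(_ f01).
have n0 : nrm ipL2 (mkL2 hf0) <> 0 by move=> /nrm_0.
move=> /(_ n0).
rewrite (ipBl ipL2_bil) => /(_ f0e ed)[gL H]; split=> // n f hf f1.
have := H n (mkL2 hf) f1; rewrite /nrm /ipL2 iter_opL2.
exact.
Qed.

Lemma wip_null f g : sqint f -> sqint g -> wip f f = 0 -> wip f g = 0.
Proof.
move=> hf hg f0; apply: (@ip_nrm0 R L2space ipL2 ipL2_bil ipL2_ge0 (mkL2 hf) (mkL2 hg)).
exact/(nrm_eq0 ipL2_ge0).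
Qed.

Lemma wip_CauchySchwarz f g : sqint f -> sqint g ->
  `|wip f g| <= Num.sqrt (wip f f) * Num.sqrt (wip g g).
Proof.
move=> hf hg.
exact: (@ip_CauchySchwarz R L2space ipL2 ipL2_bil ipL2_ge0 (mkL2 hf) (mkL2 hg)).
Qed.

(** S = 1 - T satisfies 0 <= S <= 2 - delta, hence S^2 <= (2 - delta) S, and 1 - T^2 = 2 S - S^2 >=
    delta S. *)
Lemma energy_decrement (delta : R) :
  (forall f, sqint f -> - (1 - delta) * wip f f <= wip (op f) f) ->
  forall f, sqint f -> delta * (wip f f - wip (op f) f) <= wip f f - wip (op f) (op f).
Proof.
move=> low f hf.
pose S (u : L2space) := u - opL2 u.
have linT a (u v : L2space) : opL2 (a *: u + v) = a *: opL2 u + opL2 v.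
  by apply: L2space_ext => x; exact: (op_lin a x (L2fun_sqint u) (L2fun_sqint v)).
have lin a (u v : L2space) : S (a *: u + v) = a *: S u + S v.
  by rewrite /S linT scalerBr opprD addrACA.
have symT (u v : L2space) : ipL2 (opL2 u) v = ipL2 u (opL2 v).
  exact: (op_sym (L2fun_sqint u) (L2fun_sqint v)).
have sym (u v : L2space) : ipL2 (S u) v = ipL2 u (S v).
  by rewrite /S (ipBl ipL2_bil) (ipBr ipL2_bil) symT.
have S0 (u : L2space) : 0 <= ipL2 (S u) u.
  rewrite /S (ipBl ipL2_bil) subr_ge0; apply: le_trans (ip_le_nrm ipL2_bil ipL2_ge0 _ _) _.
  rewrite -(sqr_nrm ipL2_ge0 u) expr2 ler_wpM2r ?nrm_ge0//.
  by apply: ler_wsqrtr; exact: (wip_op_contr (L2fun_sqint u)).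
have SK (u : L2space) : ipL2 (S u) u <= (2 - delta) * ipL2 u u.
  rewrite /S (ipBl ipL2_bil); have := low u (L2fun_sqint u).
  by rewrite -/(ipL2 _ _) -/(ipL2 (opL2 u) u); lra.
have := positive_op_sqr_le ipL2_bil ipL2_ge0 lin sym S0 SK (mkL2 hf).
rewrite /S !(ipBl ipL2_bil, ipBr ipL2_bil) symT -(symT (mkL2 hf)) /=.
rewrite /ipL2 /=; lra.
Qed.

End KernelOperator.

(** * The ball walk of a density *)

Section Walk.
Variables (R : realType) (d : nat) (rho : 'rV[R]_d -> R) (M h theta : R).
Local Notation X := (Rd R d).
Local Notation mu := (@leb R d).
Hypothesis mrho : measurable_fun [set: X] rho.
Hypothesis rho_gt0 : forall x, 0 < rho x.
Hypothesis rho_le : forall x, rho x <= M.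
Hypothesis rho_loc : forall r x, (\int[mu]_y (ballI r x y * rho y)%:E < +oo)%E.
Hypothesis h0 : 0 < h.
Hypothesis theta0 : 0 < theta.
(** The only form in which the class of the density enters this section: theta will be e^(-L h) from
    Harnack or e^(-alpha h^2) from convexity, and 1 for Lebesgue measure. Radii below h are included
    because the half-ball kernel uses h / 2. *)
Hypothesis low : forall r x, 0 < r -> r <= h -> theta * vol d r * rho x <= mh rho r x.

Let rho_ge0 x : 0 <= rho x. Proof. exact: ltW. Qed.
Let M0 : 0 < M. Proof. exact: lt_le_trans (rho_gt0 0) (rho_le 0). Qed.

Let mbr r x : measurable_fun [set: X] (fun y => ballI r x y * rho y).
Proof. by apply: measurable_funM => //; exact: measurable_ballI1. Qed.

Lemma mhE r x : (\int[mu]_y (ballI r x y * rho y)%:E = (mh rho r x)%:E)%E.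
Proof.
have f0 y : (0 <= (ballI r x y * rho y)%:E)%E by rewrite lee_fin mulr_ge0 ?ballI_ge0.
have mf : measurable_fun [set: X] (fun y => (ballI r x y * rho y)%:E).
  by apply/measurable_EFinP; exact: mbr.
by rewrite /mh -integral_leb// fineK// ge0_fin_numE//; exact: integral_ge0.
Qed.

Lemma measurable_mh r : measurable_fun [set: X] (mh rho r).
Proof.
rewrite (_ : mh rho r = fun x => \int[mu]_y (ballI r x y * rho y))%R.
  apply: (measurable_Rintegral_section mu (F := fun x y : X => ballI r x y * rho y)) => /=.
  apply: measurable_funM; first exact: measurable_ballI.
  exact: (measurableT_comp mrho).
by apply/funext => x; rewrite /Rintegral mhE.
Qed.

Local Notation k := (@ballI R d h).
Local Notation m := (mh rho h).

Let mk : measurable_fun setT (fun p : X * X => k p.1 p.2).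
Proof. exact: measurable_ballI. Qed.
Let k_ge0 (x y : X) : 0 <= k x y. Proof. exact: ballI_ge0. Qed.
Let k_sym (x y : X) : k x y = k y x. Proof. exact: ballI_sym. Qed.
Let k_le1 (x y : X) : k x y <= 1. Proof. exact: ballI_le1. Qed.
Let mm := measurable_mh h.
Let V0 : 0 < vol d h := vol_gt0 d h0.
Let kE := mhE h.

Lemma mh_gt0 x : 0 < m x.
Proof.
by apply: lt_le_trans (low x h0 (lexx h)); rewrite mulr_gt0// mulr_gt0.
Qed.

Let m_gt0 := mh_gt0.
Let B_ge0 : 0 <= theta^-1. Proof. by rewrite invr_ge0 ltW. Qed.

Let kB x : (\int[mu]_y (k x y * (rho y / m y))%:E <= theta^-1%:E)%E.
Proof.
apply: (@le_trans _ _ (\int[mu]_y (((theta * vol d h)^-1) * k x y)%:E)%E).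
  apply: ge0_le_integralR.
  - apply: measurable_funM; first exact: measurable_ballI1.
    by apply: measurable_funM => //; exact: measurable_inv_gt0.
  - by apply: measurable_funM => //; exact: measurable_ballI1.
  - by move=> y; rewrite mulr_ge0// divr_ge0// ltW.
  - move=> y; rewrite mulrC ler_wpM2r//.
    rewrite ler_pdivrMr// ler_pdivlMl ?mulr_gt0//.
    exact: low.
rewrite ge0_integralZlR//.
- rewrite integral_ballI -EFinM lee_fin invfM -mulrA mulVf ?mulr1// gt_eqF//.
- by rewrite invr_ge0 mulr_ge0// ltW.
- exact: measurable_ballI1.
Qed.

Local Notation sq := (sqint mu rho m).
Local Notation ip := (wip mu rho m).
Local Notation T := (op mu k rho m).

Lemma mh_le x : m x <= M * vol d h.
Proof.
rewrite -lee_fin -kE EFinM -(integral_ballI h x) -ge0_integralZlR//.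
- apply: ge0_le_integralR => //.
  + by apply: measurable_funM => //; exact: measurable_ballI1.
  + by move=> y; rewrite mulr_ge0.
  + by move=> y; rewrite mulrC ler_wpM2r.
- exact: ltW.
- exact: measurable_ballI1.
Qed.

(** * The half-ball kernel and the lower bound of the form *)

Section HalfBallKernel.
Let c := vol d (h / 2).
Local Notation b := (@ballI R d (h / 2)).

(** The normalised volume of the intersection of two balls of radius h / 2. It is at most 1, and
    vanishes once the centres are h apart, whence [halfker <= k]. *)
Definition halfker (x y : X) : R := c^-1 * \int[mu]_z (b x z * b y z).

Let c0 : 0 < c. Proof. by apply: vol_gt0; rewrite divr_gt0. Qed.
Let mb1 x : measurable_fun [set: X] (b x). Proof. exact: measurable_ballI1. Qed.

Let ib x : mu.-integrable setT (fun z : X => (b x z)%:E).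
Proof.
apply: ge0_integrable; first exact: mb1.
- by move=> z; exact: ballI_ge0.
- by rewrite integral_ballI ltry.
Qed.

Let ibb x y : mu.-integrable setT (fun z : X => (b x z * b y z)%:E).
Proof.
apply: le_integrableR (ib x); first exact: measurable_funM.
by move=> z; rewrite ger0_norm ?mulr_ge0 ?ballI_ge0// ler_piMr ?ballI_ge0// ballI_le1.
Qed.

Let cJ (x y : X) : (\int[mu]_z (b x z * b y z)%:E = (c * halfker x y)%:E)%E.
Proof. by rewrite /halfker mulrA divff ?gt_eqF// mul1r EFin_Rint. Qed.

Lemma measurable_halfker : measurable_fun setT (fun p : X * X => halfker p.1 p.2).
Proof.
apply: measurable_funM => //; rewrite /Rintegral.
apply: (measurableT_comp (fine_measurable measurableT)).
have mF : measurable_fun setT (fun q : (X * X) * X => (b q.1.1 q.2 * b q.1.2 q.2)%:E).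
  have m1 : measurable_fun setT (fun q : (X * X) * X => (q.1.1, q.2) : X * X).
    by apply: measurable_fun_pair => //; exact: (measurableT_comp measurable_fst).
  have m2 : measurable_fun setT (fun q : (X * X) * X => (q.1.2, q.2) : X * X).
    by apply: measurable_fun_pair => //; exact: (measurableT_comp measurable_snd).
  apply/measurable_EFinP; apply: measurable_funM.
  - exact: (measurableT_comp (@measurable_ballI R d (h / 2)) m1).
  - exact: (measurableT_comp (@measurable_ballI R d (h / 2)) m2).
apply: (measurable_fun_fubini_tonelli_F (m2 := mu) _ mF) => q.
by rewrite lee_fin mulr_ge0 ?ballI_ge0.
Qed.

Lemma halfker_ge0 x y : 0 <= halfker x y.
Proof.
rewrite mulr_ge0 ?invr_ge0 ?(ltW c0)//.
by apply: Rintegral_ge0 => z _; rewrite mulr_ge0 ?ballI_ge0.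
Qed.

Lemma halfker_sym x y : halfker x y = halfker y x.
Proof. by congr (_ * _); apply: eq_Rintegral => z _; rewrite mulrC. Qed.

Lemma halfker_le x y : halfker x y <= k x y.
Proof.
have [xy|xy] := ltP (enorm (y - x)) h.
  rewrite [leRHS](_ : _ = 1); last by rewrite /ballI xy.
  rewrite /halfker ler_pdivrMl// mulr1 -lee_fin EFin_Rint// -(integral_ballI (h / 2) x).
  apply: ge0_le_integralR => //.
  - exact: measurable_funM.
  - by move=> z; rewrite mulr_ge0 ?ballI_ge0.
  - by move=> z; rewrite ler_piMr ?ballI_ge0// ballI_le1.
rewrite [leLHS](_ : _ = 0) ?ballI_ge0// /halfker /Rintegral integral0_eq ?mulr0// => z _.
rewrite /ballI; case: ltP => h1; last by rewrite mul0r.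
case: ltP => h2; last by rewrite mulr0.
have : enorm (y - x) < h.
  rewrite (le_lt_trans (ler_enorm_dist _ z _))// (enormB y) [ltRHS](splitr h) ltrD//.
by rewrite ltNge xy.
Qed.

(** After exchanging integrals the row sum averages [mh rho (h / 2)] over a half-ball; [low] is used
    once inside the average and once for the average, hence the square. *)
Lemma jbar_halfker_ge x :
  theta ^+ 2 * vol d (h / 2) * rho x <= jbar mu rho halfker x.
Proof.
have h20 : 0 < h / 2 by rewrite divr_gt0.
have h2h : h / 2 <= h by rewrite ler_pdivrMr// ler_pMr// ler1n.
have lowh y := low y h20 h2h.
have jE : ((c * jbar mu rho halfker x)%:E = \int[mu]_z (b x z * mh rho (h / 2) z)%:E)%E.
  rewrite EFinM -(jbarE mk k_ge0 mrho rho_gt0 kE measurable_halfker halfker_ge0 halfker_le).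
  have mjr : measurable_fun setT (fun y : X => halfker x y * rho y).
    apply: measurable_funM => //.
    exact: (measurableT_comp measurable_halfker (pair1_measurable (x : X))).
  rewrite -ge0_integralZlR ?(ltW c0)//; last by move=> y; rewrite mulr_ge0 ?halfker_ge0.
  transitivity (\int[mu]_y \int[mu]_z (rho y * (b x z * b y z))%:E)%E.
    apply: eq_integral => y _; rewrite ge0_integralZlR//.
    - by rewrite cJ -EFinM; congr (_%:E); ring.
    - exact: measurable_funM.
    - by move=> z; rewrite mulr_ge0 ?ballI_ge0.
  rewrite (fubini_tonelli (fun p : X * X => (rho p.1 * (b x p.2 * b p.1 p.2))%:E))//=.
  - apply: eq_integral => z _; rewrite EFinM -mhE -ge0_integralZlR ?ballI_ge0//.
    + by apply: eq_integral => y _; rewrite (ballI_sym _ y); congr (_%:E); ring.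
    + by move=> y; rewrite mulr_ge0 ?ballI_ge0.
  - apply/measurable_EFinP; apply: measurable_funM; first exact: (measurableT_comp mrho).
    apply: measurable_funM; last exact: measurable_ballI.
    exact: (measurableT_comp (mb1 x)).
  - by move=> p; rewrite lee_fin mulr_ge0// mulr_ge0 ?ballI_ge0.
rewrite -(ler_pM2l c0) -lee_fin jE.
apply: (@le_trans _ _ (\int[mu]_z (theta * c * (b x z * rho z))%:E)%E).
  rewrite ge0_integralZlR//; last 2 first.
  - by rewrite mulr_ge0// ltW.
  - by move=> z; rewrite mulr_ge0 ?ballI_ge0.
  rewrite mhE -EFinM lee_fin.
  have -> : c * (theta ^+ 2 * vol d (h / 2) * rho x) =
     theta * c * (theta * vol d (h / 2) * rho x) by ring.
  by rewrite ler_wpM2l// mulr_ge0// ltW.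
apply: ge0_le_integralR => //.
- by apply: measurable_funM => //; exact: measurable_funM.
- by apply: measurable_funM => //; exact: measurable_mh.
- by move=> z; rewrite mulr_ge0 ?mulr_ge0 ?ballI_ge0 ?(ltW theta0) ?(ltW c0).
- by move=> z; rewrite mulrCA ler_wpM2l ?ballI_ge0.
Qed.

(** 2^d is the ratio of the volumes at radii h and h / 2. The row sums left over by [halfker] are at
    most (1 - theta^2 / 2^d) vol rho, which the assumption and [low] compare with (1 - delta) m. *)
Lemma walk_form_lower (delta : R) : theta <= 1 ->
  1 - theta ^+ 2 / 2 ^+ d <= (1 - delta) * theta ->
  forall f, sq f -> - (1 - delta / 2) * ip f f <= ip (T f) f.
Proof.
move=> th1 hd; have hyp x : vol d h * rho x - jbar mu rho halfker x <= (1 - delta) * m x.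
  have cE : c = vol d h / 2 ^+ d.
    by rewrite /c mulrC volM ?invr_gt0// exprVn mulrC.
  have d1 : 0 <= 1 - delta.
    rewrite -(pmulr_lge0 _ theta0) (le_trans _ hd)// subr_ge0.
    rewrite ler_pdivrMr ?exprn_gt0// mul1r.
    by rewrite (@le_trans _ _ 1)// ?exprn_ile1 ?(ltW theta0)// exprn_ege1// ler1n.
  have := jbar_halfker_ge x; rewrite -/c cE => h1.
  apply: (@le_trans _ _ ((1 - theta ^+ 2 / 2 ^+ d) * (vol d h * rho x))).
    by rewrite mulrBl mul1r lerB// (le_trans _ h1)// le_eqVlt; apply/orP; left; apply/eqP; ring.
  apply: (@le_trans _ _ ((1 - delta) * theta * (vol d h * rho x))).
    by rewrite ler_wpM2r// mulr_ge0// ltW.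
  by rewrite -mulrA ler_wpM2l// mulrA; exact: low.
apply: (form_lower_bound mk k_ge0 k_sym mrho rho_gt0 mm m_gt0 kE kB k_le1
  measurable_halfker halfker_ge0 halfker_sym halfker_le _ V0 _ hyp).
- move=> f hf.
  apply: (kform_composition_ge0 mk k_ge0 mrho rho_gt0 mm m_gt0 kE (b := b) _ _
    measurable_halfker halfker_ge0 halfker_sym halfker_le c0 cJ hf).
  + exact: measurable_ballI.
  + by move=> x z; exact: ballI_ge0.
- by move=> x; exact: integral_ballI.
Qed.

End HalfBallKernel.

Hypothesis rho_int : (\int[mu]_x (rho x)%:E < +oo)%E.

Lemma bounded_sqint (f : X -> R) (c : R) : measurable_fun setT f ->
  (forall x, `|f x| <= c) -> sq f.
Proof.
move=> mf fc.
have c0 : 0 <= c by apply: le_trans (fc 0).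
have irho : mu.-integrable setT (fun x => (rho x)%:E) by apply: ge0_integrable.
have mh0 x : 0 <= m x by rewrite ltW.
apply: sqintP => //.
apply: (le_integrableR _ _ (integrableZR (c ^+ 2 * (M * vol d h)) irho)).
  by do ?apply: measurable_funM => //; exact: measurable_funX.
move=> x; rewrite ger0_norm; last by rewrite mulr_ge0 ?sqr_ge0// mulr_ge0.
rewrite mulrA ler_wpM2r//.
apply: ler_pM => //; first exact: sqr_ge0.
  by rewrite -[leLHS]real_normK ?num_real// ler_sqr ?nnegrE.
exact: mh_le.
Qed.

Local Notation one := (fun=> 1 : R).

Lemma sqint_one : sq one.
Proof. by apply: (@bounded_sqint _ 1) => // x; rewrite normr1. Qed.

(** * Null sets and simplicity of the eigenvalue 1 *)

Lemma conull_ball (N : set X) (x : 'rV[R]_d) (r : R) : measurable N -> mu N = 0%E -> 0 < r ->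
  exists2 z, ~ N z & enorm (z - x) < r.
Proof.
move=> mN N0 r0; apply: contrapT => noz.
have : ((vol d r)%:E <= mu N)%E.
  rewrite -(integral_ballI r x) measure_integral_indic//; apply: ge0_le_integralR.
  - exact: measurable_ballI1.
  - exact: measurable_indic.
  - by move=> y; exact: ballI_ge0.
  - move=> y; rewrite /ballI; case: ltP => // yx; rewrite indicE mem_set//.
    by apply: contrapT => Ny; apply: noz; exists y.
by rewrite N0 lee_fin leNgt vol_gt0.
Qed.

Lemma ae_zero_of_integral0 (F : X -> R) : measurable_fun setT F -> (forall x, 0 <= F x) ->
  (\int[mu]_x (F x)%:E = 0)%E -> {ae mu, forall x, F x = 0}.
Proof.
move=> mF F0 IF.
have : (\int[mu]_x `|(F x)%:E| = 0)%E.
  by rewrite -IF; apply: eq_integral => x _; rewrite abse_EFin ger0_norm.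
move=> /(ae_eq_integral_abs mu measurableT); case; first exact/measurable_EFinP.
move=> N [mN N0 sub]; exists N; split=> // x /= nz; apply: sub => /= h2.
by apply: nz; have := h2 Logic.I => -[].
Qed.

Lemma sq_ae_cst_eq0 f c : sq f -> {ae mu, forall x, f x = c} -> ip f one = 0 -> ip f f = 0.
Proof.
move=> hf fc f1; have [mf _] := hf.
have E (g : X -> R) : sq g -> ip f g = c * ip one g.
  move=> hg; have [mg _] := hg; have s1 := sqint_one.
  rewrite /wip -RintegralZl//; last exact: (sqint_mul mrho rho_gt0 mm m_gt0 s1 hg).
  rewrite /Rintegral; congr fine; apply: ae_eq_integral => //.
  - apply/measurable_EFinP; apply: measurable_funM; first exact: measurable_funM.
    exact: measurable_funM.
  - apply/measurable_EFinP; apply: measurable_funM => //; apply: measurable_funM.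
      exact: measurable_funM.
    exact: measurable_funM.
  - by apply: filterS fc => x /= -> _; congr (_%:E); ring.
have := E _ sqint_one; rewrite f1 => /esym/eqP; rewrite mulf_eq0 => /orP[/eqP c0|/eqP Z0].
  by rewrite E// c0 mul0r.
exfalso; have : {ae mu, forall x, m x * rho x = 0}.
  have mw : measurable_fun [set: X] (fun x => m x * rho x) by exact: measurable_funM.
  apply: ae_zero_of_integral0 => //; first by move=> x; rewrite mulr_ge0// ltW.
  have i1 := sqint_mul mrho rho_gt0 mm m_gt0 sqint_one sqint_one.
  rewrite -[RHS]/(0%:E) -Z0 /wip EFin_Rint//; apply: eq_integral => x _.
  by rewrite !mul1r.
case=> N [mN N0 sub].
have [z Nz _] := conull_ball 0 mN N0 ltr01.
apply: Nz; apply: sub => /= /eqP; rewrite gt_eqF// mulr_gt0//.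
Qed.

(** A fixed function has zero Dirichlet form, so f x = f y for almost all pairs at distance less
    than h; chaining such pairs makes f almost everywhere constant, and orthogonality to constants
    makes it null. *)
Lemma walk_kernel_trivial f : sq f -> ip f one = 0 ->
  let g x := T f x - f x in ip g g = 0 -> ip f f = 0.
Proof.
move=> hf f1 g g0; have [mf _] := hf.
have hT : sq (T f) := sqint_op mk k_ge0 k_sym mrho rho_gt0 mm m_gt0 kE kB k_le1 hf.
have hg : sq g.
  have -> : g = (fun x => -1 * f x + T f x) by apply/funext => x; rewrite /g; ring.
  exact: sqint_lin mrho rho_gt0 mm m_gt0 _ _ _ hf hT.
have gf : ip g f = 0 := wip_null mrho rho_gt0 mm m_gt0 hg hf g0.
have Tff : ip (T f) f = ip f f.
  have := wip_lin mrho rho_gt0 mm m_gt0 1 hg hf hf.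
  rewrite gf mulr0 add0r => <-; congr (wip _ _ _ _ _); apply/funext => x.
  by rewrite /g; ring.
pose F (p : X * X) := k p.1 p.2 * rho p.1 * rho p.2 * (f p.1 - f p.2) ^+ 2.
have F0 p : 0 <= F p by rewrite mulr_ge0 ?sqr_ge0// mulr_ge0// mulr_ge0.
have iF := integrable_diff mk k_ge0 k_sym mrho rho_gt0 mm m_gt0 kE hf.
have mF : measurable_fun setT F by case/integrableP: iF => /measurable_EFinP.
have IF : (\int[mu]_x \int[mu]_y (F (x, y))%:E = 0)%E.
  have D := dirichlet_formE mk k_ge0 k_sym mrho rho_gt0 mm m_gt0 kE kB k_le1 hf.
  have mFe : measurable_fun setT (fun p => (F p)%:E) by exact/measurable_EFinP.
  have F0e p : (0 <= (F p)%:E)%E by rewrite lee_fin.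
  rewrite -(fubini_tonelli1 (m1 := mu) (m2 := mu) _ mFe F0e).
  rewrite -EFin_Rint// D Tff subrr mulr0//.
have mFx x : measurable_fun setT (fun y => F (x, y)).
  exact: (measurableT_comp mF (pair1_measurable x)).
have : {ae mu, forall x, (\int[mu]_y (F (x, y))%:E = 0)%E}.
  have mI : measurable_fun setT (fun x => \int[mu]_y (F (x, y))%:E)%E.
    apply: (measurable_integral_section mu (F := fun p => (F p)%:E)).
    exact/measurable_EFinP.
  have : (\int[mu]_x `|\int[mu]_y (F (x, y))%:E| = 0)%E.
    rewrite -IF; apply: eq_integral => x _; rewrite gee0_abs//.
    by apply: integral_ge0 => y _; rewrite lee_fin.
  move=> /(ae_eq_integral_abs mu measurableT); case; first exact: mI.
  move=> N [mN N0 sub]; exists N; split=> // x /= nz; apply: sub => /= h2.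
  by apply: nz; exact: (h2 Logic.I).
case=> N [mN N0 sub].
have good x : ~ N x -> {ae mu, forall y, F (x, y) = 0}.
  move=> Nx; apply: ae_zero_of_integral0 => //.
  by apply: contrapT => nz; apply: Nx; exact: sub.
(* Around the midpoint of two good points there is a z outside both exceptional null sets and within
   h of each, where f takes both values. *)
have base x x' : ~ N x -> ~ N x' -> enorm (x' - x) < h -> f x = f x'.
  move=> /good[N1 [mN1 N10 sub1]] /good[N2 [mN2 N20 sub2]] xx'.
  pose c : 'rV[R]_d := 2^-1 *: (x + x').
  have h20 : 0 < h / 2 by rewrite divr_gt0.
  have [z Nz zc] : exists2 z, ~ (N1 `|` N2) z & enorm (z - c) < h / 2.
    apply: conull_ball => //; first exact: measurableU.
    exact: (etrans (measureU0 mN1 mN2 N20) N10).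
  have cx : enorm (c - x) < h / 2.
    have -> : c - x = 2^-1 *: (x' - x).
      by apply/rowP => i; rewrite !mxE; lra.
    by rewrite enormZ ger0_norm// mulrC ltr_pM2r.
  have cx' : enorm (c - x') < h / 2.
    have -> : c - x' = 2^-1 *: (x - x').
      by apply/rowP => i; rewrite !mxE; lra.
    by rewrite enormZ enormB ger0_norm// mulrC ltr_pM2r.
  have step y (Ny : set X) : (forall z, (~ F (y, z) = 0) -> Ny z) -> ~ Ny z ->
      enorm (c - y) < h / 2 -> f y = f z.
    move=> suby Nyz cy; have : F (y, z) = 0 by apply: contrapT => /suby.
    rewrite /F /= /ballI (_ : enorm (z - y) < h) ?mul1r; last first.
      by rewrite (le_lt_trans (ler_enorm_dist _ c _))// [ltRHS](splitr h) ltrD.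
    move=> /eqP; rewrite mulf_eq0 gt_eqF ?mulr_gt0//= sqrf_eq0 subr_eq0.
    by move=> /eqP.
  rewrite (step x N1)//; last by move=> ?; apply: Nz; left.
  by rewrite (step x' N2)//; last by move=> ?; apply: Nz; right.
have chain n : forall x x', ~ N x -> ~ N x' -> enorm (x' - x) < n.+1%:R * (h / 2) -> f x = f x'.
  elim: n => [|n IH] x x' Nx Nx' xx'.
    apply: base => //; apply: lt_trans xx' _; rewrite mul1r ltr_pdivrMr// ltr_pMr// ltr1n//.
  pose t : R := n.+2%:R^-1.
  have t0 : 0 < t by rewrite invr_gt0 ltr0n.
  have t1 : t < 1 by rewrite invf_lt1 ?ltr0n// ltr1n.
  have tn : t * n.+2%:R = 1 by rewrite mulVf// pnatr_eq0.
  have tn1 : (1 - t) * n.+2%:R = n.+1%:R by rewrite mulrBl tn mul1r -[n.+2]addn1 natrD addrK.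
  pose y : 'rV[R]_d := x + t *: (x' - x).
  set D := enorm (x' - x) in xx'.
  have D0 : 0 <= D by exact: enorm_ge0.
  (* The division point [y] of the segment may fall in the null set; the slack [e], split in
     proportions t and 1 - t, is the room for moving it off. *)
  pose e := n.+2%:R * (h / 2) - D.
  have e0 : 0 < e by rewrite subr_gt0.
  have te0 : 0 < t * e by rewrite mulr_gt0.
  have te1 : 0 < (1 - t) * e by rewrite mulr_gt0// subr_gt0.
  have [z Nz zy] : exists2 z, ~ N z & enorm (z - y) < Num.min (t * e) ((1 - t) * e).
    by apply: conull_ball => //; rewrite lt_min te0.
  move: zy; rewrite lt_min => /andP[zy1 zy2].
  have yx : enorm (y - x) = t * D by rewrite /y addrAC subrr add0r enormZ gtr0_norm.
  have yx' : enorm (x' - y) = (1 - t) * D.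
    rewrite (_ : x' - y = (1 - t) *: (x' - x)) ?enormZ ?ger0_norm ?subr_ge0 ?(ltW t1)//.
    by rewrite /y scalerBl scale1r opprD addrA.
  have te : t * e = h / 2 - t * D by rewrite /e mulrBr [t * (_ * (_ / _))]mulrA tn mul1r.
  have te' : (1 - t) * e = n.+1%:R * (h / 2) - (1 - t) * D.
    by rewrite /e mulrBr [(1 - t) * (_ * (_ / _))]mulrA tn1.
  rewrite (IH x z Nx Nz); last first.
    apply: (@lt_le_trans _ _ (h / 2)); last by rewrite ler_peMl ?ler1n// divr_ge0// ltW.
    by have := ler_enorm_dist z y x; rewrite yx; lra.
  apply: IH => //.
  by have := ler_enorm_dist x' y z; rewrite yx' (enormB y); lra.
have [z0 Nz0 _] := conull_ball 0 mN N0 ltr01.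
apply: (@sq_ae_cst_eq0 f (f z0)) => //.
exists N; split => // x /= fx; apply: contrapT => Nx; apply: fx.
have [n Hn] : exists n : nat, enorm (z0 - x) < n.+1%:R * (h / 2).
  have h20 : 0 < h / 2 by rewrite divr_gt0.
  exists (Num.truncn (enorm (z0 - x) / (h / 2))).
  rewrite -ltr_pdivrMr//; have := truncnS_gt (enorm (z0 - x) / (h / 2)); done.
exact: (chain n).
Qed.

Lemma sqint_iter n f : sq f -> sq (iter n T f).
Proof.
move=> hf; elim: n => //= n IH.
exact: (sqint_op mk k_ge0 k_sym mrho rho_gt0 mm m_gt0 kE kB k_le1 IH).
Qed.

Lemma integral0_ae (F : X -> R) : measurable_fun setT F -> (forall x, 0 <= F x) ->
  (\int[mu]_x (F x)%:E = 0)%E <-> {ae mu, forall x, F x = 0}.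
Proof.
move=> mF F0; split; first exact: ae_zero_of_integral0.
move=> F0ae; rewrite -[RHS](integral0 mu setT); apply: ae_eq_integral => //.
- exact/measurable_EFinP.
- by apply: filterS F0ae => x /= -> _.
Qed.

Let w_gt0 x : 0 < m x * rho x. Proof. by rewrite mulr_gt0. Qed.
Let mw : measurable_fun [set: X] (fun x => m x * rho x). Proof. exact: measurable_funM. Qed.

(** * The definitions of the statement in terms of [leb] and the kernel operator *)

Let ZhE1 : (intd (fun y => (m y * rho y)%:E) = (ip one one)%:E)%E.
Proof.
have i1 := sqint_mul mrho rho_gt0 mm m_gt0 sqint_one sqint_one.
rewrite /wip EFin_Rint// -integral_leb.
- by apply: eq_integral => x _; rewrite !mul1r.
- by move=> x; rewrite lee_fin ltW.
- exact/measurable_EFinP.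
Qed.

Lemma ZhE : Zh rho h = ip one one.
Proof. by rewrite /Zh ZhE1. Qed.

Lemma Zh_gt0 : 0 < Zh rho h.
Proof.
rewrite ZhE lt_neqAle (wip_ge0 mu rho_gt0 m_gt0) andbT eq_sym; apply/eqP => Z0.
have : (\int[mu]_x (m x * rho x)%:E = 0)%E.
  rewrite integral_leb//; last exact/measurable_EFinP.
    by rewrite ZhE1 Z0.
  by move=> x; rewrite lee_fin ltW.
move=> /(ae_zero_of_integral0 mw) -[|N [mN N0 sub]]; first by move=> x; rewrite ltW.
have [z Nz _] := conull_ball 0 mN N0 ltr01.
by apply: Nz; apply: sub => /= /eqP; rewrite gt_eqF.
Qed.

Lemma Zh_le : (\int[mu]_x (rho x)%:E <= 1)%E -> Zh rho h <= M * vol d h.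
Proof.
move=> rho_int1.
have i1 := sqint_mul mrho rho_gt0 mm m_gt0 sqint_one sqint_one.
rewrite ZhE -lee_fin /wip EFin_Rint//.
apply: (@le_trans _ _ (\int[mu]_x (M * vol d h * rho x)%:E)%E).
  apply: ge0_le_integralR => //.
  - by apply: measurable_funM => //; exact: measurable_funM.
  - exact: measurable_funM.
  - by move=> x; rewrite !mul1r ltW.
  - by move=> x; rewrite !mul1r ler_wpM2r// mh_le.
rewrite ge0_integralZlR ?mulr_ge0 ?(ltW M0) ?(ltW V0)//.
by rewrite -[leRHS]mule1 lee_wpmul2l// lee_fin mulr_ge0 ?(ltW M0) ?(ltW V0).
Qed.

Lemma borel_funE (f : X -> R) : borel_fun f <-> measurable_fun [set: X] f.
Proof.
split=> [hf _ Y mY|hf Y mY]; first by rewrite setTI; exact: hf.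
by have := hf measurableT Y mY; rewrite setTI.
Qed.

Lemma L2E (f : X -> R) : L2 rho h f <-> sq f.
Proof.
have E : measurable_fun [set: X] f -> (intd (fun y => (f y ^+ 2 * m y * rho y)%:E) =
    \int[mu]_y (f y ^+ 2 * m y * rho y)%:E)%E.
  move=> mf; rewrite integral_leb//.
  - by move=> x; rewrite lee_fin -mulrA mulr_ge0 ?sqr_ge0// ltW.
  - apply/measurable_EFinP; apply: measurable_funM => //; apply: measurable_funM => //.
    exact: (measurable_funX 2 mf).
split=> -[mf fi].
  by have mf' := mf; move/borel_funE: mf' => mf'; split=> //; rewrite -E.
by split; [exact/borel_funE|rewrite E].
Qed.

Lemma sintE (F : X -> R) : measurable_fun [set: X] F -> sint F = (\int[mu]_x (F x)%:E)%E.
Proof.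
move=> mF; rewrite integralE /sint -!integral_leb.
- by congr (_ - _)%E; apply: eq_integral => x _;
    rewrite ?funeposE ?funenegE -?EFinN -EFin_max.
- by move=> x; rewrite lee_fin le_max lexx orbT.
- apply/measurable_EFinP; apply: measurable_maxr => //; exact: measurableT_comp.
- by move=> x; rewrite lee_fin le_max lexx orbT.
- by apply/measurable_EFinP; apply: measurable_maxr.
Qed.

Lemma ThE f : measurable_fun [set: X] f -> Th rho h f = T f.
Proof.
move=> mf; apply/funext => x; rewrite /Th sintE//.
by apply: measurable_funM => //; apply: measurable_funM => //; exact: measurable_ballI1.
Qed.

Let mset (f : X -> R) : measurable_fun [set: X] f ->
  measurable ([set y | f y != 0] : set X).
Proof.
move=> mf; rewrite (_ : [set y | _] = f @^-1` (~` [set 0])).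
  have := mf measurableT (~` [set 0]); rewrite setTI; apply.
  exact: measurableC.
by apply/seteqP; split=> y /= /eqP.
Qed.

Lemma nuhE (A : set X) : measurable A -> nuh rho h A = (ip \1_A one / Zh rho h)%:E.
Proof.
move=> mA; have hA : sq \1_A.
  apply: (@bounded_sqint _ 1) => // x.
  by rewrite indicE; case: (_ \in _); rewrite ?normr1 ?normr0.
have i1 := sqint_mul mrho rho_gt0 mm m_gt0 hA sqint_one.
rewrite /nuh mulrC EFinM; congr (_ * _)%E; rewrite /wip EFin_Rint// -integral_leb.
- by apply: eq_integral => x _; rewrite mulr1 mulrA.
- by move=> x; rewrite lee_fin -mulrA mulr_ge0// ltW.
- apply/measurable_EFinP; apply: measurable_funM => //.
  by apply: measurable_funM => //; exact: measurable_indic.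
Qed.

(** The weight [m rho] is positive, so both sides amount to f vanishing almost everywhere for
    Lebesgue measure. *)
Lemma ae0E f : sq f -> ae0 rho h f <-> ip f f = 0.
Proof.
move=> hf; have [mf _] := hf; have mA := mset mf.
set A := [set y | f y != 0] in mA.
have P (b : X -> R) : measurable_fun [set: X] b -> (forall x, 0 <= b x) ->
    (forall x, (b x == 0) = (f x == 0)) ->
    (\int[mu]_x (b x * (m x * rho x))%:E = 0)%E <-> {ae mu, forall x, f x = 0}.
  move=> mb b0 bf; rewrite integral0_ae; last 2 first.
  - exact: measurable_funM.
  - by move=> x; rewrite mulr_ge0// ltW.
  split; apply: filterS => x /= /eqP.
    by rewrite mulf_eq0 (gt_eqF (w_gt0 x)) orbF bf => /eqP.
  by rewrite -bf => /eqP ->; rewrite mul0r.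
have iA : sq \1_A.
  apply: (@bounded_sqint _ 1) => // x.
  by rewrite indicE; case: (_ \in _); rewrite ?normr1 ?normr0.
have i1 := sqint_mul mrho rho_gt0 mm m_gt0 iA sqint_one.
have EA : (\int[mu]_x (\1_A x * (m x * rho x))%:E = (ip \1_A one)%:E)%E.
  by rewrite /wip EFin_Rint//; apply: eq_integral => x _; rewrite mulr1.
have mA1 : measurable_fun [set: X] (\1_A : X -> R) by exact: measurable_indic.
have A0 x : 0 <= (\1_A x : R) by rewrite indicE.
have mf2 : measurable_fun [set: X] (fun x => f x ^+ 2) by exact: (measurable_funX 2 mf).
have PA : ip \1_A one = 0 <-> {ae mu, forall x, f x = 0}.
  rewrite -(P _ mA1 A0) ?EA => [|x].
    by split=> [->//|[]].
  rewrite indicE; case: (boolP (x \in A)) => [|/negP xA].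
    by rewrite inE /A /= => /negPf ->; rewrite oner_eq0.
  by rewrite eqxx; apply/esym/negPn/negP => fx; apply: xA; rewrite inE.
have PF : ip f f = 0 <-> {ae mu, forall x, f x = 0}.
  rewrite -(P _ mf2 (fun x => sqr_ge0 (f x))) ?(wipE mrho rho_gt0 mm m_gt0 hf) => [|x].
    by split=> [->//|[]].
  by rewrite sqrf_eq0.
rewrite PF -PA /ae0 -/A nuhE//; split=> [[/eqP]|->]; last by rewrite mul0r.
by rewrite mulf_eq0 invr_eq0 (gt_eqF Zh_gt0) orbF => /eqP.
Qed.

Lemma in_spectrumE l : in_spectrum rho h l <-> kspectrum mu k rho m l.
Proof.
have hlin f g : sq f -> sq g -> sq (fun x => T f x - l * f x - g x).
  move=> hf hg.
  have hT : sq (T f) := sqint_op mk k_ge0 k_sym mrho rho_gt0 mm m_gt0 kE kB k_le1 hf.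
  have h1 := sqint_lin mrho rho_gt0 mm m_gt0 (- l) hf hT.
  have := sqint_lin mrho rho_gt0 mm m_gt0 (- 1) hg h1.
  by congr sqint; apply/funext => x; ring.
have h0' : sq (fun=> 0) by apply: (@bounded_sqint _ 0) => // x; rewrite normr0.
have hlin0 f : sq f -> sq (fun x => T f x - l * f x).
  move=> hf; have := hlin f _ hf h0'.
  by congr sqint; apply/funext => x; rewrite subr0.
split; apply: contra_not => -[H1 H2]; split.
- move=> f /L2E hf; have [mf _] := hf; rewrite ThE// => E.
  by apply/(ae0E hf)/H1 => //; exact: (proj1 (ae0E (hlin0 _ hf)) E).
- move=> g /L2E hg; have [f hf E] := H2 g hg; have [mf _] := hf.
  exists f; split; first exact/L2E.
  by rewrite ThE//; apply: (proj2 (ae0E (hlin _ _ hf hg)) E).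
- move=> f hf; have [mf _] := hf => /= E; apply/(ae0E hf)/H1; first exact/L2E.
  by rewrite ThE//; exact: (proj2 (ae0E (hlin0 _ hf)) E).
- move=> g hg; have [f [/L2E hf E]] := H2 g (proj2 (L2E g) hg).
  have [mf _] := hf; exists f => //=.
  by move: E; rewrite ThE// => E; exact: (proj1 (ae0E (hlin _ _ hf hg)) E).
Qed.

Lemma lambda1E : lambda1 rho h = sup [set l | kspectrum mu k rho m l /\ l != 1].
Proof.
rewrite /lambda1; congr sup; apply/seteqP.
by split=> l /= -[/in_spectrumE].
Qed.

Lemma op_ge0 f x : (forall y, 0 <= f y) -> 0 <= T f x.
Proof.
move=> f0; rewrite mulr_ge0 ?invr_ge0 ?(ltW (m_gt0 x))//.
by apply: Rintegral_ge0 => y _; rewrite mulr_ge0// mulr_ge0.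
Qed.

Lemma iter_op_ge0 n f x : (forall y, 0 <= f y) -> 0 <= iter n T f x.
Proof. by move=> f0; elim: n x => //= n IH x; exact: op_ge0. Qed.

Lemma sqint_indic (A : set X) : measurable A -> sq \1_A.
Proof.
move=> mA; apply: (@bounded_sqint _ 1) => // x.
by rewrite indicE; case: (_ \in _); rewrite ?normr1 ?normr0.
Qed.

Lemma TnE n x (A : set X) : measurable A -> Tn rho h n x A = (iter n T \1_A x)%:E.
Proof.
move=> mA; have A0 y : 0 <= (\1_A y : R) by rewrite indicE.
elim: n x => //= n IH x; rewrite EFinM; congr (_ * _)%E.
have hn := sqint_iter n (sqint_indic mA); have [mn _] := hn.
rewrite EFin_Rint; last first.
  exact: (sqint_section mk k_ge0 mrho rho_gt0 mm m_gt0 kB k_le1 x hn).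
rewrite -integral_leb.
- by apply: eq_integral => y _; rewrite IH -EFinM mulrAC.
- by move=> y; rewrite IH -EFinM lee_fin mulr_ge0 ?iter_op_ge0// mulr_ge0.
- under eq_fun do rewrite IH -EFinM.
  by apply/measurable_EFinP; apply: measurable_funM.
Qed.

Lemma op_linW a f g : sq f -> sq g ->
  T (fun y => a * f y + g y) = (fun x => a * T f x + T g x).
Proof.
move=> hf hg; apply/funext => x.
exact: (op_lin mk k_ge0 mrho rho_gt0 mm m_gt0 kB k_le1 a x hf hg).
Qed.

(** A measurable set A is tested through u = 1_A - nu(A), which has mean zero and modulus at most 1;
    constants are fixed, so T^n u is the difference of the two measures of A. *)
Lemma TVdist_le n x c :
  (forall u : X -> R, measurable_fun setT u -> (forall y, `|u y| <= 1) ->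
     ip u one = 0 -> `|iter n T u x| <= c) ->
  (TVdist rho h n x <= c%:E)%E.
Proof.
move=> H; apply: ge_ereal_sup => _ [A mA <-].
have mA' : measurable (A : set X) by [].
have hA := sqint_indic mA'; rewrite nuhE// TnE// -EFinB abse_EFin lee_fin.
set b := ip \1_A one / Zh rho h.
have A01 y : 0 <= (\1_A y : R) <= 1.
  by rewrite indicE; case: (_ \in _); rewrite ?lexx ?ler01.
have m1 : measurable_fun [set: X] (\1_A : X -> R) by exact: measurable_indic.
have ipA : ip \1_A one = b * Zh rho h by rewrite /b divfK// gt_eqF// Zh_gt0.
have Z0 := Zh_gt0.
have wA : mu.-integrable setT (fun y => (\1_A y * one y * (m y * rho y))%:E).
  exact: (sqint_mul mrho rho_gt0 mm m_gt0 hA sqint_one).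
have w1 : mu.-integrable setT (fun y => (one y * one y * (m y * rho y))%:E).
  exact: (sqint_mul mrho rho_gt0 mm m_gt0 sqint_one sqint_one).
have b01 : 0 <= b <= 1.
  rewrite divr_ge0 ?(ltW Z0) ?ler_pdivrMr//= ?mul1r; last first.
    apply: Rintegral_ge0 => y _; have /andP[A0 _] := A01 y.
    by rewrite mulr1 mulr_ge0// ltW.
  rewrite ZhE; apply: le_Rintegral => // y _; have /andP[_ A1] := A01 y.
  by rewrite ler_wpM2r ?(ltW (w_gt0 y))// ler_wpM2r.
pose u y := - b * 1 + (\1_A y : R).
have iter1 j : iter j T one = one.
  elim: j => //= j ->; apply/funext => y.
  exact: (op_cst mk k_ge0 mrho rho_gt0 m_gt0 kE 1).
have T1 : T one = one by exact: (iter1 1%N).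
have iteru j : iter j T u = (fun y => - b * 1 + iter j T \1_A y).
  elim: j => //= j ->.
  by rewrite (op_linW _ sqint_one (sqint_iter j hA)) T1.
have := H u; rewrite iteru mulr1 addrC; apply.
- exact: measurable_funD.
- move=> y; rewrite /u mulr1 ler_norml; have /andP[? ?] := A01 y.
  by case/andP: b01 => ? ?; apply/andP; split; lra.
- by rewrite (wip_lin mrho rho_gt0 mm m_gt0 _ sqint_one hA sqint_one) -ZhE ipA mulNr addNr.
Qed.

Lemma op_sup_le (f : X -> R) c x : measurable_fun [set: X] f -> (forall y, `|f y| <= c) -> `|T f x| <= c.
Proof.
move=> mf fc; have hf := bounded_sqint mf fc.
have hc : sq (fun=> c) by apply: (@bounded_sqint _ `|c|).
have Tc := op_cst mk k_ge0 mrho rho_gt0 m_gt0 kE c x.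
have h1 := sqint_lin mrho rho_gt0 mm m_gt0 1 hf hc.
have h2 := sqint_lin mrho rho_gt0 mm m_gt0 (-1) hf hc.
have fc' y : - c <= f y <= c by rewrite -ler_norml.
have H1 : 0 <= T (fun y => 1 * f y + c) x.
  by apply: op_ge0 => y; case/andP: (fc' y) => ? ?; lra.
have H2 : 0 <= T (fun y => -1 * f y + c) x.
  by apply: op_ge0 => y; case/andP: (fc' y) => ? ?; lra.
move: H1 H2; rewrite !op_linW// Tc ler_norml => H1 H2.
by apply/andP; split; lra.
Qed.

Lemma iter_op_sup_le n (f : X -> R) c x : measurable_fun [set: X] f -> (forall y, `|f y| <= c) ->
  `|iter n T f x| <= c.
Proof.
move=> mf fc; elim: n x => //= n IH x; apply: op_sup_le => //.
by have [] := sqint_iter n (bounded_sqint mf fc).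
Qed.

Definition clamp01 (t : R) := Num.min (Num.max t 0) 1.

Lemma clamp01_bounds t : 0 <= clamp01 t <= 1.
Proof. by rewrite /clamp01 le_min le_max ge_min !lexx !orbT ler01. Qed.

Lemma clamp01_le0 t : t <= 0 -> clamp01 t = 0.
Proof. by move=> t0; rewrite /clamp01 max_r// min_l// ler01. Qed.

Lemma clamp01_ge1 t : 1 <= t -> clamp01 t = 1.
Proof. by move=> t1; rewrite /clamp01 max_l ?min_r// (le_trans ler01). Qed.

Lemma clamp01_lipschitz s t : `|clamp01 s - clamp01 t| <= `|s - t|.
Proof.
suff H u v : clamp01 v <= clamp01 u + `|u - v|.
  by have := H s t; have := H t s; rewrite (distrC t s) ler_norml => *; apply/andP; split; lra.
have n0 : 0 <= `|u - v| by [].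
rewrite -lerBlDr {2}/clamp01 le_min; apply/andP; split; rewrite lerBlDr.
  apply: (@le_trans _ _ (Num.max v 0)); first by rewrite /clamp01 ge_min lexx.
  rewrite ge_max addr_ge0 ?le_max ?lexx ?orbT// andbT.
  apply: (@le_trans _ _ (u + `|u - v|)); last by rewrite lerD2r le_max lexx.
  by rewrite -lerBlDl distrC ler_norm.
by have /andP[_ v1] := clamp01_bounds v; lra.
Qed.

(** * The truncated coordinate as test function *)

Section TestFunction.
Variables (i : 'I_d) (s : R).
Let E0 : set X := [set x | (x : 'rV[R]_d) ord0 i <= 0].
Let E1 : set X := [set x | 1 <= (x : 'rV[R]_d) ord0 i].
Hypothesis s_gt0 : 0 < s.
Hypothesis sE0 : (s%:E <= \int[mu]_x (\1_E0 x * rho x ^+ 2)%:E)%E.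
Hypothesis sE1 : (s%:E <= \int[mu]_x (\1_E1 x * rho x ^+ 2)%:E)%E.
Hypothesis rho_int1 : (\int[mu]_x (rho x)%:E <= 1)%E.

Let c (x : X) := clamp01 ((x : 'rV[R]_d) ord0 i).

(** The truncation is 1-Lipschitz and only pairs closer than h count, so the energy is at most h^2
    Zh / 2 <= h^2 M vol / 2. The squared norm is at least theta vol s / 2, and the volumes
    cancel. *)
Lemma test_function : exists f0, [/\ sq f0, ip f0 one = 0, ip f0 f0 <> 0 &
  ip f0 f0 - ip (T f0) f0 <= h ^+ 2 * M / (theta * s) * ip f0 f0].
Proof.
have mci : measurable_fun [set: X] (fun x : X => (x : 'rV[R]_d) ord0 i).
  exact: measurable_coord.
have mc : measurable_fun [set: X] c.
  by apply: measurable_minr => //; exact: measurable_maxr.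
have mE0 : measurable E0 := measurable_coord_le i 0.
have mE1 : measurable E1 := measurable_coord_ge i 1.
have hc : sq c.
  apply: (@bounded_sqint _ 1) => // x.
  by have /andP[? ?] := clamp01_bounds ((x : 'rV[R]_d) ord0 i); rewrite ger0_norm.
have Z0 := Zh_gt0.
pose a := ip c one / Zh rho h.
pose f0 x := - a * 1 + c x.
have hf0 : sq f0 by exact: (sqint_lin mrho rho_gt0 mm m_gt0 (- a) sqint_one hc).
have f01 : ip f0 one = 0.
  rewrite (wip_lin mrho rho_gt0 mm m_gt0 _ sqint_one hc sqint_one) -ZhE.
  by rewrite /a mulNr divfK ?gt_eqF// addNr.
have ZV := Zh_le rho_int1.
have D : 2 * (ip f0 f0 - ip (T f0) f0) <= h ^+ 2 * Zh rho h.
  have <- := dirichlet_formE mk k_ge0 k_sym mrho rho_gt0 mm m_gt0 kE kB k_le1 hf0.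
  have kl (x y : X) : k x y <= k x y := lexx _.
  have i1 := integrable_K1 mk k_ge0 mrho rho_gt0 mm m_gt0 kE mk k_ge0 kl sqint_one.
  have iD := integrable_diff mk k_ge0 k_sym mrho rho_gt0 mm m_gt0 kE hf0.
  have wE := @wipEj _ X R mu k rho m kE one.
  rewrite ZhE wE -(Rintegral_K1 mk k_ge0 mrho rho_gt0 kE mk k_ge0 kl sqint_one).
  rewrite -RintegralZl//; apply: le_Rintegral => //; first exact: (integrableZR (h ^+ 2) i1).
  move=> [x y] _ /=; rewrite expr1n mulr1 /ballI; case: ltP => [xy|_]; last first.
    by rewrite !mul0r mulr0.
  rewrite mul1r mulrC ler_wpM2r ?mulr_ge0//.
  have -> : f0 x - f0 y = c x - c y by rewrite /f0; ring.
  rewrite -real_normK ?num_real// lerXn2r ?nnegrE ?(ltW h0)//.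
  apply: le_trans (clamp01_lipschitz _ _) _; apply: le_trans (ltW xy).
  have := ler_coord_enorm ((x : 'rV[R]_d) - y) i.
  by rewrite !mxE enormB.
(* Whatever the mean [a], the centred function is -a on [E0] and 1 - a on [E1], and a^2 + (1 - a)^2
   >= 1/2. *)
have var : theta * vol d h * s / 2 <= ip f0 f0.
  rewrite -lee_fin -(wipE mrho rho_gt0 mm m_gt0 hf0).
  have m0 : measurable_fun [set: X] (fun x => \1_E0 x * rho x ^+ 2).
    by apply: measurable_funM; [exact: measurable_indic|exact: (measurable_funX 2 mrho)].
  have m1 : measurable_fun [set: X] (fun x => \1_E1 x * rho x ^+ 2).
    by apply: measurable_funM; [exact: measurable_indic|exact: (measurable_funX 2 mrho)].
  have p0 x : 0 <= \1_E0 x * rho x ^+ 2 by rewrite indicE mulr_ge0 ?sqr_ge0.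
  have p1 x : 0 <= \1_E1 x * rho x ^+ 2 by rewrite indicE mulr_ge0 ?sqr_ge0.
  pose V := vol d h; have tV : 0 <= theta * V by rewrite mulr_ge0 ?(ltW theta0) ?(ltW V0).
  have q0 : 0 <= theta * V * a ^+ 2 by rewrite mulr_ge0 ?sqr_ge0.
  have q1 : 0 <= theta * V * (1 - a) ^+ 2 by rewrite mulr_ge0 ?sqr_ge0.
  apply: (@le_trans _ _ (\int[mu]_x (theta * V * a ^+ 2 * (\1_E0 x * rho x ^+ 2) +
      theta * V * (1 - a) ^+ 2 * (\1_E1 x * rho x ^+ 2))%:E)%E).
    under eq_integral do rewrite EFinD.
    rewrite ge0_integralD//=; last 4 first.
    - by move=> x _; rewrite lee_fin mulr_ge0.
    - by apply/measurable_EFinP; exact: measurable_funM.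
    - by move=> x _; rewrite lee_fin mulr_ge0.
    - by apply/measurable_EFinP; exact: measurable_funM.
    rewrite !ge0_integralZlR//.
    apply: (@le_trans _ _ ((theta * V * a ^+ 2)%:E * s%:E +
        (theta * V * (1 - a) ^+ 2)%:E * s%:E)%E); last by apply: leeD; exact: lee_wpmul2l.
    rewrite -!EFinM -EFinD lee_fin.
    have -> : theta * V * a ^+ 2 * s + theta * V * (1 - a) ^+ 2 * s =
      theta * V * s / 2 + theta * V * (s / 2 * (2 * a - 1) ^+ 2) by field.
    by rewrite lerDl mulr_ge0// mulr_ge0 ?sqr_ge0// divr_ge0 ?(ltW s_gt0).
  apply: ge0_le_integralR.
  - by apply: measurable_funD; exact: measurable_funM.
  - by have [mf _] := hf0; apply: measurable_funM => //; exact: (measurable_funX 2 mf).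
  - by move=> x; rewrite addr_ge0// mulr_ge0.
  have lowx x : theta * V * rho x ^+ 2 <= m x * rho x.
    by rewrite expr2 mulrA ler_wpM2r//; exact: low.
  move=> x; rewrite !indicE; case: (boolP (x \in E0)) => x0.
    have cx : c x = 0 by apply: clamp01_le0; move: x0; rewrite inE.
    have -> : (x \in E1) = false.
      by apply/negP; move: x0; rewrite !inE /E0 /E1 /=; lra.
    rewrite mul0r mulr0 addr0 mul1r /f0 cx addr0 mulr1 sqrrN.
    by rewrite mulrAC mulrC ler_wpM2l ?sqr_ge0.
  case: (boolP (x \in E1)) => x1; last first.
    by rewrite !mul0r !mulr0 addr0 mulr_ge0 ?sqr_ge0 ?(ltW (w_gt0 x)).
  have cx : c x = 1 by apply: clamp01_ge1; move: x1; rewrite inE.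
  rewrite mul0r mulr0 add0r mul1r /f0 cx mulr1 addrC.
  by rewrite mulrAC mulrC ler_wpM2l ?sqr_ge0.
have var0 : 0 < ip f0 f0.
  by apply: lt_le_trans var; rewrite divr_gt0// mulr_gt0// mulr_gt0.
exists f0; split=> //; first by apply/eqP; rewrite gt_eqF.
rewrite -(ler_pM2l (ltr0Sn R 1)); apply: le_trans D _.
apply: (@le_trans _ _ (h ^+ 2 * (M * vol d h))).
  by rewrite ler_wpM2l ?sqr_ge0.
have -> : h ^+ 2 * (M * vol d h) =
    2 * (h ^+ 2 * M / (theta * s) * (theta * vol d h * s / 2)).
  by field; rewrite !gt_eqF.
rewrite ler_wpM2l// ler_wpM2l// mulr_ge0 ?invr_ge0// mulr_ge0 ?sqr_ge0 ?(ltW M0)//.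
  exact: ltW.
exact: ltW.
Qed.

End TestFunction.

(** Collects the constants: theta >= 1 - 2^-d / 4 yields the form bound with delta = 2^-d / 8,
    independent of h, and theta >= 1/2 accounts for the factor 2 in the bound on the gap. *)
Lemma walk_gap (i : 'I_d) (s : R) :
  let E0 : set X := [set x | (x : 'rV[R]_d) ord0 i <= 0] in
  let E1 : set X := [set x | 1 <= (x : 'rV[R]_d) ord0 i] in
  0 < s -> (s%:E <= \int[mu]_x (\1_E0 x * rho x ^+ 2)%:E)%E ->
  (s%:E <= \int[mu]_x (\1_E1 x * rho x ^+ 2)%:E)%E ->
  (\int[mu]_x (rho x)%:E <= 1)%E ->
  1 - (2 ^+ d)^-1 / 4 <= theta <= 1 -> 2 * M / s * h ^+ 2 < (2 ^+ d)^-1 / 8 ->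
  spectral_gap rho h <= 2 * M / s * h ^+ 2 /\
  forall n f, sq f -> ip f one = 0 ->
    Num.sqrt (ip (iter n T f) (iter n T f)) <=
      expR (- n%:R * spectral_gap rho h) * Num.sqrt (ip f f).
Proof.
move=> E0 E1 s0 sE0 sE1 I1 /andP[th th1] small.
set t : R := (2 ^+ d)^-1 in th small.
have t0 : 0 < t by rewrite invr_gt0 exprn_gt0.
have t1 : t <= 1 by rewrite invf_le1 ?exprn_gt0// exprn_ege1// ler1n.
(* With t = 2^-d, both sides are compared with 1 - t / 2, using t^2 <= t on the left. *)
have low' : 1 - theta ^+ 2 / 2 ^+ d <= (1 - t / 4) * theta.
  rewrite -/t; have a0 : 0 <= 1 - t / 4 by lra.
  have q1 : (1 - t / 4) * (1 - t / 4) <= (1 - t / 4) * theta by rewrite ler_wpM2l.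
  have q2 : (1 - t / 4) ^+ 2 <= theta ^+ 2 by rewrite lerXn2r ?nnegrE ?(ltW theta0).
  have q3 : t * (1 - t / 4) ^+ 2 <= t * theta ^+ 2 by rewrite ler_wpM2l ?(ltW t0).
  have q4 : t * t <= t by rewrite ler_piMr ?(ltW t0).
  have q5 : 0 <= t * t * t by rewrite !mulr_ge0 ?(ltW t0).
  lra.
have form := walk_form_lower th1 low'.
have [f0 [hf0 f01 f00 f0e]] := test_function s0 sE0 sE1 I1.
have eps_le : h ^+ 2 * M / (theta * s) <= 2 * M / s * h ^+ 2.
  have -> : 2 * M / s * h ^+ 2 = (h ^+ 2 * M / s) * 2 by ring.
  have -> : h ^+ 2 * M / (theta * s) = (h ^+ 2 * M / s) * theta^-1.
    by field; rewrite !gt_eqF.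
  have A0 : 0 <= h ^+ 2 * M / s.
    by apply: divr_ge0; [rewrite mulr_ge0 ?sqr_ge0 ?(ltW M0)|exact: ltW].
  have ti : theta^-1 <= 2 by rewrite -div1r ler_pdivrMr//; lra.
  exact: ler_wpM2l.
have f0e' : ip f0 f0 - ip (T f0) f0 <= 2 * M / s * h ^+ 2 * ip f0 f0.
  by apply: le_trans f0e _; rewrite ler_wpM2r// (wip_ge0 mu rho_gt0 m_gt0).
have small' : 2 * M / s * h ^+ 2 < t / 4 / 2 by lra.
have d01 : 0 < t / 4 / 2 <= 1 by apply/andP; split; lra.
rewrite /spectral_gap lambda1E.
exact: (kernel_gap_contraction mk k_ge0 k_sym mrho rho_gt0 mm m_gt0 kE kB k_le1 d01
  form sqint_one walk_kernel_trivial hf0 f01 f00 f0e' small').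
Qed.

(** For n >= n0, n - n0 steps contract in L^2 and n0 steps pass to the value at x; since |u| <= 1
    its norm is at most the root of Zh. Giving up n0 steps costs e^(n0 g) <= e^(n0 eps). For n < n0
    the maximum principle is enough. *)
Lemma TVdist_contraction (eps c K : R) n0 n x : 0 <= eps -> spectral_gap rho h <= eps ->
  (forall n f, sq f -> ip f one = 0 ->
    Num.sqrt (ip (iter n T f) (iter n T f)) <=
      expR (- n%:R * spectral_gap rho h) * Num.sqrt (ip f f)) ->
  0 <= K -> (forall f, sq f -> `|iter n0 T f x| <= K * Num.sqrt (ip f f)) ->
  1 <= c -> K * Num.sqrt (Zh rho h) <= c ->
  (TVdist rho h n x <=
     (c * expR (n0%:R * eps) * expR (- n%:R * spectral_gap rho h))%:E)%E.
Proof.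
set g := spectral_gap rho h => e0 ge contr K0 HK c1 Kc.
have c0 : 0 <= c by exact: le_trans c1.
apply: TVdist_le => u mu1 u1 u01.
have hu := bounded_sqint mu1 u1.
have [n0n|nn0] := leqP n0 n.
  rewrite -(subnKC n0n) iterD.
  apply: le_trans (HK _ (sqint_iter _ hu)) _.
  apply: (@le_trans _ _ (K * (expR (- (n - n0)%:R * g) * Num.sqrt (Zh rho h)))).
    rewrite ler_wpM2l//; apply: le_trans (contr _ _ hu u01) _.
    rewrite ler_wpM2l ?expR_ge0// ler_wsqrtr// ZhE.
    apply: le_Rintegral => //.
    - exact: (sqint_mul mrho rho_gt0 mm m_gt0 hu hu).
    - exact: (sqint_mul mrho rho_gt0 mm m_gt0 sqint_one sqint_one).
    move=> y _; rewrite ler_wpM2r ?(ltW (w_gt0 y))// mul1r.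
    by rewrite -expr2 -real_normK ?num_real// expr_le1.
  rewrite mulrCA mulrC -mulrA ler_pM ?mulr_ge0 ?expR_ge0 ?sqrtr_ge0//.
  rewrite -expRD ler_expR subnKC// natrB//.
  have : n0%:R * g <= n0%:R * eps by rewrite ler_wpM2l.
  by rewrite mulNr; lra.
apply: le_trans (iter_op_sup_le n x mu1 u1) _.
rewrite -mulrA -expRD (le_trans c1)// ler_peMr// -[leLHS]expR0 ler_expR.
(* For g >= 0, n < n0 and g <= eps give n g <= n0 eps; a negative g only enlarges the right-hand
   side. *)
have [g0|g0] := leP 0 g.
  have : n%:R * g <= n0%:R * eps by rewrite ler_pM// ler_nat ltnW.
  by rewrite mulNr; lra.
have : 0 <= n0%:R * eps by rewrite mulr_ge0.
have : 0 <= n%:R * - g by rewrite mulr_ge0// oppr_ge0 ltW.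
by rewrite mulNr mulrN; lra.
Qed.

Lemma walk_op_bound f x : sq f ->
  `|T f x| <= (theta * vol d h * rho x)^-1 * Num.sqrt theta^-1 * Num.sqrt (ip f f).
Proof.
move=> hf.
apply: le_trans (op_bound mk k_ge0 mrho rho_gt0 mm m_gt0 B_ge0 kB k_le1 x hf) _.
rewrite [Num.sqrt (ip f f) * _]mulrC -mulrA ler_wpM2r ?mulr_ge0 ?sqrtr_ge0//.
by rewrite lef_pV2 ?posrE ?low// mulr_gt0// mulr_gt0.
Qed.

Lemma walk_local f x : sq f -> mu.-integrable setT (fun y : X => (k x y * `|f y| * rho y)%:E).
Proof. exact: (sqint_local mk k_ge0 mrho rho_gt0 mm m_gt0 kB k_le1 x). Qed.

Lemma walk_op_dominated f x : sq f ->
  `|T f x| <= theta^-1 * (rho x)^-1 * ((vol d h)^-1 * \int[mu]_y (k x y * `|f y| * rho y)).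
Proof.
move=> hf; have i1 := sqint_section mk k_ge0 mrho rho_gt0 mm m_gt0 kB k_le1 x hf.
rewrite normrM ger0_norm ?invr_ge0 ?(ltW (m_gt0 x))//.
have I0 : 0 <= \int[mu]_y (k x y * `|f y| * rho y).
  by apply: Rintegral_ge0 => y _; rewrite mulr_ge0// mulr_ge0.
have -> : theta^-1 * (rho x)^-1 * ((vol d h)^-1 * \int[mu]_y (k x y * `|f y| * rho y)) =
    (theta * vol d h * rho x)^-1 * \int[mu]_y (k x y * `|f y| * rho y).
  by rewrite !invfM; ring.
apply: ler_pM; rewrite ?invr_ge0 ?(ltW (m_gt0 x))//.
  by rewrite lef_pV2 ?posrE ?low// mulr_gt0// mulr_gt0.
apply: le_trans (le_normr_Rintegral measurableT i1) _.
rewrite le_eqVlt; apply/orP; left; apply/eqP; apply: eq_Rintegral => y _.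
by rewrite !normrM (ger0_norm (k_ge0 x y)) (ger0_norm (rho_ge0 y)).
Qed.

End Walk.

(** * Nash's inequality for the ball walk of Lebesgue measure *)

(* [(1 - u) ^ N <= 1 / (1 + N u)] by Bernoulli's inequality, as [(1 - u) (1 + u) <= 1]. *)
Lemma expr_onem_bernoulli (R : realType) (u : R) (N : nat) : 0 <= u <= 1 ->
  (1 - u) ^+ N * (1 + N%:R * u) <= 1.
Proof.
move=> /andP[u0 u1]; elim: N => [|N IH]; first by rewrite expr0 mul0r addr0 mul1r.
apply: le_trans IH; rewrite exprSr -mulrA ler_wpM2l ?exprn_ge0 ?subr_ge0//.
rewrite -[N.+1]addn1 natrD; have : 0 <= N%:R * u * u by rewrite !mulr_ge0.
by have := sqr_ge0 u; rewrite expr2; lra.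
Qed.

(** * Decay of a sequence obeying Nash's inequality at every dyadic scale *)

Section NashSequence.
Variables (R : realType) (a : nat -> R) (delta : R) (d kappa : nat).
Hypothesis delta01 : 0 < delta <= 1.
Hypothesis dec : forall n j,
  a n <= 4 ^+ j / delta * (a n - a n.+1) + (2 ^+ (j * d))^-1.
Hypothesis a0 : a 0%N <= 2.
Hypothesis kappa_ge : 2 ^+ d.+1 <= kappa%:R * delta.

(** At a fixed scale, [dec] says that the excess over the floor 2^(-j d) shrinks by 1 - delta / 4^j
    per step. *)
Lemma nash_block n N j : a (n + N)%N - (2 ^+ (j * d))^-1 <=
  (1 - delta / 4 ^+ j) ^+ N * Num.max 0 (a n - (2 ^+ (j * d))^-1).
Proof.
set b := (2 ^+ (j * d))^-1; set u := delta / 4 ^+ j.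
have p0 : 0 < 4 ^+ j :> R by rewrite exprn_gt0.
have step i : a i.+1 - b <= (1 - u) * (a i - b).
  have := dec i j; rewrite -/b => ab.
  have : u * (a i - b) <= a i - a i.+1.
    have -> : a i - a i.+1 = u * (4 ^+ j / delta * (a i - a i.+1)).
      by rewrite /u; field; rewrite !gt_eqF//; case/andP: delta01.
    by rewrite ler_wpM2l ?lerBlDr// divr_ge0 ?(ltW p0)//; case/andP: delta01 => /ltW.
  lra.
have u1 : 0 <= 1 - u.
  rewrite subr_ge0 ler_pdivrMr// mul1r; case/andP: delta01 => _ /le_trans; apply.
  by rewrite exprn_ege1// ler1n.
elim: N => [|N IH]; first by rewrite addn0 expr0 mul1r le_max lexx orbT.
rewrite addnS; apply: le_trans (step _) _; rewrite exprS -mulrA.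
exact: ler_wpM2l.
Qed.

(** Stage i uses scale i + 1 for kappa 4^(i+1) steps. By the choice of [kappa] and Bernoulli, the
    initial excess, at most 2^(d+1) times the new floor, is reduced below one floor, so each stage
    gains 2^d. The geometric sum keeps the total time of order 4^J. *)
Lemma nash_decay J : a (kappa * \sum_(i < J) 4 ^ i.+1)%N <= 2 / 2 ^+ (J * d).
Proof.
elim: J => [|J IH]; first by rewrite big_ord0 muln0 mul0n expr0 divr1.
rewrite big_ord_recr /= mulnDr.
set n := (kappa * \sum_(i < J) _)%N in IH *; set N := (kappa * 4 ^ J.+1)%N.
pose b : R := (2 ^+ (J.+1 * d))^-1.
have b0 : 0 < b by rewrite invr_gt0 exprn_gt0.
have := nash_block n N J.+1; rewrite -/b; set u := delta / _.
have p0 : 0 < 4 ^+ J.+1 :> R by rewrite exprn_gt0.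
have /andP[d0 d1] := delta01.
have u01 : 0 <= u <= 1.
  rewrite divr_ge0 ?(ltW p0) ?(ltW d0)//= ler_pdivrMr// mul1r.
  by apply: le_trans d1 _; rewrite exprn_ege1// ler1n.
have Nu : N%:R * u = kappa%:R * delta.
  by rewrite /N /u natrM natrX; field; rewrite gt_eqF.
have := expr_onem_bernoulli N u01; rewrite Nu.
set q := (1 - u) ^+ N => qk.
have q0 : 0 <= q by rewrite exprn_ge0// subr_ge0; case/andP: u01.
have bE : 2 / 2 ^+ (J * d) = 2 ^+ d.+1 * b.
  rewrite /b mulSn exprD invfM exprS -!mulrA; congr (_ * _).
  by rewrite mulrA divff ?mul1r// gt_eqF// exprn_gt0.
rewrite bE in IH.
have D0 : 0 < 2 ^+ d.+1 :> R by rewrite exprn_gt0.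
have qD : q * 2 ^+ d.+1 <= 1.
  by apply: le_trans qk; rewrite ler_wpM2l// (le_trans kappa_ge)// lerDr.
have mx : Num.max 0 (a n - b) <= 2 ^+ d.+1 * b.
  by rewrite ge_max mulr_ge0 ?(ltW D0) ?(ltW b0)//= (le_trans _ IH)// gerBl ltW.
move=> ab.
have : q * Num.max 0 (a n - b) <= b.
  apply: le_trans (ler_wpM2l q0 mx) _; rewrite mulrA ler_piMl//; exact: ltW.
by rewrite -/b; lra.
Qed.

End NashSequence.

Section IteratedIntegrals.
Variables (R : realType) (d : nat).
Local Notation X := (Rd R d).
Local Notation mu := (@leb R d).
Variables a b c : X -> X -> R.
Hypothesis ma : measurable_fun setT (fun p : X * X => a p.1 p.2).
Hypothesis mb : measurable_fun setT (fun p : X * X => b p.1 p.2).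
Hypothesis mc : measurable_fun setT (fun p : X * X => c p.1 p.2).
Hypothesis a0 : forall x y, 0 <= a x y.
Hypothesis b0 : forall x y, 0 <= b x y.
Hypothesis c0 : forall x y, 0 <= c x y.

Let EFin_meas (g : X -> X -> R) : measurable_fun setT (fun p : X * X => g p.1 p.2) ->
  measurable_fun setT (fun p : X * X => (g p.1 p.2)%:E).
Proof. by move=> mg; exact/measurable_EFinP. Qed.

Let integral2E (g : X -> X -> R) : measurable_fun setT (fun p : X * X => g p.1 p.2) ->
  (forall x y, 0 <= g x y) ->
  (\int[mu]_x \int[mu]_y (g x y)%:E = \int[(mu \x mu)%E]_p (g p.1 p.2)%:E)%E.
Proof.
move=> mg g0; apply/esym; apply: (fubini_tonelli1 (m1 := mu) (m2 := mu) _ (EFin_meas mg)).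
by move=> p; rewrite lee_fin.
Qed.

Lemma integral2_swap :
  (\int[mu]_x \int[mu]_y (a x y)%:E = \int[mu]_y \int[mu]_x (a x y)%:E)%E.
Proof.
apply: (fubini_tonelli (m1 := mu) (m2 := mu) _ (EFin_meas ma)).
by move=> p; rewrite lee_fin.
Qed.

Lemma integral2Zl (t : R) : 0 <= t ->
  (\int[mu]_x (t%:E * \int[mu]_y (a x y)%:E) = t%:E * \int[mu]_x \int[mu]_y (a x y)%:E)%E.
Proof.
move=> t0; apply: ge0_integralZl => //.
  apply: (measurable_fun_fubini_tonelli_F (m2 := mu) _ (EFin_meas ma)).
  by move=> p; rewrite lee_fin.
by move=> x _; apply: integral_ge0 => y _; rewrite lee_fin.
Qed.

Lemma integral2_le : (forall x y, c x y <= 2 * a x y + 2 * b x y) ->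
  (\int[mu]_x \int[mu]_y (c x y)%:E <=
   2%:E * \int[mu]_x \int[mu]_y (a x y)%:E + 2%:E * \int[mu]_x \int[mu]_y (b x y)%:E)%E.
Proof.
move=> le; rewrite !integral2E//.
apply: (@le_trans _ _
    (\int[(mu \x mu)%E]_p (2 * a p.1 p.2 + 2 * b p.1 p.2)%:E)%E).
  by apply: ge0_le_integralR => //; apply: measurable_funD; exact: measurable_funM.
under eq_integral do rewrite EFinD.
rewrite ge0_integralD//=.
- by rewrite !ge0_integralZlR.
- by move=> p _; rewrite lee_fin mulr_ge0.
- by apply/measurable_EFinP; exact: measurable_funM.
- by move=> p _; rewrite lee_fin mulr_ge0.
- by apply/measurable_EFinP; exact: measurable_funM.
Qed.

End IteratedIntegrals.

(** * Growth of the Dirichlet form under doubling of the radius *)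

Section Doubling.
Variables (R : realType) (d : nat).
Local Notation X := (Rd R d).
Local Notation mu := (@leb R d).
Variable f : 'rV[R]_d -> R.
Hypothesis mf : measurable_fun [set: X] f.

Definition energy (r : R) : \bar R :=
  (\int[mu]_x \int[mu]_y (ballI r x y * (f x - f y) ^+ 2)%:E)%E.

Lemma measurable_add_scale (c : R) : measurable_fun [set: X * X]
  (fun p => c *: (p.2 : 'rV[R]_d) + (p.1 : 'rV[R]_d) : X).
Proof.
apply: measurable_rV => i.
rewrite (_ : (fun p : X * X => _) = fun p : X * X =>
  c * (p.2 : 'rV[R]_d) ord0 i + (p.1 : 'rV[R]_d) ord0 i); last first.
  by apply/funext => p; rewrite !mxE.
apply: measurable_funD; last exact: (measurableT_comp (@measurable_coord R d i)).
by apply: measurable_funM => //; exact: (measurableT_comp (@measurable_coord R d i)).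
Qed.

Lemma ballI_shift (r : R) (x z : 'rV[R]_d) : ballI r x (z + x) = ballI r 0 z.
Proof. by rewrite /ballI addrK subr0. Qed.

Lemma ballI_scale (r : R) (z : 'rV[R]_d) : ballI (2 * r) 0 (2 *: z) = ballI r 0 z.
Proof. by rewrite /ballI !subr0 enormZ ger0_norm// ltr_pM2l. Qed.

Let msq (g1 g2 : X * X -> X) : measurable_fun setT g1 -> measurable_fun setT g2 ->
  measurable_fun setT (fun p => (f (g1 p) - f (g2 p)) ^+ 2).
Proof.
move=> m1 m2; apply: (measurable_funX 2).
by apply: measurable_funB; exact: (measurableT_comp mf).
Qed.

Let inc (r c : R) (x z : 'rV[R]_d) := ballI r 0 z * (f x - f (c *: z + x)) ^+ 2.

Let minc r c : measurable_fun [set: X * X] (fun p => inc r c p.1 p.2).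
Proof.
apply: measurable_funM.
  by apply: (measurableT_comp (measurable_ballI1 r (0 : 'rV[R]_d))).
by apply: msq => //; exact: measurable_add_scale.
Qed.

Let minc1 r c (x : X) : measurable_fun [set: X] (inc r c x).
Proof. exact: (measurableT_comp (minc r c) (pair1_measurable x)). Qed.

Let inc_ge0 r c x z : 0 <= inc r c x z.
Proof. by rewrite mulr_ge0 ?ballI_ge0 ?sqr_ge0. Qed.

Lemma energy_shift r : (energy r = \int[mu]_x \int[mu]_z (inc r 1 x z)%:E)%E.
Proof.
apply: eq_integral => x _.
rewrite -(@integral_translate R d x (fun y => (ballI r x y * (f x - f y) ^+ 2)%:E)).
- by apply: eq_integral => z _; rewrite ballI_shift /inc scale1r.
- apply/measurable_EFinP; apply: measurable_funM; first exact: measurable_ballI1.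
  by apply: (measurable_funX 2); exact: measurable_funB.
- by move=> y; rewrite lee_fin mulr_ge0 ?ballI_ge0 ?sqr_ge0.
Qed.

Lemma energy_scale r :
  (energy (2 * r) = \int[mu]_x ((2 ^+ d)%:E * \int[mu]_z (inc r 2 x z)%:E))%E.
Proof.
rewrite energy_shift; apply: eq_integral => x _.
rewrite -(@integral_affine R d 2 0 (fun z => (inc (2 * r) 1 x z)%:E)) ?gt_eqF//.
- rewrite ger0_norm//; congr (_ * _)%E; apply: eq_integral => z _.
  by rewrite addr0 /inc ballI_scale scale1r.
- by apply/measurable_EFinP; exact: minc1.
- by move=> z; rewrite lee_fin.
Qed.

(** Writing the second point as x + 2 z gives the Jacobian 2^d; passing through x + z splits the
    increment into two, whose squares cost a factor 2 each, hence 4 in all. *)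
Lemma energy_double r : (energy (2 * r) <= (2 ^+ (d + 2))%:E * energy r)%E.
Proof.
pose inc' (x z : 'rV[R]_d) := ballI r 0 z * (f (z + x) - f (2 *: z + x)) ^+ 2.
have minc' : measurable_fun [set: X * X] (fun p => inc' p.1 p.2).
  apply: measurable_funM.
    by apply: (measurableT_comp (measurable_ballI1 r (0 : 'rV[R]_d))).
  apply: msq; last exact: measurable_add_scale.
  have := measurable_add_scale 1; congr measurable_fun.
  by apply/funext => p; rewrite scale1r.
have inc'0 x z : 0 <= inc' x z by rewrite mulr_ge0 ?ballI_ge0 ?sqr_ge0.
(* Translation of x by z turns the second increment into the first. *)
have E' : (\int[mu]_x \int[mu]_z (inc' x z)%:E = energy r)%E.
  rewrite energy_shift.
  rewrite (integral2_swap minc' inc'0) (integral2_swap (minc r 1) (inc_ge0 r 1)).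
  apply: eq_integral => z _.
  rewrite -(@integral_translate R d z (fun x => (inc r 1 x z)%:E)).
  - apply: eq_integral => x _; rewrite /inc /inc' (addrC x z).
    by rewrite (_ : 2 *: z + x = 1 *: z + (z + x))// scale1r scaler_nat mulr2n addrA.
  - apply/measurable_EFinP.
    exact: (measurableT_comp (minc r 1) (pair2_measurable (z : X))).
  - by move=> x; rewrite lee_fin.
rewrite energy_scale.
have -> : (\int[mu]_x ((2 ^+ d)%:E * \int[mu]_z (inc r 2 x z)%:E) =
    (2 ^+ d)%:E * \int[mu]_x \int[mu]_z (inc r 2 x z)%:E)%E.
  exact: (integral2Zl (minc r 2) (inc_ge0 r 2) (exprn_ge0 d (ler0n R 2))).
rewrite exprD EFinM -muleA; apply: lee_wpmul2l; first by rewrite lee_fin exprn_ge0.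
have le2 x z : inc r 2 x z <= 2 * inc r 1 x z + 2 * inc' x z.
  rewrite /inc /inc' scale1r ![2 * _]mulrCA -mulrDr ler_wpM2l ?ballI_ge0//.
  set u := f x; set v := f (z + x); set w := f _.
  by have := sqr_ge0 (u - 2 * v + w); rewrite !expr2; lra.
have := integral2_le (minc r 1) minc' (minc r 2) (inc_ge0 r 1) inc'0 (inc_ge0 r 2) le2.
rewrite E' -energy_shift; move/le_trans; apply.
rewrite -ge0_muleDl// -EFinD (_ : 2 + 2 = 2 ^+ 2)//; by ring.
Qed.

End Doubling.

(** * The walk [P] for Lebesgue measure: the kernel theory with density 1 *)

Section BallWalk.
Variables (R : realType) (d : nat).
Local Notation X := (Rd R d).
Local Notation mu := (@leb R d).
Local Notation one := (fun=> 1 : R).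
Local Notation m r := (mh (fun _ : 'rV[R]_d => 1) r).
Local Notation k r := (@ballI R d r).
Local Notation vol := (@vol R d).
Local Notation sq r := (sqint mu one (m r)).
Local Notation ip r := (wip mu one (m r)).
Local Notation P r := (op mu (k r) one (m r)).

Let mone : measurable_fun [set: X] one. Proof. by []. Qed.
Let one_gt0 (x : X) : 0 < one x. Proof. exact: ltr01. Qed.
Let one_loc (r : R) x : (\int[mu]_y (k r x y * one y)%:E < +oo)%E.
Proof. by under eq_integral do rewrite mulr1; rewrite integral_ballI ltry. Qed.
Let mk r : measurable_fun setT (fun p : X * X => k r p.1 p.2).
Proof. exact: measurable_ballI. Qed.
Let k_ge0 r (x y : X) : 0 <= k r x y. Proof. exact: ballI_ge0. Qed.
Let k_sym r (x y : X) : k r x y = k r y x. Proof. exact: ballI_sym. Qed.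
Let k_le1 r (x y : X) : k r x y <= 1. Proof. exact: ballI_le1. Qed.
Let mk1 r x : measurable_fun [set: X] (k r x). Proof. exact: measurable_ballI1. Qed.
Let kE r x : (\int[mu]_y (k r x y * one y)%:E = (m r x)%:E)%E.
Proof. by apply: mhE => //; exact: one_loc. Qed.

Lemma mh_one r x : m r x = vol r.
Proof.
apply: EFin_inj; rewrite -kE -(integral_ballI r x).
by apply: eq_integral => y _; rewrite mulr1.
Qed.

Let mm r : measurable_fun [set: X] (m r).
Proof. by rewrite (_ : m r = fun=> vol r)//; apply/funext => x; exact: mh_one. Qed.

Section Radius.
Variable r : R.
Hypothesis r0 : 0 < r.

Let V0 : 0 < vol r. Proof. exact: vol_gt0. Qed.
Let m_gt0 x : 0 < m r x. Proof. by rewrite mh_one. Qed.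
Let kB x : (\int[mu]_y (k r x y * (one y / m r y))%:E <= 1%:E)%E.
Proof.
under eq_integral do rewrite mh_one mul1r mulrC.
by rewrite ge0_integralZlR ?invr_ge0 ?(ltW V0)// integral_ballI -EFinM mulVf ?gt_eqF.
Qed.

Let B_ge0 : (0 : R) <= 1. Proof. exact: ler01. Qed.

Lemma ball_sqint_op f : sq r f -> sq r (P r f).
Proof.
exact: (sqint_op (mk r) (@k_ge0 r) (@k_sym r) mone one_gt0 (mm r) m_gt0 (kE r) kB (@k_le1 r)).
Qed.

Lemma ball_op_sym f g : sq r f -> sq r g -> ip r (P r f) g = ip r f (P r g).
Proof.
exact: (op_sym (mk r) (@k_ge0 r) (@k_sym r) mone one_gt0 (mm r) m_gt0 (kE r) kB (@k_le1 r)).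
Qed.

Lemma ball_sqint_section f x : sq r f -> mu.-integrable setT (fun y : X => (k r x y * f y * one y)%:E).
Proof. exact: (sqint_section (mk r) (@k_ge0 r) mone one_gt0 (mm r) m_gt0 kB (@k_le1 r)). Qed.

Lemma ball_sqint_mul f g : sq r f -> sq r g ->
  mu.-integrable setT (fun y : X => (f y * g y * (m r y * one y))%:E).
Proof. exact: (sqint_mul mone one_gt0 (mm r) m_gt0). Qed.

Lemma ball_CauchySchwarz f g : sq r f -> sq r g ->
  `|ip r f g| <= Num.sqrt (ip r f f) * Num.sqrt (ip r g g).
Proof. exact: (wip_CauchySchwarz mone one_gt0 (mm r) m_gt0). Qed.

(** For density 1 the comparison [low] holds with theta = 1, so delta = 2^-d is admissible and the
    form bound has 2^-d / 2. *)
Lemma ball_energy_decrement f : sq r f ->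
  (2 ^+ d)^-1 / 2 * (ip r f f - ip r (P r f) f) <= ip r f f - ip r (P r f) (P r f).
Proof.
apply: (energy_decrement (mk r) (@k_ge0 r) (@k_sym r) mone one_gt0 (mm r) m_gt0 (kE r) kB
  (@k_le1 r)).
apply: (@walk_form_lower R d one r 1 mone one_gt0 one_loc r0 ltr01) => //.
- by move=> s x s0 _; rewrite mul1r mulr1 mh_one.
- by rewrite expr1n mulr1 div1r.
Qed.

Lemma energyE f : sq r f -> (energy f r = (2 * (ip r f f - ip r (P r f) f))%:E)%E.
Proof.
move=> hf.
have iD := integrable_diff (mk r) (@k_ge0 r) (@k_sym r) mone one_gt0 (mm r) m_gt0 (kE r) hf.
rewrite -(dirichlet_formE (mk r) (@k_ge0 r) (@k_sym r) mone one_gt0 (mm r) m_gt0 (kE r) kB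
  (@k_le1 r) hf) EFin_Rint//.
have mF := measurable_int _ iD.
have F0 (p : X * X) : (0 <= (k r p.1 p.2 * one p.1 * one p.2 * (f p.1 - f p.2) ^+ 2)%:E)%E.
  by rewrite lee_fin !mulr1 mulr_ge0 ?sqr_ge0.
rewrite (fubini_tonelli1 (m1 := mu) (m2 := mu) _ mF F0).
by apply: eq_integral => x _; apply: eq_integral => y _; rewrite /= !mulr1.
Qed.

Lemma ball_op_ge0 (f : X -> R) : (forall x, 0 <= f x) -> forall x, 0 <= P r f x.
Proof.
move=> f0 x; rewrite mulr_ge0 ?invr_ge0 ?(ltW (m_gt0 x))//.
by apply: Rintegral_ge0 => y _; rewrite mulr1 mulr_ge0.
Qed.

Lemma ball_op_EFin f x : sq r f ->
  ((P r f x)%:E = (vol r)^-1%:E * \int[mu]_y (k r x y * f y)%:E)%E.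
Proof.
move=> hf; rewrite /op mh_one EFinM EFin_Rint; last exact: ball_sqint_section.
by congr (_ * _)%E; apply: eq_integral => y _; rewrite mulr1.
Qed.

Definition subdensity (f : X -> R) :=
  [/\ sq r f, forall x, 0 <= f x & (\int[mu]_x (f x)%:E <= 1)%E].

Let mkf f x : measurable_fun [set: X] f -> measurable_fun [set: X] (fun y => k r x y * f y).
Proof. by move=> mf; apply: measurable_funM. Qed.

Lemma subdensity_op f : subdensity f -> subdensity (P r f).
Proof.
move=> [hf f0 f1]; have [mf _] := hf; split; [exact: ball_sqint_op|exact: ball_op_ge0|].
apply: le_trans f1; under eq_integral do rewrite ball_op_EFin//.
have mF : measurable_fun setT (fun p : X * X => (k r p.1 p.2 * f p.2)%:E).
  apply/measurable_EFinP; apply: measurable_funM; first exact: mk.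
  exact: (measurableT_comp mf).
have F0 (p : X * X) : (0 <= (k r p.1 p.2 * f p.2)%:E)%E by rewrite lee_fin mulr_ge0.
have mI : measurable_fun [set: X] (fun x => \int[mu]_y (k r x y * f y)%:E)%E.
  exact: (measurable_fun_fubini_tonelli_F (m2 := mu) _ mF).
rewrite ge0_integralZl// ?lee_fin ?invr_ge0 ?(ltW V0)//; last first.
  by move=> x _; apply: integral_ge0 => y _; rewrite lee_fin mulr_ge0.
have -> : (\int[mu]_x \int[mu]_y (k r x y * f y)%:E = \int[mu]_y (vol r * f y)%:E)%E.
  transitivity (\int[mu]_y \int[mu]_x (k r x y * f y)%:E)%E.
    exact: (fubini_tonelli (m1 := mu) (m2 := mu) _ mF F0).
  apply: eq_integral => y _; rewrite EFinM muleC -(integral_ballI r y) -ge0_integralZlR//.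
  by apply: eq_integral => x _; rewrite mulrC k_sym.
by rewrite ge0_integralZlR ?(ltW V0)// muleA -EFinM mulVf ?gt_eqF// mul1e.
Qed.

(** The weight of [ip r] is the constant [vol r], which cancels the normalisation of [P r]: the form
    integrates f x times the mass of f in a ball, and that mass is at most 1. *)
Lemma subdensity_ip_le1 f : subdensity f -> ip r (P r f) f <= 1.
Proof.
move=> [hf f0 f1]; have [mf _] := hf; have [mPf _] := ball_sqint_op hf.
rewrite -lee_fin /wip EFin_Rint; last exact: (ball_sqint_mul (ball_sqint_op hf) hf).
apply: le_trans (f1); apply: ge0_le_integralR => //.
- by apply: measurable_funM; [exact: measurable_funM|exact: measurable_funM].
- by move=> x; rewrite mulr1 mh_one mulr_ge0 ?(ltW V0)// mulr_ge0// ball_op_ge0.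
move=> x; rewrite mulr1 mh_one mulrAC ler_piMl// -lee_fin EFinM ball_op_EFin//.
rewrite muleC muleA -EFinM divff ?gt_eqF// mul1e.
apply: le_trans f1; apply: ge0_le_integralR => //; first exact: mkf.
- by move=> y; rewrite mulr_ge0.
- by move=> y; rewrite ler_piMl.
Qed.

End Radius.

Lemma ball_sqint_change r s f : 0 < r -> sq r f -> sq s f.
Proof.
move=> r0 hf; have V0 : 0 < vol r by exact: vol_gt0.
have m0 x : 0 < m r x by rewrite mh_one.
have [mf fi] := hf; split=> //.
rewrite (_ : (fun x => _) = fun x => (vol s / vol r * (f x ^+ 2 * m r x * 1))%:E); last first.
  by apply/funext => x; congr (_%:E); rewrite !mh_one; field; rewrite gt_eqF.
rewrite ge0_integralZlR//.
- by rewrite lte_mul_pinfty// ?lee_fin ?divr_ge0 ?vol_ge0.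
- by rewrite divr_ge0 ?vol_ge0.
- apply: measurable_funM => //; apply: measurable_funM => //; exact: (measurable_funX 2 mf).
- by move=> x; rewrite mulr1 mulr_ge0 ?sqr_ge0// ltW.
Qed.

Lemma ball_ip_change r s f : 0 < r -> sq r f -> ip s f f = vol s / vol r * ip r f f.
Proof.
move=> r0 hf; have V0 : 0 < vol r by exact: vol_gt0.
rewrite /wip -RintegralZl//; last exact: (ball_sqint_mul r0 hf hf).
by apply: eq_Rintegral => x _; rewrite !mh_one; field; rewrite gt_eqF.
Qed.

Lemma energy_double_iter (f : X -> R) j r : measurable_fun [set: X] f ->
  (energy f (2 ^+ j * r) <= (2 ^+ (j * (d + 2)))%:E * energy f r)%E.
Proof.
move=> mf; elim: j => [|j IH]; first by rewrite mul0n !expr0 mul1r mul1e.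
rewrite exprS -mulrA; apply: le_trans (energy_double mf _) _.
by rewrite mulSn [X in (_ <= X%:E * _)%E]exprD EFinM -muleA lee_wpmul2l ?lee_fin ?exprn_ge0.
Qed.

(* The Dirichlet form at radius [2 ^ j h] controls the [L^2] norm up to the mass of [f],
   and is itself controlled by the Dirichlet form at radius [h]. *)
Lemma nash_inequality (h : R) j f : 0 < h -> subdensity h f ->
  ip h f f <= 4 ^+ j * (ip h f f - ip h (P h f) f) + (2 ^+ (j * d))^-1.
Proof.
move=> h0 [hf f0 f1]; have [mf _] := hf; set r := 2 ^+ j * h.
have r0 : 0 < r by rewrite mulr_gt0// exprn_gt0.
have hr : sq r f by exact: ball_sqint_change hf.
have := energy_double_iter j h mf; rewrite -/r !energyE// -EFinM lee_fin.
have volr : vol r / vol h = 2 ^+ (j * d).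
  by rewrite /r volM ?exprn_gt0// -exprM mulfK// gt_eqF// vol_gt0.
have := subdensity_ip_le1 r0 (And3 hr f0 f1).
rewrite (ball_ip_change r h0 hf) volr mulnDr exprD (exprM _ j 2).
rewrite (_ : (2 ^+ j) ^+ 2 = 4 ^+ j); last first.
  by rewrite -exprM mulnC exprM; congr (_ ^+ _); ring.
set A := ip h f f; set B := ip h (P h f) f; set q := 2 ^+ (j * d); set C := ip r _ _.
have q0 : 0 < q by rewrite exprn_gt0.
(* [E] reads q A - C <= q 4^j (A - B) with C <= 1; dividing by q = 2^(j d), the volume ratio, gives
   the claim. *)
move=> C1 E.
rewrite -(ler_pM2l q0) mulrDr divff ?gt_eqF//.
have : q * (4 ^+ j * (A - B)) = q * 4 ^+ j * (A - B) by rewrite mulrA.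
lra.
Qed.

(** The lower bound makes the final ball of unit volume scale, and the upper bound gives 4^J h^2 <=
    4, hence O(h^(-2)) steps. *)
Lemma dyadic_scale (h : R) : 0 < h <= 1 -> exists J, 1 <= 2 ^+ J * h <= 2.
Proof.
move=> /andP[h0 h1].
have ex : exists J, 1 <= 2 ^+ J * h.
  exists (Num.truncn h^-1).+1; rewrite -ler_pdivrMr// div1r.
  apply: le_trans (ltW (truncnS_gt _)) _.
  by rewrite -natrX ler_nat ltnW// ltn_expl.
case: (ex_minnP ex) => -[|J] H min; first by exists 0%N; rewrite H mul1r; lra.
exists J.+1; rewrite H exprS -mulrA -[leRHS]mulr1 ler_pM2l//= leNgt.
by apply/negP => /ltW /min; rewrite ltnn.
Qed.

(** Bounds n0 h^2: the number of steps is at most 4^(d+1) * 2 * 4^J + 1, with 4^J h^2 <= 4 and h^2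
    <= 1. *)
Definition heat_time : R := (8 * 4 ^ d.+1 + 1)%:R.

Lemma heat_bound (h : R) : 0 < h <= 1 -> exists2 n0 : nat, n0%:R * h ^+ 2 <= heat_time &
  forall w, sq h w -> forall x,
    `|iter n0 (P h) w x| <= Num.sqrt (2 / (vol h * vol 1)) * Num.sqrt (ip h w w).
Proof.
move=> /[dup] h01 /andP[h0 h1]; have [J /andP[J1 J2]] := dyadic_scale h01.
have V0 : 0 < vol h by exact: vol_gt0.
have V1 : 0 < vol 1 by exact: vol_gt0.
pose N := (4 ^ d.+1 * \sum_(i < J) 4 ^ i.+1)%N.
exists N.+1.
  have NJ : (N.+1 <= 4 ^ d.+1 * (2 * 4 ^ J) + 1)%N.
    rewrite addn1 ltnS leq_mul2l; apply/orP; right.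
    suff : (3 * \sum_(i < J) 4 ^ i.+1 + 4 = 4 ^ J.+1)%N by rewrite expnS; lia.
    elim: J {J1 J2 N} => [|J IH]; first by rewrite big_ord0.
    by rewrite big_ord_recr /= mulnDr addnAC IH [in RHS]expnS; lia.
  apply: (@le_trans _ _ ((4 ^ d.+1 * (2 * 4 ^ J) + 1)%:R * h ^+ 2)).
    by rewrite ler_wpM2r ?sqr_ge0// ler_nat.
  rewrite /heat_time; set D := (4 ^ d.+1)%N; rewrite !natrD !natrM [(4 ^ J)%:R]natrX.
  have p : (2 ^+ J * h) ^+ 2 <= 4.
    rewrite (_ : 4 = 2 ^+ 2); last by ring.
    by rewrite lerXn2r ?nnegrE//; exact: le_trans ler01 J1.
  have e : 4%:R ^+ J * h ^+ 2 = (2 ^+ J * h) ^+ 2.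
    by rewrite exprMn -exprM mulnC exprM; congr (_ ^+ _ * _); ring.
  have h2 : h ^+ 2 <= 1 by rewrite expr_le1// ltW.
  have D0 : 0 <= D%:R :> R by [].
  have : D%:R * (4%:R ^+ J * h ^+ 2) <= D%:R * 4 :> R by rewrite e ler_wpM2l.
  set x := D%:R in D0 *; set y := _ ^+ J in e *; set z := h ^+ 2 in e h2 *.
  have -> : (x * (2 * y) + 1) * z = 2 * (x * (y * z)) + z by ring.
  lra.
move=> w hw x.
pose p (y : X) : R := (vol h)^-1 * k h x y.
have mp : measurable_fun [set: X] p by exact: measurable_funM.
have p0 y : 0 <= p y by rewrite mulr_ge0 ?invr_ge0 ?(ltW V0).
have kk y : k h x y * k h x y = k h x y.
  by rewrite /ballI; case: (_ < _); rewrite ?mulr1 ?mulr0.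
have pE (y : X) : p y ^+ 2 * m h y * 1 = (vol h)^-1 * k h x y.
  rewrite mulr1 mh_one /p exprMn [k _ _ _ ^+ 2]expr2 kk; field; exact: lt0r_neq0.
have ip_ : (\int[mu]_y (p y ^+ 2 * m h y * 1)%:E = 1)%E.
  under eq_integral do rewrite pE.
  by rewrite ge0_integralZlR ?invr_ge0 ?(ltW V0)// integral_ballI -EFinM mulVf ?gt_eqF.
have hp : sq h p by split=> //; rewrite ip_ ltry.
have dp : subdensity h p.
  split=> //.
  by rewrite ge0_integralZlR ?invr_ge0 ?(ltW V0)// integral_ballI -EFinM mulVf ?gt_eqF.
have dn n : subdensity h (iter n (P h) p) by elim: n => //= n; exact: subdensity_op.
pose a n := ip h (iter n (P h) p) (iter n (P h) p).
pose delta : R := (2 ^+ d)^-1 / 2.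
have D0 : 0 < 2 ^+ d :> R by rewrite exprn_gt0.
have delta01 : 0 < delta <= 1.
  rewrite divr_gt0 ?invr_gt0//= ler_pdivrMr// mul1r.
  by apply: (@le_trans _ _ 1); [rewrite invf_le1// exprn_ege1// ler1n|rewrite ler1n].
have dec n j : a n <= 4 ^+ j / delta * (a n - a n.+1) + (2 ^+ (j * d))^-1.
  have [hn _ _] := dn n.
  apply: le_trans (nash_inequality j h0 (dn n)) _; rewrite lerD2r -mulrA ler_wpM2l ?exprn_ge0//.
  by rewrite ler_pdivlMl; [exact: ball_energy_decrement|case/andP: delta01].
have a0 : a 0%N <= 2.
  rewrite /a /= -lee_fin -(wipE mone one_gt0 (mm h) _ hp); last by move=> y; rewrite mh_one.
  under eq_integral do rewrite mulrA.
  by rewrite ip_ lee_fin ler1n.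
(* The choice kappa = 4^(d+1) makes this an equality. *)
have kd : 2 ^+ d.+1 <= (4 ^ d.+1)%:R * delta.
  rewrite natrX (_ : 4%:R = 2 ^+ 2); last by ring.
  rewrite -exprM mulnC exprM expr2 -mulrA ler_peMr ?exprn_ge0// /delta.
  by rewrite exprS; rewrite le_eqVlt; apply/orP; left; apply/eqP; field; exact: lt0r_neq0.
have aN := nash_decay delta01 dec a0 kd J.
have [hN _ _] := dn N.
have hwn n : sq h (iter n (P h) w) by elim: n => //= n; exact: ball_sqint_op.
have hpn n : sq h (iter n (P h) p) by have [] := dn n.
have sym n g : sq h g -> ip h p (iter n (P h) g) = ip h (iter n (P h) p) g.
  elim: n g => //= n IH g hg; rewrite ball_op_sym// -IH; last exact: ball_sqint_op.
  by rewrite -iterSr.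
have -> : iter N.+1 (P h) w x = (vol h)^-1 * ip h (iter N (P h) p) w.
  rewrite -sym// iterS /op mh_one /wip; congr (_ * _).
  by apply: eq_Rintegral => y _; rewrite mh_one /p; field; rewrite gt_eqF.
rewrite normrM ger0_norm ?invr_ge0 ?(ltW V0)//.
apply: (@le_trans _ _ ((vol h)^-1 * (Num.sqrt (a N) * Num.sqrt (ip h w w)))).
  by rewrite ler_wpM2l ?invr_ge0 ?(ltW V0)// ball_CauchySchwarz.
rewrite mulrA ler_wpM2r ?sqrtr_ge0//.
rewrite -ler_sqr ?nnegrE ?mulr_ge0 ?sqrtr_ge0 ?invr_ge0 ?(ltW V0)//.
have aN0 : 0 <= a N by apply: (wip_ge0 mu one_gt0) => y; rewrite mh_one.
have c0 : 0 <= 2 / (vol h * vol 1) by rewrite divr_ge0// mulr_ge0// ltW.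
rewrite exprMn (sqr_sqrtr aN0) (sqr_sqrtr c0).
have vJ : vol 1 <= 2 ^+ (J * d) * vol h.
  rewrite exprM -volM ?exprn_gt0//.
  rewrite -[2 ^+ J * h]mulr1 volM; last by rewrite mulr_gt0// exprn_gt0.
  by rewrite ler_peMl ?(ltW V1)// exprn_ege1.
apply: (@le_trans _ _ ((vol h)^-1 ^+ 2 * (2 / 2 ^+ (J * d)))).
  by rewrite ler_wpM2l ?sqr_ge0.
have q0 : 0 < 2 ^+ (J * d) :> R by rewrite exprn_gt0.
rewrite invfM mulrCA ler_wpM2l// expr2 -mulrA ler_wpM2l ?invr_ge0 ?(ltW V0)//.
by rewrite -invfM lef_pV2 ?posrE ?mulr_gt0// mulrC.
Qed.

End BallWalk.

(** * Pointwise bounds and conclusion *)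

Section Domination.
Variables (R : realType) (d : nat) (rho : 'rV[R]_d -> R) (M h theta : R).
Local Notation X := (Rd R d).
Local Notation mu := (@leb R d).
Hypothesis mrho : measurable_fun [set: X] rho.
Hypothesis rho_gt0 : forall x, 0 < rho x.
Hypothesis rho_le : forall x, rho x <= M.
Hypothesis rho_loc : forall r x, (\int[mu]_y (ballI r x y * rho y)%:E < +oo)%E.
Hypothesis h01 : 0 < h <= 1.
Hypothesis theta0 : 0 < theta.
Hypothesis low : forall r x, 0 < r -> r <= h -> theta * vol d r * rho x <= mh rho r x.
Hypothesis rho_int : (\int[mu]_x (rho x)%:E < +oo)%E.

Local Notation one := (fun=> 1 : R).
Local Notation m := (mh rho h).
Local Notation k := (@ballI R d h).
Local Notation sq := (sqint mu rho m).
Local Notation ip := (wip mu rho m).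
Local Notation T := (op mu k rho m).
Local Notation m1 := (mh (fun _ : 'rV[R]_d => 1) h).
Local Notation sq1 := (sqint mu one m1).
Local Notation ip1 := (wip mu one m1).
Local Notation P := (op mu k one m1).

Let h0 : 0 < h. Proof. by case/andP: h01. Qed.
Let V0 : 0 < vol d h. Proof. exact: vol_gt0. Qed.
Let m_gt0 x : 0 < m x. Proof. exact: (mh_gt0 rho_gt0 h0 theta0 low). Qed.
Let mm : measurable_fun [set: X] m. Proof. exact: measurable_mh. Qed.
Let m1_gt0 x : 0 < m1 x. Proof. by rewrite mh_one. Qed.
Let mm1 : measurable_fun [set: X] m1.
Proof. by rewrite (_ : m1 = fun=> vol d h)//; apply/funext => x; exact: mh_one. Qed.
Let rho_ge0 x : 0 <= rho x. Proof. exact: ltW. Qed.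

Let w (u : X -> R) (y : X) := rho y * `|u y|.

Let mw u : measurable_fun [set: X] u -> measurable_fun [set: X] (w u).
Proof. by move=> mu0; apply: measurable_funM => //; exact: measurableT_comp. Qed.

Let w_bound u x : w u x ^+ 2 * (m1 x * 1) <= theta^-1 * (u x ^+ 2 * (m x * rho x)).
Proof.
rewrite mulr1 mh_one /w exprMn real_normK ?num_real//.
have -> : rho x ^+ 2 * u x ^+ 2 * vol d h =
  theta^-1 * (u x ^+ 2 * (theta * vol d h * rho x * rho x)) by field; rewrite gt_eqF.
by rewrite ler_wpM2l ?invr_ge0 ?(ltW theta0)// ler_wpM2l ?sqr_ge0// ler_wpM2r// low.
Qed.

Lemma rho_mul_sqint u : sq u -> sq1 (w u).
Proof.
move=> hu; have [mu0 _] := hu; have := sqint_sqr mrho rho_gt0 mm m_gt0 hu => iu.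
have one0 (y : X) : 0 < one y by exact: ltr01.
apply: (sqintP one0 m1_gt0); first exact: mw.
apply: (le_integrableR _ _ (integrableZR theta^-1 iu)).
  apply: measurable_funM; first exact: (measurable_funX 2 (mw mu0)).
  exact: measurable_funM.
move=> x; rewrite ger0_norm ?w_bound// mulr1 mulr_ge0 ?sqr_ge0// ltW//.
Qed.

(** Since m rho >= theta vol rho^2, the norm for nu controls the Lebesgue norm of rho u. *)
Lemma rho_mul_ip u : sq u -> ip1 (w u) (w u) <= theta^-1 * ip u u.
Proof.
move=> hu; have hw := rho_mul_sqint hu.
rewrite /wip -RintegralZl//; last exact: (sqint_mul mrho rho_gt0 mm m_gt0 hu hu).
apply: le_Rintegral => //.
- exact: (ball_sqint_mul h0 hw hw).
- by apply: integrableZR; exact: (sqint_mul mrho rho_gt0 mm m_gt0 hu hu).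
- by move=> x _; rewrite -!expr2 w_bound.
Qed.

(** The quantity rho |T^n u| reproduces itself: one step divides by m >= theta vol rho, and the
    factor rho at the integration variable is exactly what the next step needs. Only theta^-1 is
    lost per step. *)
Lemma iter_dominated u n x : sq u ->
  `|iter n T u x| <= theta^-1 ^+ n * (rho x)^-1 * iter n P (w u) x.
Proof.
move=> hu; have hw := rho_mul_sqint hu.
have hTn i : sq (iter i T u) := sqint_iter mrho rho_gt0 rho_loc h0 theta0 low i hu.
have hPn i : sq1 (iter i P (w u)) by elim: i => //= i; exact: ball_sqint_op.
elim: n x => [|n IH] x; first by rewrite /= expr0 mul1r /w mulKf// gt_eqF.
rewrite 2!iterS; move: (iter n P (w u)) IH (hPn n) => g IH hg.
apply: le_trans (walk_op_dominated mrho rho_gt0 rho_loc h0 theta0 low x (hTn n)) _.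
rewrite exprS.
have -> : theta^-1 * theta^-1 ^+ n * (rho x)^-1 * P g x =
  theta^-1 * (rho x)^-1 * (theta^-1 ^+ n * P g x) by ring.
rewrite ler_wpM2l ?mulr_ge0 ?invr_ge0 ?(ltW theta0)//.
have -> : P g x = (vol d h)^-1 * \int[mu]_y (k x y * g y * 1) by rewrite /op mh_one.
rewrite mulrCA ler_wpM2l ?invr_ge0 ?(ltW V0)//.
have iP := ball_sqint_section h0 x hg.
rewrite -RintegralZl//; apply: le_Rintegral => //.
- exact: (walk_local mrho rho_gt0 rho_loc h0 theta0 low x (hTn n)).
- exact: integrableZR.
move=> y _; rewrite mulr1 mulrCA -mulrA ler_wpM2l ?ballI_ge0//.
by have := IH y; rewrite mulrAC ler_pdivlMr.
Qed.

Lemma dominated_heat_bound : exists2 n0 : nat, n0%:R * h ^+ 2 <= heat_time R d &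
  forall f, sq f -> forall x, `|iter n0 T f x| <=
    theta^-1 ^+ n0 * (rho x)^-1 * Num.sqrt (2 / (vol d h * vol d 1)) * Num.sqrt theta^-1
      * Num.sqrt (ip f f).
Proof.
have [n0 n0h H] := heat_bound d h01; exists n0 => // f hf x.
apply: le_trans (iter_dominated n0 x hf) _.
have th0 : 0 <= theta^-1 by rewrite invr_ge0 ltW.
rewrite -!mulrA ler_wpM2l ?exprn_ge0// ler_wpM2l ?invr_ge0//.
apply: le_trans (ler_norm _) _.
apply: le_trans (H _ (rho_mul_sqint hf) x) _.
rewrite ler_wpM2l ?sqrtr_ge0// -sqrtrM//.
by apply: ler_wsqrtr; exact: rho_mul_ip.
Qed.

End Domination.

(** * Lower bounds for the mass of small balls *)

Section LocalComparison.
Variables (R : realType) (d : nat) (rho : 'rV[R]_d -> R).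
Local Notation X := (Rd R d).
Local Notation mu := (@leb R d).

Lemma continuous_measurable_Rd : continuous rho -> measurable_fun [set: X] rho.
Proof.
move=> crho; apply: (measurability (@RGenOInfty.G R)); first exact: RGenOInfty.measurableE.
move=> _ [_ [x ->] <-]; rewrite setTI; apply: sub_gen_smallest => /=.
by apply: open_comp; [move=> y _; exact: crho|exact: interval_open].
Qed.

Lemma is_derive_line (x v : 'rV[R]_d) (t : R) : derivable rho (t *: v + x) v ->
  is_derive t 1 (fun s : R => rho (s *: v + x)) ('D_v rho (t *: v + x)).
Proof.
have E : (fun h : R => h^-1 *: (rho ((h *: 1 + t) *: v + x) - rho (t *: v + x))) =
    (fun h : R => h^-1 *: (rho (h *: v + (t *: v + x)) - rho (t *: v + x))).
  by apply/funext => h; rewrite scalerDl addrA /GRing.scale /= mulr1.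
move=> dv; split; last by rewrite /derive E.
by rewrite /derivable E.
Qed.

Lemma is_derive_expR_weighted (phi : R -> R) (C t dphi : R) : is_derive t 1 phi dphi ->
  is_derive t 1 (fun s => expR (C * s) * phi s) (expR (C * t) * (dphi + C * phi t)).
Proof.
move=> dp.
have dl : is_derive t 1 (fun s => C * s) C.
  by apply: is_derive_eq; rewrite /GRing.scale /= mulr1.
have de : is_derive t 1 (fun s => expR (C * s)) (C * expR (C * t)).
  have dc := @is_derive1_comp _ expR (fun s => C * s) t _ _ (is_derive_expR (C * t)) dl.
  exact: (is_derive_eq dc (mulrC _ _)).
apply: (@is_derive_eq _ _ _ _ _ _ _ _ (is_deriveM de dp)).
by rewrite /GRing.scale /=; ring.
Qed.

(** The bound makes e^(C s) phi nondecreasing and e^(-C s) phi nonincreasing; the mean value theorem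
    is applied to one or the other according to the sign of t. *)
Lemma log_lipschitz (phi dphi : R -> R) (C : R) :
  (forall t : R, is_derive t 1 phi (dphi t)) -> (forall t, `|dphi t| <= C * phi t) ->
  forall t, expR (- (C * `|t|)) * phi 0 <= phi t.
Proof.
move=> dp bd t.
have cont (c : R) a b : {within `[a, b], continuous (fun s => expR (c * s) * phi s)}.
  apply: continuous_subspaceT => s.
  have := is_derive_expR_weighted c (dp s) => ds.
  by apply: differentiable_continuous; apply/derivable1_diffP; case: ds.
have [t0|t0] := leP 0 t.
  have [c _] := MVT_segment t0 (fun s _ => is_derive_expR_weighted C (dp s)) (cont C 0 t).
  rewrite mulr0 expR0 mul1r subr0 => E.
  have : phi 0 <= expR (C * t) * phi t.
    rewrite -subr_ge0 E !mulr_ge0 ?expR_ge0//.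
    by have := bd c; rewrite ler_norml => /andP[]; lra.
  by move=> le; rewrite ger0_norm// expRN mulrC ler_pdivrMr ?expR_gt0// mulrC.
have [c _] := MVT_segment (ltW t0) (fun s _ => is_derive_expR_weighted (- C) (dp s))
  (cont (- C) t 0).
rewrite mulr0 expR0 mul1r sub0r => E.
have : phi 0 <= expR (- C * t) * phi t.
  rewrite -subr_le0 E mulr_le0_ge0 ?oppr_ge0 ?(ltW t0)// mulr_ge0_le0 ?expR_ge0//.
  by have := bd c; rewrite ler_norml => /andP[]; lra.
rewrite ltr0_norm// mulNr mulrN opprK => le.
by rewrite -[C * t]opprK expRN mulrC ler_pdivrMr ?expR_gt0// mulrC.
Qed.

(** Only coordinate derivatives are available, so x is joined to y by changing one coordinate at a
    time; each of the d legs is no longer than |y - x|. *)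
Lemma harnack (C : R) : 0 <= C ->
  (forall x i, derivable rho x (@ecoord R d i)) ->
  (forall x i, `|'D_(@ecoord R d i) rho x| <= C * rho x) ->
  (forall x, 0 < rho x) ->
  forall x y, expR (- (d%:R * C * enorm (y - x))) * rho x <= rho y.
Proof.
move=> C0 dr bd r0 x y.
pose z (j : nat) : 'rV[R]_d := \row_i (if (i < j)%N then y ord0 i else x ord0 i).
have zS (i : 'I_d) : z i.+1 = (y ord0 i - x ord0 i) *: @ecoord R d i + z i.
  apply/rowP => l; rewrite !mxE eqxx /= ltnS leq_eqVlt.
  case: (eqVneq l i) => [->|li]; first by rewrite eqxx ltnn mulr1 subrK.
  by rewrite -[(l == i :> nat)]/(l == i) (negPf li) /= mulr0 add0r.
have step j : (j <= d)%N -> expR (- (j%:R * C * enorm (y - x))) * rho x <= rho (z j).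
  elim: j => [_|j IH jd].
    rewrite !mul0r oppr0 expR0 mul1r (_ : z 0%N = x)//.
    by apply/rowP => l; rewrite mxE.
  pose i := Ordinal jd.
  have zS' : z j.+1 = (y ord0 i - x ord0 i) *: @ecoord R d i + z j := zS i.
  have := @log_lipschitz (fun s => rho (s *: @ecoord R d i + z j)) _ C
    (fun t => is_derive_line (dr _ i)) (fun t => bd _ i) (y ord0 i - x ord0 i).
  rewrite -zS' scale0r add0r; apply: le_trans.
  have -> : expR (- (j.+1%:R * C * enorm (y - x))) =
     expR (- (C * enorm (y - x))) * expR (- (j%:R * C * enorm (y - x))).
    by rewrite -expRD -[j.+1]add1n natrD; congr expR; ring.
  rewrite -mulrA; apply: ler_pM; rewrite ?expR_ge0 ?mulr_ge0 ?expR_ge0 ?(ltW (r0 _))//.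
    rewrite ler_expR lerN2 ler_wpM2l//.
    by have := ler_coord_enorm (y - x) i; rewrite !mxE.
  exact: IH (ltnW jd).
have := step d (leqnn d); rewrite (_ : z d = y)//.
by apply/rowP => l; rewrite mxE ltn_ord.
Qed.

Hypothesis mrho : measurable_fun [set: X] rho.
Hypothesis rho_gt0 : forall x, 0 < rho x.
Hypothesis rho_loc : forall r x, (\int[mu]_y (ballI r x y * rho y)%:E < +oo)%E.

Lemma harnack_mh_ge (L h : R) : 0 <= L ->
  (forall x y, expR (- (L * enorm (y - x))) * rho x <= rho y) ->
  forall r x, 0 < r -> r <= h -> expR (- (L * h)) * vol d r * rho x <= mh rho r x.
Proof.
move=> L0 H r x r0 rh.
rewrite -lee_fin -(mhE mrho rho_gt0 rho_loc) mulrAC EFinM -(integral_ballI r x).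
have mb : measurable_fun [set: X] (ballI r x) by exact: measurable_ballI1.
rewrite -ge0_integralZlR ?mulr_ge0 ?expR_ge0 ?(ltW (rho_gt0 x))//.
apply: ge0_le_integralR => //.
- exact: measurable_funM.
- exact: measurable_funM.
- by move=> y; rewrite !mulr_ge0 ?expR_ge0 ?ballI_ge0 ?(ltW (rho_gt0 x)).
move=> y; rewrite mulrC /ballI; case: ltP => [xy|_]; last by rewrite !mul0r.
rewrite !mul1r; apply: le_trans (H x y); rewrite ler_wpM2r ?(ltW (rho_gt0 x))//.
by rewrite ler_expR lerN2 ler_wpM2l// (le_trans (ltW xy)).
Qed.

(** Pairing y = x + v with its reflection x - v turns the linear term of the exponent into a
    hyperbolic cosine, at least 1. Only the quadratic term is lost, so the loss is of second order
    in h and uniform in x. *)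
Lemma gaussian_mh_ge (alpha beta h : R) : 0 < alpha -> 0 < beta ->
  (forall x, rho x = beta * expR (- alpha * enorm x ^+ 2)) ->
  forall r x, 0 < r -> r <= h -> expR (- (alpha * h ^+ 2)) * vol d r * rho x <= mh rho r x.
Proof.
move=> a0 b0 rhoE r x r0 rh.
have mb : measurable_fun [set: X] (ballI r x) by exact: measurable_ballI1.
have f0 (y : 'rV[R]_d) : 0 <= ballI r x y * rho y.
  by rewrite mulr_ge0 ?ballI_ge0 ?(ltW (rho_gt0 y)).
have mF : measurable_fun [set: X] (fun y => (ballI r x y * rho y)%:E).
  by apply/measurable_EFinP; exact: measurable_funM.
have F0 (y : 'rV[R]_d) : (0 <= (ballI r x y * rho y)%:E)%E by rewrite lee_fin.
have E1 : (\int[mu]_z (ballI r x (x + x - z) * rho (x + x - z))%:E = (mh rho r x)%:E)%E.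
  by rewrite -(mhE mrho rho_gt0 rho_loc) -(integral_reflect (x + x) mF F0).
have mF' : measurable_fun [set: X] (fun z => ballI r x (x + x - z) * rho (x + x - z)).
  have mr : measurable_fun [set: X] (fun z : X => x + x - (z : 'rV[R]_d) : X).
    have := @measurable_affine R d (-1) (x + x); congr measurable_fun.
    by apply/funext => z; rewrite scaleN1r addrC.
  exact: (measurableT_comp (measurable_funM mb mrho) mr).
suff : (\int[mu]_y (2 * (expR (- (alpha * h ^+ 2)) * rho x) * ballI r x y)%:E <=
    (2 * mh rho r x)%:E)%E.
  rewrite ge0_integralZlR ?mulr_ge0 ?expR_ge0 ?(ltW (rho_gt0 x))//.
  by rewrite integral_ballI -EFinM lee_fin; lra.
have -> : ((2 * mh rho r x)%:E = \int[mu]_y (ballI r x y * rho y +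
    ballI r x (x + x - y) * rho (x + x - y))%:E)%E.
  under eq_integral do rewrite EFinD.
  have G0 y : (0 <= (ballI r x (x + x - y) * rho (x + x - y))%:E)%E by exact: F0.
  have mG : measurable_fun [set: X] (fun y => (ballI r x (x + x - y) * rho (x + x - y))%:E).
    exact/measurable_EFinP.
  rewrite ge0_integralD//.
  rewrite E1 (mhE mrho rho_gt0 rho_loc) -EFinD; congr (_%:E); ring.
apply: ge0_le_integralR => //.
- exact: measurable_funM.
- by apply: measurable_funD => //; exact/measurable_EFinP.
- by move=> y; rewrite !mulr_ge0 ?expR_ge0 ?ballI_ge0 ?(ltW (rho_gt0 x)).
move=> y.
have -> : ballI r x (x + x - y) = ballI r x y.
  rewrite /ballI (_ : x + x - y - x = - (y - x)) ?enormN//.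
  by apply/rowP => i; rewrite !mxE; ring.
rewrite -mulrDr mulrC; rewrite /ballI; case: ltP => [xy|_]; last by rewrite !mul0r.
rewrite !mul1r.
pose v := y - x.
have -> : y = x + v by rewrite /v addrC subrK.
have -> : x + x - (x + v) = x - v by apply/rowP => i; rewrite !mxE; ring.
rewrite !rhoE !sqr_enorm.
have eD : edot (x + v) (x + v) = edot x x + 2 * edot x v + edot v v.
  rewrite /edot mulr_sumr -!big_split /=; apply: eq_bigr => i _; rewrite !mxE; ring.
have eB : edot (x - v) (x - v) = edot x x - 2 * edot x v + edot v v.
  rewrite /edot mulr_sumr -sumrB -!big_split /=; apply: eq_bigr => i _; rewrite !mxE; ring.
have vh : edot v v <= h ^+ 2.
  rewrite -sqr_enorm lerXn2r ?nnegrE ?enorm_ge0 ?(le_trans (ltW r0))//.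
  exact: le_trans (ltW xy) rh.
rewrite eD eB.
set A := edot x x; set B := edot x v; set D := edot v v in vh *.
have -> : beta * expR (- alpha * (A + 2 * B + D)) + beta * expR (- alpha * (A - 2 * B + D)) =
  beta * expR (- alpha * A) * expR (- (alpha * D)) *
    (expR (- (2 * alpha * B)) + expR (2 * alpha * B)).
  have e1 : expR (- alpha * (A + 2 * B + D)) =
      expR (- alpha * A) * expR (- (alpha * D)) * expR (- (2 * alpha * B)).
    by rewrite -!expRD; congr expR; ring.
  have e2 : expR (- alpha * (A - 2 * B + D)) =
      expR (- alpha * A) * expR (- (alpha * D)) * expR (2 * alpha * B).
    by rewrite -!expRD; congr expR; ring.
  by rewrite e1 e2; ring.
have -> : 2 * (expR (- (alpha * h ^+ 2)) * (beta * expR (- alpha * A))) =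
  beta * expR (- alpha * A) * expR (- (alpha * h ^+ 2)) * 2 by ring.
have p : 0 <= beta * expR (- alpha * A) by rewrite mulr_ge0 ?expR_ge0 ?(ltW b0).
apply: ler_pM => //; first by rewrite mulr_ge0 ?expR_ge0.
  by rewrite ler_wpM2l// ler_expR lerN2 ler_wpM2l// ltW.
by have := expR_ge1Dx (2 * alpha * B); have := expR_ge1Dx (- (2 * alpha * B)); lra.
Qed.

End LocalComparison.

Lemma supTV_le (R : realType) (d : nat) (rho : 'rV[R]_d -> R) h n tau (c : R) :
  (forall x, enorm x < tau -> (TVdist rho h n x <= c%:E)%E) -> (supTV rho h n tau <= c%:E)%E.
Proof. by move=> H; apply: ge_ereal_sup => _ [x xt <-]; exact: H. Qed.

(** On a one-point space both measures are the point mass. *)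
Lemma supTV_dim0 (R : realType) (rho : 'rV[R]_0 -> R) h n tau (c : R) :
  0 < h -> (forall x, 0 < rho x) -> 0 <= c -> (supTV rho h n tau <= c%:E)%E.
Proof.
move=> h0 r0 c0; apply: supTV_le => x _; apply: ge_ereal_sup => _ [A _ <-].
have r00 : rho 0 != 0 by rewrite gt_eqF.
have b1 (y : 'rV[R]_0) : ballI h x y = 1 by rewrite /ballI !thinmx0 enorm0 h0.
have mE : mh rho h x = rho 0 by rewrite /mh /= b1 mul1r.
have TE : Tn rho h n x A = (\1_A x)%:E.
  elim: n => //= n IH; rewrite mE b1 mul1r.
  rewrite (_ : Tn rho h n 0 A = (\1_A x)%:E); last by rewrite -IH !thinmx0.
  by rewrite -!EFinM mulKf.
have nE : nuh rho h A = (\1_A x)%:E.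
  rewrite /nuh /Zh /= -EFinM (_ : mh rho h 0 = rho 0); last by rewrite -mE !thinmx0.
  rewrite (_ : \1_A 0 = \1_A x :> R); last by rewrite !thinmx0.
  by congr (_%:E); field.
by rewrite TE nE subee// abse0 lee_fin.
Qed.

Lemma square_mass_gt0 (R : realType) (d : nat) (rho : 'rV[R]_d -> R) (E : set (Rd R d))
    (x : 'rV[R]_d) (r : R) : measurable_fun [set: Rd R d] rho -> (forall y, 0 < rho y) ->
  measurable E -> 0 < r -> (forall y, enorm (y - x) < r -> E y) ->
  exists2 s : R, 0 < s & (s%:E <= \int[@leb R d]_y (\1_E y * rho y ^+ 2)%:E)%E.
Proof.
move=> mrho r0 mE r1 sub.
have mF : measurable_fun [set: Rd R d] (fun y => \1_E y * rho y ^+ 2).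
  by apply: measurable_funM; [exact: measurable_indic|exact: (measurable_funX 2 mrho)].
have F0 y : 0 <= \1_E y * rho y ^+ 2 by rewrite indicE mulr_ge0 ?sqr_ge0.
have I0 : (0 <= \int[@leb R d]_y (\1_E y * rho y ^+ 2)%:E)%E.
  by apply: integral_ge0 => y _; rewrite lee_fin.
have : (\int[@leb R d]_y (\1_E y * rho y ^+ 2)%:E != 0)%E.
  apply/eqP => /(ae_zero_of_integral0 mF F0)[N [mN N0 sN]].
  have [z Nz zx] := conull_ball x mN N0 r1.
  apply: Nz; apply: sN => /= /eqP.
  rewrite indicE mem_set ?mul1r ?expf_eq0/= ?gt_eqF//.
  exact: sub.
(* For an infinite integral any positive s serves. *)
move: I0; case: (integral _ _ _) => [s| |] //; last by exists 1 => //; rewrite leey.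
by rewrite lee_fin eqe => s0 sn; exists s => //; rewrite lt_neqAle eq_sym sn.
Qed.

(** The linear smallness is for the Harnack constant e^(-L h), the quadratic one for e^(-alpha h^2)
    and for the bound on the gap. *)
Lemma small_scale (R : realType) (c e : R) : 0 <= c -> 0 < e ->
  exists2 h0 : R, 0 < h0 & forall h, 0 < h -> h <= h0 ->
    [/\ h <= 1, c * h < e & c * h ^+ 2 < e].
Proof.
move=> c0 e0; have p : 0 < c + 1 by rewrite ltr_wpDl.
exists (Num.min 1 (e / (c + 1))); first by rewrite lt_min ltr01 divr_gt0.
move=> h h0; rewrite le_min => /andP[h1]; rewrite ler_pdivlMr// mulrC mulrDl mul1r => he.
have ch : c * h < e by lra.
split=> //; apply: le_lt_trans (ch).
by rewrite expr2 mulrA ler_piMr ?mulr_ge0 ?(ltW h0).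
Qed.

(** * Choice of constants for the two classes of densities *)

Section Assembly.
Variables (R : realType) (d : nat) (rho : 'rV[R]_d -> R) (i : 'I_d).
Local Notation X := (Rd R d).
Local Notation mu := (@leb R d).
Hypothesis drho : density rho.

Let crho : continuous rho. Proof. by case: drho => -[]. Qed.
Let mrho : measurable_fun [set: X] rho. Proof. exact: continuous_measurable_Rd. Qed.
Let rho_gt0 x : 0 < rho x. Proof. by case: drho => _ []. Qed.
Let rho_int : (\int[mu]_x (rho x)%:E = 1)%E.
Proof.
case: drho => _ [_ [_ I1]]; rewrite integral_leb//.
  by move=> x; rewrite lee_fin ltW.
exact/measurable_EFinP.
Qed.
Let rho_lty : (\int[mu]_x (rho x)%:E < +oo)%E. Proof. by rewrite rho_int ltry. Qed.
Let rho_le1 : (\int[mu]_x (rho x)%:E <= 1)%E. Proof. by rewrite rho_int. Qed.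

Lemma density_loc r x : (\int[mu]_y (ballI r x y * rho y)%:E < +oo)%E.
Proof.
apply: le_lt_trans rho_lty; apply: ge0_le_integralR => //.
- by apply: measurable_funM => //; exact: measurable_ballI1.
- by move=> y; rewrite mulr_ge0 ?ballI_ge0// ltW.
- by move=> y; rewrite ler_piMl ?ballI_le1// ltW.
Qed.

Let E0 : set X := [set x | (x : 'rV[R]_d) ord0 i <= 0].
Let E1 : set X := [set x | 1 <= (x : 'rV[R]_d) ord0 i].

Lemma half_space_masses : exists2 s : R, 0 < s &
  (s%:E <= \int[mu]_x (\1_E0 x * rho x ^+ 2)%:E)%E /\
  (s%:E <= \int[mu]_x (\1_E1 x * rho x ^+ 2)%:E)%E.
Proof.
have mE0 : measurable E0 := measurable_coord_le i 0.
have mE1 : measurable E1 := measurable_coord_ge i 1.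
have co (a : R) (y : 'rV[R]_d) : enorm (y - const_mx a) < 1 -> `|y ord0 i - a| < 1.
  by apply: le_lt_trans; have := ler_coord_enorm (y - const_mx a) i; rewrite !mxE.
have [s0 s00 s01] := @square_mass_gt0 R d rho E0 (const_mx (-1)) 1 mrho rho_gt0 mE0 ltr01
  (fun y => ltac:(by move=> /co; rewrite ltr_norml /E0 /=; lra)).
have [s1 s10 s11] := @square_mass_gt0 R d rho E1 (const_mx 2) 1 mrho rho_gt0 mE1 ltr01
  (fun y => ltac:(by move=> /co; rewrite ltr_norml /E1 /=; lra)).
exists (Num.min s0 s1); first by rewrite lt_min s00.
by split; [apply: le_trans s01|apply: le_trans s11]; rewrite lee_fin ge_min lexx ?orbT.
Qed.

Variables (M s : R).
Hypothesis rho_le : forall x, rho x <= M.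
Hypothesis s_gt0 : 0 < s.
Hypothesis sE0 : (s%:E <= \int[mu]_x (\1_E0 x * rho x ^+ 2)%:E)%E.
Hypothesis sE1 : (s%:E <= \int[mu]_x (\1_E1 x * rho x ^+ 2)%:E)%E.

Let M0 : 0 < M. Proof. exact: lt_le_trans (rho_gt0 0) (rho_le 0). Qed.
Let eps h := 2 * M / s * h ^+ 2.

Lemma TVdist_bound (theta h K c : R) n0 n x : 0 < h ->
  1 - (2 ^+ d)^-1 / 4 <= theta <= 1 -> 2 * M / s * h ^+ 2 < (2 ^+ d)^-1 / 8 ->
  (forall r x, 0 < r -> r <= h -> theta * vol d r * rho x <= mh rho r x) ->
  0 <= K -> (forall f, sqint mu rho (mh rho h) f ->
    `|iter n0 (op mu (@ballI R d h) rho (mh rho h)) f x| <=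
      K * Num.sqrt (wip mu rho (mh rho h) f f)) ->
  1 <= c -> K * Num.sqrt (M * vol d h) <= c ->
  (TVdist rho h n x <= (c * expR (n0%:R * (2 * M / s * h ^+ 2))
     * expR (- n%:R * spectral_gap rho h))%:E)%E.
Proof.
move=> h0 th small low K0 HK c1 Kc.
have t1 : (2 ^+ d)^-1 <= 1 :> R by rewrite invf_le1 ?exprn_gt0// exprn_ege1// ler1n.
have theta0 : 0 < theta by case/andP: th => + _; lra.
have [ge contr] := walk_gap mrho rho_gt0 rho_le density_loc h0 theta0 low rho_lty
  s_gt0 sE0 sE1 rho_le1 th small.
have e0 : 0 <= 2 * M / s * h ^+ 2.
  by rewrite mulr_ge0 ?sqr_ge0// divr_ge0 ?(ltW s_gt0)// mulr_ge0 ?(ltW M0).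
apply: (TVdist_contraction mrho rho_gt0 rho_le density_loc h0 theta0 low rho_lty n
  e0 ge contr K0 HK c1).
apply: le_trans Kc; rewrite ler_wpM2l// ler_wsqrtr//.
exact: (Zh_le mrho rho_gt0 rho_le density_loc h0 theta0 low rho_lty rho_le1).
Qed.

Lemma theta_inv_le2 (theta : R) : 1 - (2 ^+ d)^-1 / 4 <= theta <= 1 -> theta^-1 <= 2.
Proof.
have t1 : (2 ^+ d)^-1 <= 1 :> R by rewrite invf_le1 ?exprn_gt0// exprn_ege1// ler1n.
case/andP => th _; have theta0 : 0 < theta by lra.
by rewrite -div1r ler_pdivrMr//; lra.
Qed.

Lemma gaussian_bound (alpha beta : R) : 0 < alpha -> 0 < beta ->
  (forall x, rho x = beta * expR (- alpha * enorm x ^+ 2)) ->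
  exists C h0 : R, 0 < C /\ 0 < h0 /\
    forall (n : nat) (h tau : R), 0 < h -> h <= h0 -> 0 < tau ->
      (supTV rho h n tau <= (C * expR (alpha * tau * (tau + 3 * h))
             * expR (- n%:R * spectral_gap rho h))%:E)%E.
Proof.
move=> a0 b0 rhoE.
set t : R := (2 ^+ d)^-1.
have t0 : 0 < t by rewrite invr_gt0 exprn_gt0.
have Ms0 : 0 <= M / s by rewrite divr_ge0 ?(ltW M0) ?(ltW s_gt0).
(* Making this constant times h^2 less than t secures both alpha h^2 < t / 4 and 2 M / s h^2 < t /
   8. *)
have c0 : 0 <= 4 * alpha + 16 * (M / s) by lra.
have [h0 h00 hs] := small_scale c0 t0.
have V1 : 0 < vol d (1 : R) by exact: vol_gt0.
pose H := heat_time R d.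
pose c1 := Num.sqrt (4 * M / vol d 1).
pose C1 := expR (alpha * H) * c1 / beta.
have C10 : 0 <= C1 by rewrite divr_ge0 ?(ltW b0)// mulr_ge0 ?expR_ge0 ?sqrtr_ge0.
(* [C1] comes from the pointwise heat bound, 1 is added for the times n < n0, and the exponential
   bounds e^(n0 eps) because n0 h^2 <= [H]. *)
exists ((1 + C1) * expR (2 * M / s * H)), h0; split.
  by rewrite mulr_gt0 ?expR_gt0// ltr_pwDl.
split=> // n h tau hp hh tau0; apply: supTV_le => x xt.
have [h1 ch ch2] := hs h hp hh.
have ah : 0 <= alpha * h ^+ 2 by rewrite mulr_ge0 ?sqr_ge0 ?(ltW a0).
have Mh : 0 <= M / s * h ^+ 2 by rewrite mulr_ge0 ?sqr_ge0.
have h01 : 0 < h <= 1 by rewrite hp.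
set theta := expR (- (alpha * h ^+ 2)).
have theta0 : 0 < theta by exact: expR_gt0.
have th : 1 - t / 4 <= theta <= 1.
  rewrite -[X in _ && (_ <= X)]expR0 ler_expR oppr_le0 ah andbT.
  by apply: le_trans (expR_ge1Dx _); lra.
have small : 2 * M / s * h ^+ 2 < t / 8.
  have -> : 2 * M / s * h ^+ 2 = 2 * (M / s * h ^+ 2) by ring.
  by lra.
have low := gaussian_mh_ge mrho rho_gt0 density_loc a0 b0 rhoE (h := h).
have [n0 n0h HK] := dominated_heat_bound mrho rho_gt0 density_loc h01 theta0 low.
have V0 : 0 < vol d h by exact: vol_gt0.
have ti0 : 0 <= theta^-1 by rewrite invr_ge0 ltW.
set K := theta^-1 ^+ n0 * (rho x)^-1 * Num.sqrt (2 / (vol d h * vol d 1)) * Num.sqrt theta^-1.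
have K0 : 0 <= K.
  by rewrite /K !mulr_ge0 ?sqrtr_ge0 ?exprn_ge0 ?invr_ge0 ?(ltW theta0) ?(ltW (rho_gt0 x)).
pose q := expR (alpha * tau * (tau + 3 * h)).
have q1 : 1 <= q.
  rewrite -expR0 ler_expR mulr_ge0 ?mulr_ge0 ?(ltW a0) ?(ltW tau0)// addr_ge0 ?(ltW tau0)//.
  by rewrite mulr_ge0// ltW.
have KC : K * Num.sqrt (M * vol d h) <= (1 + C1) * q.
  have thn : theta^-1 ^+ n0 <= expR (alpha * H).
    rewrite -expRN opprK -expRM_natl ler_expR mulrCA ler_wpM2l ?(ltW a0)//.
  have rx : (rho x)^-1 <= beta^-1 * q.
    rewrite rhoE invfM ler_wpM2l ?invr_ge0 ?(ltW b0)//.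
    rewrite -expRN ler_expR mulNr opprK -mulrA ler_wpM2l ?(ltW a0)//.
    apply: (@le_trans _ _ (tau ^+ 2)).
      by rewrite lerXn2r ?nnegrE ?enorm_ge0 ?(ltW tau0)// ltW.
    by rewrite expr2 ler_wpM2l ?(ltW tau0)// lerDl mulr_ge0// ltW.
  (* The heat bound contributes vol(h)^(-1/2) and the norm of a bounded function vol(h)^(1/2): they
     cancel, so no power of h survives. *)
  have sq : Num.sqrt (2 / (vol d h * vol d 1)) * Num.sqrt theta^-1 * Num.sqrt (M * vol d h)
      <= c1.
    have p1 : 0 <= 2 / (vol d h * vol d 1) by rewrite divr_ge0// mulr_ge0// ltW.
    have p2 : 0 <= 2 / (vol d h * vol d 1) * theta^-1 by rewrite mulr_ge0.
    rewrite -(sqrtrM _ p1) -(sqrtrM _ p2); apply: ler_wsqrtr.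
    have -> : 2 / (vol d h * vol d 1) * theta^-1 * (M * vol d h) =
      2 * M / vol d 1 * theta^-1 by field; rewrite !gt_eqF.
    have -> : 4 * M / vol d 1 = 2 * M / vol d 1 * 2 by ring.
    by rewrite ler_wpM2l ?(theta_inv_le2 th)// divr_ge0 ?(ltW V1)// mulr_ge0// ltW.
  have -> : K * Num.sqrt (M * vol d h) = theta^-1 ^+ n0 * (rho x)^-1 *
    (Num.sqrt (2 / (vol d h * vol d 1)) * Num.sqrt theta^-1 * Num.sqrt (M * vol d h)).
    by rewrite /K; ring.
  apply: (@le_trans _ _ (expR (alpha * H) * (beta^-1 * q) * c1)).
    apply: ler_pM => //.
    - by rewrite mulr_ge0 ?exprn_ge0 ?invr_ge0 ?(ltW theta0) ?(ltW (rho_gt0 x)).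
    - by apply: ler_pM => //; rewrite ?exprn_ge0 ?invr_ge0 ?(ltW theta0) ?(ltW (rho_gt0 x)).
  rewrite mulrDl mul1r; have -> : C1 * q = expR (alpha * H) * (beta^-1 * q) * c1.
    by rewrite /C1; ring.
  by rewrite lerDr (le_trans ler01).
have c1' : 1 <= (1 + C1) * q by rewrite mulr_ege1// lerDl.
apply: le_trans (TVdist_bound n hp th small low K0 (fun f hf => HK f hf x) c1' KC) _.
rewrite lee_fin ler_wpM2r ?expR_ge0//.
rewrite -/q [(1 + C1) * expR _ * _]mulrAC ler_wpM2l ?(le_trans ler01)// ler_expR.
have -> : n0%:R * (2 * M / s * h ^+ 2) = 2 * M / s * (n0%:R * h ^+ 2) by ring.
by rewrite ler_wpM2l// divr_ge0 ?(ltW s_gt0)// mulr_ge0// ltW.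
Qed.

Lemma tempered_bound : tempered_exp rho ->
  exists C h0 : R, 0 < C /\ 0 < h0 /\
    forall (n : nat) (h tau : R), 0 < h -> h <= h0 -> 0 < tau ->
      (supTV rho h n tau <=
        (C * (h `^ (- (d%:R / 2)) * sup [set (rho x)^-1 | x in [set x | enorm x < tau]])
             * expR (- n%:R * spectral_gap rho h))%:E)%E.
Proof.
move=> [sm [bd _]].
have [Cf HCf] := choice (fun j : 'I_d => bd [:: j]).
pose CL := \sum_j Cf j.
have CL0 : 0 <= CL by apply: sumr_ge0 => j _; apply: ltW; case: (HCf j).
pose L := d%:R * CL.
have L0 : 0 <= L by rewrite mulr_ge0.
have har : forall x y, expR (- (L * enorm (y - x))) * rho x <= rho y.
  apply: harnack => //.
  - by move=> x j; have [_ /(_ x j)] := sm [::].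
  - move=> x j; have [_ /(_ x)/= le] := HCf j; apply: le_trans le _.
    rewrite ler_wpM2r ?(ltW (rho_gt0 x))// /CL (bigD1 j)//= lerDl.
    by apply: sumr_ge0 => l _; apply: ltW; case: (HCf l).
set t : R := (2 ^+ d)^-1.
have t0 : 0 < t by rewrite invr_gt0 exprn_gt0.
have t1 : t <= 1 by rewrite invf_le1 ?exprn_gt0// exprn_ege1// ler1n.
have Ms0 : 0 <= M / s by rewrite divr_ge0 ?(ltW M0) ?(ltW s_gt0).
have c0 : 0 <= 4 * L + 16 * (M / s) by lra.
have [h0 h00 hs] := small_scale c0 t0.
have V1 : 0 < vol d (1 : R) by exact: vol_gt0.
(* The summand [M] ensures 1 <= C0 P S, as the supremum of 1 / rho is at least 1 / M. The other is
   the one-step bound, where vol(h)^(-1) vol(h)^(1/2) gives the power h^(-d/2). *)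
pose C0 := M + 2 * Num.sqrt (2 * M / vol d 1).
have C00 : 0 < C0 by rewrite ltr_pwDl// mulr_ge0 ?sqrtr_ge0.
exists (C0 * expR 1), h0; split; first by rewrite mulr_gt0 ?expR_gt0.
split=> // n h tau hp hh tau0; apply: supTV_le => x xt.
have [h1 ch ch2] := hs h hp hh.
have Lh : 0 <= L * h by rewrite mulr_ge0 ?(ltW hp).
have Lh2 : 0 <= L * h ^+ 2 by rewrite mulr_ge0 ?sqr_ge0.
have Mh : 0 <= M / s * h by rewrite mulr_ge0 ?(ltW hp).
have Mh2 : 0 <= M / s * h ^+ 2 by rewrite mulr_ge0 ?sqr_ge0.
set theta := expR (- (L * h)).
have theta0 : 0 < theta by exact: expR_gt0.
have th : 1 - t / 4 <= theta <= 1.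
  rewrite -[X in _ && (_ <= X)]expR0 ler_expR oppr_le0 Lh andbT.
  by apply: le_trans (expR_ge1Dx _); lra.
have small : 2 * M / s * h ^+ 2 < t / 8.
  have -> : 2 * M / s * h ^+ 2 = 2 * (M / s * h ^+ 2) by ring.
  by lra.
have low := harnack_mh_ge mrho rho_gt0 density_loc L0 har (h := h).
have V0 : 0 < vol d h by exact: vol_gt0.
have ti0 : 0 <= theta^-1 by rewrite invr_ge0 ltW.
set K := (theta * vol d h * rho x)^-1 * Num.sqrt theta^-1.
have K0 : 0 <= K.
  by rewrite mulr_ge0 ?sqrtr_ge0// invr_ge0 !mulr_ge0 ?(ltW theta0) ?(ltW V0) ?(ltW (rho_gt0 x)).
have HK f : sqint mu rho (mh rho h) f ->
    `|iter 1 (op mu (@ballI R d h) rho (mh rho h)) f x| <=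
      K * Num.sqrt (wip mu rho (mh rho h) f f).
  exact: (walk_op_bound mrho rho_gt0 density_loc hp theta0 low).
set S := sup _.
(* The supremum is meaningful only for a set bounded above; Harnack from the origin bounds 1 / rho
   on the ball. *)
have rS : (rho x)^-1 <= S.
  apply: ub_le_sup; last by exists x.
  exists (expR (L * tau) / rho 0) => _ [y yt <-].
  have := har 0 y; rewrite subr0 => hy.
  rewrite -[leRHS]invrK lef_pV2 ?posrE ?invr_gt0 ?divr_gt0 ?expR_gt0//.
  rewrite invf_div; apply: le_trans hy; rewrite mulrC -expRN ler_wpM2r ?(ltW (rho_gt0 0))//.
  by rewrite ler_expR lerN2 ler_wpM2l// ltW.
have S0 : M^-1 <= S by apply: le_trans rS; rewrite lef_pV2 ?posrE.
have S00 : 0 <= S by apply: le_trans S0; rewrite invr_ge0 ltW.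
set P := h `^ _.
have PE : P = (Num.sqrt (h ^+ d))^-1.
  by rewrite /P powRN powRrM powR_mulrn ?(ltW hp)// powR12_sqrt// exprn_ge0// ltW.
have hd0 : 0 < h ^+ d by rewrite exprn_gt0.
have P1 : 1 <= P.
  rewrite PE invf_ge1 ?sqrtr_gt0// -[leRHS]sqrtr1 ler_wsqrtr// exprn_ile1// ltW//.
have P0 : 0 <= P := le_trans ler01 P1.
have c1 : 1 <= C0 * (P * S).
  apply: (@le_trans _ _ (M * (1 * M^-1))); first by rewrite mul1r divff// gt_eqF.
  apply: ler_pM; rewrite ?(ltW M0) ?mulr_ge0 ?invr_ge0 ?(ltW M0)//.
    by rewrite lerDl mulr_ge0 ?sqrtr_ge0.
  by apply: ler_pM; rewrite ?invr_ge0 ?(ltW M0).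
have KC : K * Num.sqrt (M * vol d h) <= C0 * (P * S).
  have volE : vol d h = h ^+ d * vol d 1 by rewrite -[X in vol d X]mulr1 volM.
  have sE : Num.sqrt theta^-1 * Num.sqrt (M * vol d h) <=
      Num.sqrt (2 * M / vol d 1) * (vol d h * P).
    rewrite -sqrtrM//.
    have -> : vol d h * P = Num.sqrt (vol d 1 ^+ 2 * h ^+ d).
      rewrite PE volE sqrtrM ?sqr_ge0// sqrtr_sqr ger0_norm ?(ltW V1)//.
      rewrite -{1}(sqr_sqrtr (ltW hd0)); field; rewrite gt_eqF// sqrtr_gt0//.
    rewrite -sqrtrM; last by rewrite divr_ge0 ?(ltW V1)// mulr_ge0// ltW.
    apply: ler_wsqrtr; rewrite volE.
    have -> : 2 * M / vol d 1 * (vol d 1 ^+ 2 * h ^+ d) = 2 * (M * (h ^+ d * vol d 1)).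
      by field; rewrite gt_eqF.
    rewrite ler_wpM2r ?(theta_inv_le2 th)// mulr_ge0 ?(ltW M0)// mulr_ge0 ?(ltW V1)// ltW//.
  have -> : K * Num.sqrt (M * vol d h) = (theta * vol d h * rho x)^-1 *
      (Num.sqrt theta^-1 * Num.sqrt (M * vol d h)) by rewrite /K; ring.
  apply: le_trans (ler_wpM2l _ sE) _.
    by rewrite invr_ge0 !mulr_ge0 ?(ltW theta0) ?(ltW V0) ?(ltW (rho_gt0 x)).
  have -> : (theta * vol d h * rho x)^-1 * (Num.sqrt (2 * M / vol d 1) * (vol d h * P)) =
      theta^-1 * Num.sqrt (2 * M / vol d 1) * (P * (rho x)^-1).
    by field; rewrite !gt_eqF.
  apply: ler_pM.
  - by rewrite mulr_ge0 ?sqrtr_ge0.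
  - by rewrite mulr_ge0 ?invr_ge0 ?(ltW (rho_gt0 x)).
  - rewrite /C0 (@le_trans _ _ (2 * Num.sqrt (2 * M / vol d 1)))//.
      by rewrite ler_wpM2r ?sqrtr_ge0 ?(theta_inv_le2 th).
    by rewrite lerDr ltW.
  - by rewrite ler_wpM2l.
apply: le_trans (TVdist_bound n hp th small low K0 HK c1 KC) _.
rewrite lee_fin ler_wpM2r ?expR_ge0//.
rewrite [C0 * expR 1 * _]mulrAC ler_wpM2l ?(le_trans ler01)//.
(* Here n0 = 1 and eps < t / 8 <= 1, so e^(n0 eps) is absorbed by the factor e. *)
rewrite ler_expR mul1r; lra.
Qed.

End Assembly.

Theorem theorem5p3 (R : realType) (d : nat) (rho : 'rV[R]_d -> R) :
  density rho ->
  (* Gaussian case *)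
  (forall alpha beta : R, 0 < alpha -> 0 < beta ->
     (forall x, rho x = beta * expR (- alpha * enorm x ^+ 2)) ->
     exists C h0 : R, 0 < C /\ 0 < h0 /\
       forall (n : nat) (h tau : R), 0 < h -> h <= h0 -> 0 < tau ->
         (supTV rho h n tau <=
          (C * expR (alpha * tau * (tau + 3 * h))
             * expR (- n%:R * spectral_gap rho h))%:E)%E) /\
  (* smooth tempered of exponential type case *)
  (tempered_exp rho ->
     exists C h0 : R, 0 < C /\ 0 < h0 /\
       forall (n : nat) (h tau : R), 0 < h -> h <= h0 -> 0 < tau ->
         (supTV rho h n tau <=
          (C * (h `^ (- (d%:R / 2)) * sup [set (rho x)^-1 | x in [set x | enorm x < tau]])
             * expR (- n%:R * spectral_gap rho h))%:E)%E).
Proof.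
move=> drho; have rho_gt0 : forall x, 0 < rho x by case: drho => _ [].
have [M rho_le] : exists M, forall x, rho x <= M by case: drho => _ [_ []].
case: d rho drho rho_gt0 rho_le => [|d] rho drho rho_gt0 rho_le.
  split=> [alpha beta a0 b0 _|_]; exists 1, 1; split=> //; split=> // n h tau h0 _ tau0.
    by apply: supTV_dim0 => //; rewrite mul1r mulr_ge0 ?expR_ge0.
  apply: supTV_dim0 => //; rewrite mul1r !mulr_ge0 ?expR_ge0 ?powR_ge0//.
  rewrite (_ : [set _ | _ in _] = [set (rho 0)^-1]) ?sup1 ?invr_ge0 ?(ltW (rho_gt0 0))//.
  apply/seteqP; split=> [_ [x _ <-]|_ ->]; first by rewrite /= !thinmx0.
  by exists 0 => //=; rewrite enorm0.
have [s s0 [s1 s2]] := half_space_masses ord0 drho.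
split=> [alpha beta a0 b0 rhoE|temp].
  exact: (gaussian_bound drho rho_le s0 s1 s2 a0 b0 rhoE).
exact: (tempered_bound drho rho_le s0 s1 s2 temp).
Qed.
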